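(* Let $(Q,W)$ be the quiver with potential associated to a geometrically consistent brane tiling with bipartite graph $G$, let $A=\mathbb{C}Q/(\partial W)$, $\alpha=(1,\dots,1)\in\mathbb{Z}^{Q_0}$, let $\theta\in B$ be $\alpha$-generic, and let $\mathcal{M}_\theta=\mathcal{M}_\theta(A,\alpha)$. Let $O_x\subset\mathcal{M}_\theta$ be a one-dimensional $T_M$-orbit and let $(a_1,\dots,a_{2k})$ be the big component of the cosupport $I_x$, which is a cycle (with consecutive edges $a_1,\dots,a_{2k}$). Then there are precisely two $2$-dimensional $T_M$-orbits in $\mathcal{M}_\theta$ containing $O_x$ in their closures. The corresponding perfect matchings (the cosupports of these orbits) are $$I_x\setminus\{a_1,a_3,\dots,a_{2k-1}\},\qquad I_x\setminus\{a_2,a_4,\dots,a_{2k}\}.$$ These are the only perfect matchings contained in $I_x$, and $I_x$ is the union of these perfect matchings.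
   Context: Brane tilings. A brane tiling is a bipartite graph $G=(G_0^\pm,G_1)$ (white vertices $G_0^+$, black vertices $G_0^-$) embedded in the real two-dimensional torus $T$ so that all connected components of $T\setminus G$ are simply connected; the set of these faces is $G_2$. The dual quiver $Q=(Q_0,Q_1)$ has $Q_0=G_2$ and $Q_1=G_1$; the arrow $a$ joins the two faces of $G$ adjacent to the edge $a$ and is directed so that the white endpoint lies on the right of $a$. $Q$ is embedded in $T$ and its set of faces $Q_2$ is identified with $G_0$, $Q_2=Q_2^+\sqcup Q_2^-$. The arrows around every face $F\in Q_2$ form an oriented cycle $w_F$. Put $W=\sum_{F\in Q_2^+}w_F-\sum_{F\in Q_2^-}w_F$; for a cycle $u=a_1\cdots a_n$, $\partial u/\partial a=\sum_{i:\,a_i=a}a_{i+1}\cdots a_na_1\cdots a_{i-1}$; $(\partial W)$ is the two-sided ideal generated by all $\partial W/\partial a$, and $A=\mathbb{C}Q/(\partial W)$. Geometric consistency: there is a map $R:Q_1\to(0,1)$ with $\sum_{a\in F}R_a=2$ for all $F\in Q_2$ and $\sum_{a\ni i}(1-R_a)=2$ for all $i\in Q_0$ (sum over arrows incident to $i$, loops counted twice). Groups. $d_2(F)=\sum_{a\in F}a\in\mathbb{Z}^{Q_1}$ for $F\in Q_2$, $d_1(a)=t(a)-s(a)\in\mathbb{Z}^{Q_0}$ for $a\in Q_1$, $\Lambda=\mathbb{Z}^{Q_1}/\langle d_2(F)-d_2(F')\mid F,F'\in Q_2\rangle$, $d:\Lambda\to\mathbb{Z}^{Q_0}$ is induced by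 $d_1$, $M=\ker d$ (free of rank 3), $B=\ker(\mathbb{Z}^{Q_0}\to\mathbb{Z},\ i\mapsto1)=\operatorname{im}d$. For a lattice $L$ put $T_L=\operatorname{Hom}_{\mathbb{Z}}(L,\mathbb{C}^* )$; $T_M=T_\Lambda/T_B$. Moduli. $R(A,\alpha)\subset\mathbb{C}^{Q_1}$ is the variety of representations $x=(x_a)_{a\in Q_1}$ of $Q$ of dimension $\alpha$ satisfying the relations of $W$; $T_\Lambda\subset(\mathbb{C}^* )^{Q_1}$ acts on it by coordinatewise multiplication, and $T_B$ acts via $d$, i.e. by change of basis. $\theta\in B$ is $\alpha$-generic if $\theta\cdot\beta\ne0$ for all $0<\beta<\alpha$ in $\mathbb{Z}^{Q_0}$. $X\in R(A,\alpha)$ is $\theta$-semistable (resp. stable) if $\theta\cdot\dim Y\ge0$ (resp. $>0$) for all proper nonzero subrepresentations $Y\subset X$. $\mathcal{M}_\theta=R(A,\alpha)/\!/_\theta T_B$ is the moduli space of $\theta$-semistable left $A$-modules of dimension $\alpha$; it carries an action of $T_M$. Cosupports. For $x\in\mathcal{M}_\theta$ its cosupport is $I_x=\{a\in Q_1\mid x_a=0\}$, regarded as a subgraph of $G$ via $Q_1=G_1$; it is constant on $T_M$-orbits. A connected component of $I_x$ is big if it has more than one edge; there is at most one, and for a one-dimensional orbit it exists and is a cycle. The cosupport of every 2-dimensional orbit is a perfect matching (a set of edges of $G$ such that every vertex of $G$ is incident with exactly one of them). *)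

(* Defs.v *)
From HB Require Import structures.
From mathcomp Require Import all_boot all_order all_fingroup all_algebra.
From mathcomp Require Import mpoly complex.
From mathcomp Require Import classical_sets reals.

Set Implicit Arguments.
Unset Strict Implicit.
Unset Printing Implicit Defensive.

Import Order.TTheory GRing.Theory Num.Theory.
Local Open Scope classical_set_scope.
Local Open Scope ring_scope.

(* A bipartite graph embedded in a closed oriented surface with simply
   connected faces is determined up to orientation-preserving homeomorphism
   by its edges and the rotations of the edges around the vertices.
   The white (black) vertices are the cycles of [white] ([black]), listing the
   edges clockwise around a white vertex and counterclockwise around a black
   one.  Since arrows of the dual quiver have the white endpoint of their edge
   on the right, [white] and [black] both map an arrow to its successor in the
   oriented cycle w_F, and the source of [white (black^-1 a)] is that of [a]:
   the faces of G are the cycles of [black^-1 * white] (permutations compose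
   left to right), each given as the set of arrows starting at it.
   The last field, V - E + F = 0, says that the surface is a torus. *)
Record brane_tiling := BraneTiling {
  edge : finType;
  white : {perm edge};
  black : {perm edge};
  tiling_connected :
    [transitive <<[set white; black]%SET>>%g, on [set: edge]%SET | 'P];
  tiling_torus :
    (#|porbits white| + #|porbits black| + #|porbits (black^-1 * white)%g|
     = #|edge|)%N }.

Definition face_perm (T : brane_tiling) : {perm edge T} :=
  ((black T)^-1 * white T)%g.

(* Q_0 = G_2 *)
Definition face (T : brane_tiling) : finType :=
  {F : {set edge T} | F \in porbits (face_perm T)}.

Definition src (T : brane_tiling) (a : edge T) : face T :=
  exist _ (porbit (face_perm T) a) (imset_f _ (isT : a \in edge T)).

Definition tgt (T : brane_tiling) (a : edge T) : face T := src (white T a).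

(* G_0 = Q_2; the tag separates a white and a black vertex with the same set
   of incident edges. *)
Definition vertex (T : brane_tiling) : finType :=
  ({F : {set edge T} | F \in porbits (white T)} +
   {F : {set edge T} | F \in porbits (black T)})%type.

Definition star (T : brane_tiling) (v : vertex T) : {set edge T} :=
  match v with inl F => val F | inr F => val F end.

Definition geometrically_consistent (R : realType) (T : brane_tiling) : Prop :=
  exists r : edge T -> R,
    [/\ forall a, 0 < r a < 1,
        forall v : vertex T, \sum_(a in star v) r a = 2%:R
      & forall i : face T,
          \sum_(a | src a == i) (1 - r a) + \sum_(a | tgt a == i) (1 - r a)
          = 2%:R].

(* The cycle w_F, read from an arbitrary starting arrow. *)
Definition cycle_word (E : finType) (p : {perm E}) (F : {set E}) : seq E :=
  if [pick a in F] is Some a then fingraph.orbit p a else [::].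

(* The words summed in the cyclic derivative of u with respect to a. *)
Definition cyclic_derivative (E : eqType) (u : seq E) (a : E) : seq (seq E) :=
  [seq behead (rot i u) | i <- iota 0 (size u) & nth a u i == a].

Definition rep (R : realType) (T : brane_tiling) := {ffun edge T -> R[i]}.

Definition eval_word (R : realType) (T : brane_tiling) (x : rep R T)
    (u : seq (edge T)) : R[i] :=
  \prod_(b <- u) x b.

Definition eval_derivative (R : realType) (T : brane_tiling) (x : rep R T)
    (p : {perm edge T}) (a : edge T) : R[i] :=
  \sum_(F in porbits p)
    \sum_(u <- cyclic_derivative (cycle_word p F) a) eval_word x u.

(* R(A, alpha) for alpha = (1, ..., 1) *)
Definition satisfies_relations (R : realType) (T : brane_tiling)
    (x : rep R T) : Prop :=
  forall a, eval_derivative x (white T) a - eval_derivative x (black T) a = 0.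

Definition cosupport (R : realType) (T : brane_tiling) (x : rep R T) :
  {set edge T} := [set a | x a == 0]%SET.

Definition in_B (T : brane_tiling) (theta : face T -> int) : Prop :=
  \sum_i theta i = 0.

Definition generic (T : brane_tiling) (theta : face T -> int) : Prop :=
  forall beta : face T -> int,
    (forall i, 0 <= beta i <= 1) ->
    (exists i, beta i != 0) -> (exists i, beta i != 1) ->
    \sum_i theta i * beta i != 0.

Definition subrepresentation (R : realType) (T : brane_tiling) (x : rep R T)
    (Y : face T -> {vspace (R[i])^o}) : Prop :=
  forall (a : edge T) (v : (R[i])^o), v \in Y (src a) -> x a *: v \in Y (tgt a).

Definition semistable (R : realType) (T : brane_tiling) (theta : face T -> int)
    (x : rep R T) : Prop :=
  forall Y : face T -> {vspace (R[i])^o},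
    subrepresentation x Y ->
    (exists i, Y i != 0%VS) -> (exists i, Y i != fullv) ->
    0 <= \sum_i theta i * (\dim (Y i))%:Z.

Definition semistable_locus (R : realType) (T : brane_tiling)
    (theta : face T -> int) : set (rep R T) :=
  [set x | satisfies_relations x /\ semistable theta x].

(* Zariski topology on C^{Q_1}, and the induced one on a subset X. *)
Definition zariski_closed (R : realType) (T : brane_tiling)
    (Z : set (rep R T)) : Prop :=
  exists J : set {mpoly R[i][#|edge T|]},
    Z = [set x | forall p, J p -> p.@[fun i => x (enum_val i)] = 0].

Definition closed_in (R : realType) (T : brane_tiling)
    (X Z : set (rep R T)) : Prop :=
  exists2 A, zariski_closed A & Z = X `&` A.

Definition closure_in (R : realType) (T : brane_tiling)
    (X S : set (rep R T)) : set (rep R T) :=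
  [set x | X x /\ forall Z, closed_in X Z -> S `<=` Z -> Z x].

(* T_Lambda = Hom(Lambda, C^* ) as a subgroup of the torus of Q_1. *)
Definition torus_Lambda (R : realType) (T : brane_tiling) : set (rep R T) :=
  [set l | (forall a, l a != 0) /\
           forall v w : vertex T,
             \prod_(a in star v) l a = \prod_(a in star w) l a].

Definition act (R : realType) (T : brane_tiling) (l x : rep R T) : rep R T :=
  [ffun a => l a * x a].

(* The image of T_B in T_Lambda under d: changes of basis. *)
Definition torus_B (R : realType) (T : brane_tiling) : set (rep R T) :=
  [set l | exists2 g : face T -> R[i],
             (forall i, g i != 0) & l = [ffun a => g (tgt a) / g (src a)]].

Definition orbit_B (R : realType) (T : brane_tiling) (x : rep R T) :
  set (rep R T) := [set act l x | l in @torus_B R T].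

(* Two semistable points have the same image in the GIT quotient iff the
   closures of their orbits meet in the semistable locus. *)
Definition GIT_equivalent (R : realType) (T : brane_tiling)
    (theta : face T -> int) (x y : rep R T) : Prop :=
  closure_in (semistable_locus theta) (orbit_B x)
    `&` closure_in (semistable_locus theta) (orbit_B y) !=set0.

Definition moduli_point (R : realType) (T : brane_tiling)
    (theta : face T -> int) (x : rep R T) : set (rep R T) :=
  [set y | semistable_locus theta y /\ GIT_equivalent theta x y].

(* The points of M_theta = R(A, alpha) //_theta T_B, with the quotient of the
   Zariski topology. *)
Definition moduli (R : realType) (T : brane_tiling) (theta : face T -> int) :
  set (set (rep R T)) :=
  [set moduli_point theta x | x in semistable_locus theta].

Definition moduli_closed (R : realType) (T : brane_tiling)
    (theta : face T -> int) (Z : set (set (rep R T))) : Prop :=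
  Z `<=` moduli theta /\
  closed_in (semistable_locus theta)
    [set x | semistable_locus theta x /\ Z (moduli_point theta x)].

Definition moduli_closure (R : realType) (T : brane_tiling)
    (theta : face T -> int) (S : set (set (rep R T))) : set (set (rep R T)) :=
  [set p | forall Z, moduli_closed theta Z -> S `<=` Z -> Z p].

(* T_B acts trivially on M_theta, so the orbits of T_M = T_Lambda / T_B are
   those of T_Lambda. *)
Definition orbit_M (R : realType) (T : brane_tiling) (p : set (rep R T)) :
  set (set (rep R T)) := [set [set act l x | x in p] | l in @torus_Lambda R T].

Definition is_orbit_M (R : realType) (T : brane_tiling)
    (theta : face T -> int) (O : set (set (rep R T))) : Prop :=
  exists2 p, moduli theta p & O = orbit_M p.

(* Krull dimension of a subspace X of M_theta. *)
Definition moduli_closed_in (R : realType) (T : brane_tiling)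
    (theta : face T -> int) (X Z : set (set (rep R T))) : Prop :=
  exists2 A, moduli_closed theta A & Z = X `&` A.

Definition irreducible_closed (R : realType) (T : brane_tiling)
    (theta : face T -> int) (X Z : set (set (rep R T))) : Prop :=
  [/\ moduli_closed_in theta X Z, Z !=set0
    & forall A B, moduli_closed_in theta X A -> moduli_closed_in theta X B ->
        Z `<=` A `|` B -> Z `<=` A \/ Z `<=` B].

Definition has_irreducible_chain (R : realType) (T : brane_tiling)
    (theta : face T -> int) (X : set (set (rep R T))) (n : nat) : Prop :=
  exists2 Z : 'I_n.+1 -> set (set (rep R T)),
    forall i, irreducible_closed theta X (Z i)
    & forall i j : 'I_n.+1, (i < j)%N -> Z i `<=` Z j /\ Z i <> Z j.

Definition has_dimension (R : realType) (T : brane_tiling)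
    (theta : face T -> int) (X : set (set (rep R T))) (n : nat) : Prop :=
  has_irreducible_chain theta X n /\
  forall m, has_irreducible_chain theta X m -> (m <= n)%N.

Definition orbit_has_cosupport (R : realType) (T : brane_tiling)
    (theta : face T -> int) (O : set (set (rep R T))) (I : {set edge T}) :
  Prop :=
  forall y, semistable_locus theta y -> O (moduli_point theta y) ->
    cosupport y = I.

Definition perfect_matching (T : brane_tiling) (P : {set edge T}) : Prop :=
  forall v : vertex T, #|star v :&: P| = 1%N.

Definition adjacent_in (T : brane_tiling) (I : {set edge T}) : rel (edge T) :=
  [rel a b | [&& a \in I, b \in I
                & [exists v : vertex T, (a \in star v) && (b \in star v)]]].

(* Connected components having at least one edge, given by their edges. *)
Definition component (T : brane_tiling) (I S : {set edge T}) : Prop :=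
  exists2 a, a \in I & S = [set b | connect (adjacent_in I) a b]%SET.

Definition big_component (T : brane_tiling) (I S : {set edge T}) : Prop :=
  component I S /\ (1 < #|S|)%N.

(* The edges a_0, ..., a_{n-1} are consecutive edges of a (simple) cycle of G
   with vertices v_0, ..., v_{n-1}. *)
Definition graph_cycle (T : brane_tiling) (n : nat) (a : 'I_n -> edge T) :
  Prop :=
  injective a /\
  exists2 v : 'I_n -> vertex T, injective v &
    forall i, (a i \in star (v i)) && (a i \in star (v (ordS i))).

(* Main.v *)
(* Since [theta] is generic, every semistable representation x is stable: its
   support is connected as a graph on Q_0, and its T_B-orbit is closed.  Choosing
   paths in the support, x is determined up to T_B by Laurent monomials indexed
   by cycles, so the T_M-orbit of x has dimension r, the rank of the image in M of
   the cycles of the support.  Counting dimensions with V - E + F = 0 gives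
   r = |V| - |I| + 2 - n, where I is the cosupport and n is the dimension of the
   space of functions psi on the vertices of G with sum 0 and
   psi (white end of a) + psi (black end of a) = 0 for a in I.

   The relations of W say that an edge of I which is alone at one end is alone at
   the other.  So if I is nonempty, it consists of isolated edges and of an edge
   set J with all degrees at least 2, and r <= 2 - p as soon as J is the union of p
   nonempty balanced unions of components.  Hence r = 2 exactly when I is a
   perfect matching, and for r = 1 a cycle in J is all of J; the perfect matchings
   in I are then the two asserted ones.

   Conversely, let x have r = 1 and let C be the cycle in I.  A representation
   with the coordinates of x outside I and nonzero coordinates at the even edges
   of C exists because the product of the w_F at the white vertices of C,
   divided by that at the black ones, is a monomial in the support of x with
   value 1: multiply the relations at the isolated edges.  The one-parameter
   subgroup with weight 1 on the even and -1 on the odd edges of C degenerates it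
   to x.  Representations whose cosupport is a given perfect matching form a single
   T_Lambda-orbit, whence uniqueness. *)

Require Import Defs.
From HB Require Import structures.
From mathcomp Require Import all_boot all_order all_fingroup all_algebra.
From mathcomp Require Import mpoly complex.
From mathcomp Require Import classical_sets reals.
From mathcomp Require Import boolp zify.

Set Implicit Arguments.
Unset Strict Implicit.
Unset Printing Implicit Defensive.

Import Order.TTheory GRing.Theory Num.Theory.
Local Open Scope classical_set_scope.
Local Open Scope ring_scope.

(* [act] also names the action function of [fingroup]. *)
Local Notation act := Defs.act.

(** * Vertices, edges and relations of a brane tiling *)

Section Tiling.
Variable T : brane_tiling.
Implicit Types (a b : edge T) (v w : vertex T) (i j : face T).

(** Dimension is defined through chains of irreducible closed subsets, so both inequalities for
    dimension r have to be obtained from polynomials. The map [normalize] picks in each T_B-orbit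
    the point where fixed paths in the support act by 1; its coordinates turn a T_M-orbit into a
    subset of affine space. Upper bound: the polynomials separating the members of a chain are
    algebraically independent, whereas the normalized coordinates are governed by r parameters, so
    that polynomials of degree at most d in them span a space of dimension O(d^r) only. Lower bound:
    subtori of dimensions 0, ..., r have strictly increasing closures, and their irreducibility is
    tested on lines, where it reduces to polynomials in one variable. Relations between cycles are
    computed over Q; clearing denominators is the origin of the constants N+1 and M+1. Geometric
    consistency enters as the equality of the numbers of white and black vertices, by which the sign
    function has sum 0. The bound r <= 2 - p combines |V| <= |I| + #isolated with n >= #isolated +
    p. *)

Definition white_end a : vertex T :=
  inl (exist _ (porbit (white T) a) (imset_f _ (isT : a \in edge T))).

Definition black_end a : vertex T :=
  inr (exist _ (porbit (black T) a) (imset_f _ (isT : a \in edge T))).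

Lemma in_star a v : (a \in star v) = (v == white_end a) || (v == black_end a).
Proof.
case: v => -[F PF]; rewrite /star /=.
- transitivity (F == porbit (white T) a); last by rewrite orbF.
  by have /imsetP[b _ ->] := PF; rewrite eq_sym eq_porbit_mem.
- transitivity (F == porbit (black T) a); last by [].
  by have /imsetP[b _ ->] := PF; rewrite eq_sym eq_porbit_mem.
Qed.

Lemma white_end_in a : a \in star (white_end a).
Proof. by rewrite in_star eqxx. Qed.

Lemma black_end_in a : a \in star (black_end a).
Proof. by rewrite in_star eqxx orbT. Qed.

Lemma vertexP v : exists a, v = white_end a \/ v = black_end a.
Proof.
by case: v => -[F PF]; have /imsetP[b _ eF] := PF; exists b; [left|right];
  congr (_ _); apply/val_inj.
Qed.

Lemma white_end_white a : white_end (white T a) = white_end a.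
Proof.
congr inl; apply/val_inj => /=; apply/eqP.
by rewrite eq_porbit_mem (mem_porbit _ 1).
Qed.

Lemma black_end_black a : black_end (black T a) = black_end a.
Proof.
congr inr; apply/val_inj => /=; apply/eqP.
by rewrite eq_porbit_mem (mem_porbit _ 1).
Qed.

(** [white T a] is the successor of [black T a] under [face_perm T], so both start at the same face:
    [tgt] treats the colours alike. *)
Lemma tgtE a : tgt a = src (black T a).
Proof.
apply/val_inj; rewrite /tgt /src /=; apply/eqP; rewrite eq_porbit_mem.
have -> : white T a = face_perm T (black T a) by rewrite permM permK.
exact: (mem_porbit _ 1).
Qed.

(** The group generated by [white T] and [black T] is transitive and, being finite, consists of
    products of these generators without inverses. *)
Lemma edge_ind (P : edge T -> Prop) :
    (forall a, P a -> P (white T a)) -> (forall a, P a -> P (black T a)) ->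
  forall a b, P a -> P b.
Proof.
move=> Pw Pb a b Pa.
have [g gG ->] := atransP2 (tiling_connected T) (finset.in_setT a) (finset.in_setT b).
have /gen_prodgP[n [c cA ->]] := gG; rewrite /= apermE {g gG}.
elim: n => [|n IHn] in c cA *; first by rewrite big_ord0 perm1.
rewrite big_ord_recr /= permM.
have := cA ord_max; rewrite in_set2 => /orP[] /eqP ->; [apply: Pw|apply: Pb];
  by apply: IHn => i; apply: cA.
Qed.

(** Connectedness of G. A turn around a white vertex changes nothing; a turn around a black one goes
    to it along an edge and back along the next. *)
Lemma vertex_ind (P : vertex T -> Prop) :
    (forall a, P (white_end a) <-> P (black_end a)) ->
  forall v w, P v -> P w.
Proof.
move=> Pwb v w.
have [a va] := vertexP v; have [b wb] := vertexP w.
have [Pa1 Pa2] := Pwb a; have [Pb1 Pb2] := Pwb b => Pv.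
suff Pb : P (white_end b) by case: wb => -> //; apply: Pb1.
apply: (@edge_ind (fun c => P (white_end c)) _ _ a) => [c|c|].
- by rewrite white_end_white.
- by move=> /Pwb; rewrite -black_end_black => /Pwb.
- by case: va Pv => -> // /Pa2.
Qed.

Lemma edge_inhabited : exists a : edge T, True.
Proof.
by have /imsetP[a _ _] := tiling_connected T; exists a.
Qed.

Lemma sum_star (V : nmodType) (f : vertex T -> edge T -> V) :
  \sum_v \sum_(a in star v) f v a =
  \sum_a (f (white_end a) a + f (black_end a) a).
Proof.
rewrite (exchange_big_dep predT) //=; apply: eq_bigr => a _.
rewrite (bigD1 (white_end a)) ?white_end_in //=; congr (_ + _).
rewrite (bigD1 (black_end a)) ?black_end_in //= big1 ?addr0 // => v.
by rewrite in_star; case: eqP; case: eqP.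
Qed.

Lemma prod_star (K : comRingType) (f : vertex T -> edge T -> K) :
  \prod_v \prod_(a in star v) f v a =
  \prod_a (f (white_end a) a * f (black_end a) a).
Proof.
rewrite (exchange_big_dep predT) //=; apply: eq_bigr => a _.
rewrite (bigD1 (white_end a)) ?white_end_in //=; congr (_ * _).
rewrite (bigD1 (black_end a)) ?black_end_in //= big1 ?mulr1 // => v.
by rewrite in_star; case: eqP; case: eqP.
Qed.

(* Each star is the set of arrows of a cycle of Q: its arrows have the same
   sources and targets, up to order. *)
Lemma star_reindex (R : Type) (idx : R) (op : Monoid.com_law idx)
    (f : face T -> R) v :
  \big[op/idx]_(a in star v) f (tgt a) = \big[op/idx]_(a in star v) f (src a).
Proof.
case: v => -[F PF]; rewrite /star /=.
- rewrite [RHS](reindex_inj (h := white T)) /=; last exact: perm_inj.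
  apply: eq_bigl => a; have /imsetP[b _ ->] := PF.
  by have pa := porbit_perm (white T) 1 a; rewrite -!eq_porbit_mem -pa.
- rewrite [RHS](reindex_inj (h := black T)) /=; last exact: perm_inj.
  apply: eq_big => [a|a _]; last by rewrite tgtE.
  have /imsetP[b _ ->] := PF.
  by have pa := porbit_perm (black T) 1 a; rewrite -!eq_porbit_mem -pa.
Qed.

Definition nwhite := #|porbits (white T)|.
Definition nblack := #|porbits (black T)|.

Lemma sum_white_black (V : zmodType) (c : V) :
  \sum_(v : vertex T) (if v is inl _ then c else - c) = c *+ nwhite - c *+ nblack.
Proof.
rewrite big_sumType /= !sumr_const mulNrn.
by rewrite !card_sig.
Qed.

Lemma card_vertex : #|vertex T| = (nwhite + nblack)%N.
Proof. by rewrite card_sum !card_sig. Qed.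

Lemma card_edge : #|edge T| = (#|vertex T| + #|face T|)%N.
Proof. by rewrite card_vertex -(tiling_torus T) card_sig. Qed.

(** Summing R over the white stars or over the black stars counts every edge once, and each star
    contributes 2. *)
Lemma consistent_balanced (R : realType) :
  geometrically_consistent R T -> nwhite = nblack.
Proof.
case=> r [_ r2 _].
have /eqP : \sum_(v : vertex T) (if v is inl _ then 2%:R else - 2%:R : R) = 0.
  rewrite (eq_bigr (fun v => \sum_(a in star v)
      if v is inl _ then r a else - r a)); last first.
    by case=> F _; [rewrite -(r2 (inl F)) | rewrite sumrN (r2 (inr F))].
  by rewrite sum_star big1 // => a _; rewrite /= addrN.
rewrite sum_white_black -!mulrnA subr_eq0 eqr_nat.
by rewrite eqn_mul2l => /eqP.
Qed.

End Tiling.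

Lemma porbit_fconnect (E : finType) (p : {perm E}) (a b : E) :
  fconnect p a b = (b \in porbit p a).
Proof.
apply/idP/porbitP => [ab|[i ->]].
  by exists (findex p a b); rewrite permX iter_findex.
by rewrite permX fconnect_iter.
Qed.

Lemma cyclic_derivative_uniq (E : eqType) (u : seq E) (a : E) : uniq u ->
  cyclic_derivative u a =
  if a \in u then [:: behead (rot (index a u) u)] else [::].
Proof.
move=> u_uniq; rewrite /cyclic_derivative.
have -> : [seq i <- iota 0 (size u) | nth a u i == a] =
          if a \in u then [:: index a u] else [::].
  case: ifP => [au|/negP au].
    rewrite (eq_in_filter (a2 := pred1 (index a u))); last first.
      move=> i; rewrite mem_iota /= => iu.
      by rewrite -{2}(nth_index a au) nth_uniq // index_mem.
    by rewrite filter_pred1_uniq ?iota_uniq // mem_iota index_mem.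
  rewrite (eq_in_filter (a2 := pred0)) ?filter_pred0 // => i.
  rewrite mem_iota /= => iu; apply/eqP => ia; case: au.
  by rewrite -ia mem_nth.
by case: ifP.
Qed.

Section Relations.
Variables (R : realType) (T : brane_tiling).
Implicit Types (x : rep R T) (a b : edge T) (v w : vertex T).

(** Only the cycle through [a] has a term, and since the spaces at the vertices are one-dimensional,
    its starting arrow and its order do not matter. *)
Lemma eval_derivativeE x (p : {perm edge T}) a :
  eval_derivative x p a = \prod_(b in porbit p a | b != a) x b.
Proof.
rewrite /eval_derivative (bigD1 (porbit p a)) ?imset_f //= [X in _ + X]big1.
  rewrite addr0 /cycle_word; case: pickP => [c ca|/(_ a)]; last first.
    by rewrite porbit_id.
  have ac : a \in fingraph.orbit p c.
    by rewrite -fconnect_orbit porbit_fconnect porbit_sym.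
  rewrite cyclic_derivative_uniq ?orbit_uniq // ac big_seq1 /eval_word.
  set u := fingraph.orbit p c in ac *.
  transitivity (\prod_(b <- u | b != a) x b).
    rewrite [RHS](perm_big (rot (index a u) u)) ?[perm_eq u _]perm_sym ?perm_rot //.
    rewrite rot_index //= big_cons eqxx /= [LHS]big_seq_cond [RHS]big_seq_cond.
    apply: eq_bigl => b; rewrite andbT andbC; apply/esym/andb_idl => bu.
    apply: contraTneq bu => ->.
    have : uniq (rot (index a u) u) by rewrite rot_uniq orbit_uniq.
    by rewrite rot_index //= => /andP[].
  rewrite big_mkcond big_uniq ?orbit_uniq // -big_mkcondr /=; apply: eq_bigl => b; congr (_ && _).
  rewrite /u -fconnect_orbit porbit_fconnect.
  by move: ca; rewrite -eq_porbit_mem => /eqP->.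
move=> F /andP[/imsetP[c _ ->] ne].
rewrite /cycle_word; case: pickP => [d dc|_]; last by rewrite big_nil.
rewrite cyclic_derivative_uniq ?orbit_uniq //.
rewrite -fconnect_orbit porbit_fconnect; case: ifP => [ad|]; last first.
  by rewrite big_nil.
case/eqP: ne; apply/eqP; rewrite eq_sym eq_porbit_mem.
by move: dc; rewrite -eq_porbit_mem => /eqP <-.
Qed.

Lemma relationsP x : satisfies_relations x <->
  forall a, \prod_(b in star (white_end a) | b != a) x b =
            \prod_(b in star (black_end a) | b != a) x b.
Proof.
by split=> xr a; [apply/eqP; rewrite -subr_eq0; apply/eqP|apply/eqP; rewrite subr_eq0; apply/eqP];
  have := xr a; rewrite !eval_derivativeE.
Qed.

End Relations.

(** * Tori and Laurent monomials *)

Section Laurent.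
Variables (K : fieldType) (E : finType).
Implicit Types (z : E -> K) (c d : {ffun E -> int}) (S : {set E}).

Definition supported S c := forall a, a \notin S -> c a = 0.

Definition laurent z c : K := \prod_a z a ^ c a.

Definition delta a : {ffun E -> int} := [ffun b => (b == a)%:Z].

Lemma supported0 S : supported S 0.
Proof. by move=> a _; rewrite ffunE. Qed.

Lemma supportedD S c d : supported S c -> supported S d -> supported S (c + d).
Proof. by move=> cS dS a aS; rewrite ffunE cS // dS. Qed.

Lemma supportedN S c : supported S c -> supported S (- c).
Proof. by move=> cS a aS; rewrite ffunE cS // oppr0. Qed.

Lemma supportedB S c d : supported S c -> supported S d -> supported S (c - d).
Proof. by move=> cS dS; apply/supportedD/supportedN. Qed.

Lemma supported_delta S a : a \in S -> supported S (delta a).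
Proof. by move=> aS b; rewrite ffunE; case: eqP => // ->; rewrite aS. Qed.

Lemma laurent0 z : laurent z 0 = 1.
Proof. by rewrite /laurent big1 // => a _; rewrite ffunE expr0z. Qed.

(** The inverse of 0 is 0, so [0 ^ 1 * 0 ^ (-1)] is 0 while [0 ^ 0] is 1: exponents must be
    supported where [z] does not vanish. *)
Lemma laurentD S z c d : (forall a, a \in S -> z a != 0) ->
  supported S c -> supported S d -> laurent z (c + d) = laurent z c * laurent z d.
Proof.
move=> zS cS dS; rewrite /laurent -big_split; apply: eq_bigr => a _ /=.
have [aS|aS] := boolP (a \in S); first by rewrite ffunE expfzDr ?zS.
by rewrite ffunE cS // dS // addr0 expr0z mulr1.
Qed.

Lemma laurentD_neq0 z c d : (forall a, z a != 0) ->
  laurent z (c + d) = laurent z c * laurent z d.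
Proof.
by move=> z0; apply: (@laurentD [set: E]%SET) => // a; rewrite inE.
Qed.

Lemma laurentN z c : laurent z (- c) = (laurent z c)^-1.
Proof.
by rewrite /laurent -prodfV; apply: eq_bigr => a _; rewrite ffunE invr_expz.
Qed.

Lemma laurentX z c n : laurent z [ffun a => c a * n] = laurent z c ^ n.
Proof.
rewrite /laurent (big_morph (fun u : K => u ^ n) (fun u v => expfzMl u v n) (@exp1rz K n)).
by apply: eq_bigr => a _; rewrite ffunE exprz_exp.
Qed.

Lemma laurentM z w c : laurent (fun a => z a * w a) c = laurent z c * laurent w c.
Proof.
by rewrite /laurent -big_split; apply: eq_bigr => a _; rewrite expfzMl.
Qed.

Lemma laurent_delta z a : laurent z (delta a) = z a.
Proof.
rewrite /laurent (bigD1 a) //= ffunE eqxx expr1z big1 ?mulr1 // => b ba.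
by rewrite ffunE (negbTE ba) expr0z.
Qed.

Lemma laurent_neq0 S z c : (forall a, a \in S -> z a != 0) ->
  supported S c -> laurent z c != 0.
Proof.
move=> zS cS; apply/prodf_neq0 => a _.
have [aS|aS] := boolP (a \in S); first by rewrite expfz_neq0 ?zS.
by rewrite cS // expr0z oner_neq0.
Qed.

Lemma laurent_neq0_all z c : (forall a, z a != 0) -> laurent z c != 0.
Proof. by move=> z0; apply: (@laurent_neq0 [set: E]%SET) => // a; rewrite inE. Qed.

Lemma eq_laurent z w c : z =1 w -> laurent z c = laurent w c.
Proof. by move=> zw; apply: eq_bigr => a _; rewrite zw. Qed.

End Laurent.

Section Torus.
Variables (R : realType) (T : brane_tiling).
Local Notation C := R[i].
Implicit Types (a b : edge T) (x y z l : rep R T) (i j : face T).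
Implicit Types (g : face T -> C) (c : {ffun edge T -> int}).

Definition gauge g : rep R T := [ffun a => g (tgt a) / g (src a)].

Lemma actE l x a : act l x a = l a * x a.
Proof. by rewrite ffunE. Qed.

Lemma laurent_act l x c : laurent (act l x) c = laurent l c * laurent x c.
Proof. by rewrite -laurentM; apply: eq_laurent => a; rewrite actE. Qed.

Lemma gauge_neq0 g a : (forall i, g i != 0) -> gauge g a != 0.
Proof. by move=> g0; rewrite ffunE mulf_neq0 ?invr_neq0. Qed.

Lemma torus_B_gauge g : (forall i, g i != 0) -> torus_B (gauge g).
Proof. by move=> g0; exists g. Qed.

Lemma torus_B_Lambda l : torus_B l -> torus_Lambda l.
Proof.
case=> g g0 ->; split=> [a|v w]; first exact: gauge_neq0.
have star1 u : \prod_(a in star u) (gauge g a) = 1.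
  rewrite (eq_bigr (fun a => g (tgt a) / g (src a))) => [|a _]; last first.
    by rewrite ffunE.
  rewrite big_split /= star_reindex prodfV divff //.
  by apply/prodf_neq0 => a _.
by rewrite !star1.
Qed.

Lemma torus_Lambda1 : torus_Lambda ([ffun=> 1] : rep R T).
Proof.
split=> [a|v w]; first by rewrite ffunE oner_neq0.
by rewrite !big1 // => a _; rewrite ffunE.
Qed.

Lemma torus_LambdaM l m : torus_Lambda l -> torus_Lambda m -> torus_Lambda (act l m).
Proof.
move=> [l0 lv] [m0 mv]; split=> [a|v w]; first by rewrite actE mulf_neq0.
rewrite (eq_bigr (fun a => l a * m a)) => [|a _]; last by rewrite actE.
rewrite [RHS](eq_bigr (fun a => l a * m a)) => [|a _]; last by rewrite actE.
by rewrite !big_split /= (lv v w) (mv v w).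
Qed.

Definition torus_inv l : rep R T := [ffun a => (l a)^-1].

Lemma torus_LambdaV l : torus_Lambda l -> torus_Lambda (torus_inv l).
Proof.
move=> [l0 lv]; split=> [a|v w]; first by rewrite ffunE invr_eq0.
rewrite (eq_bigr (fun a => (l a)^-1)) => [|a _]; last by rewrite ffunE.
rewrite [RHS](eq_bigr (fun a => (l a)^-1)) => [|a _]; last by rewrite ffunE.
by rewrite !prodfV (lv v w).
Qed.

Lemma torus_BM l m : torus_B l -> torus_B m -> torus_B (act l m).
Proof.
move=> [g g0 ->] [h h0 ->]; exists (fun i => g i * h i).
  by move=> i; rewrite mulf_neq0.
by apply/ffunP => a; rewrite !ffunE invfM mulrACA.
Qed.

Lemma torus_BV l : torus_B l -> torus_B (torus_inv l).
Proof.
move=> [g g0 ->]; exists (fun i => (g i)^-1).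
  by move=> i; rewrite invr_eq0.
by apply/ffunP => a; rewrite !ffunE invfM.
Qed.

Lemma torus_B1 : torus_B ([ffun=> 1] : rep R T).
Proof.
exists (fun=> 1) => [i|]; first by rewrite oner_neq0.
by apply/ffunP => a; rewrite !ffunE divr1.
Qed.

Lemma actA l m x : act l (act m x) = act (act l m) x.
Proof. by apply/ffunP => a; rewrite !ffunE mulrA. Qed.

Lemma actC l m x : act l (act m x) = act m (act l x).
Proof. by apply/ffunP => a; rewrite !ffunE mulrCA. Qed.

Lemma act1 x : act [ffun=> 1] x = x.
Proof. by apply/ffunP => a; rewrite !ffunE mul1r. Qed.

Lemma act_invK l x : torus_Lambda l -> act (torus_inv l) (act l x) = x.
Proof. by case=> l0 _; apply/ffunP => a; rewrite !ffunE mulKf. Qed.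

Lemma act_eq0 l x a : torus_Lambda l -> (act l x a == 0) = (x a == 0).
Proof. by case=> l0 _; rewrite actE mulf_eq0 (negbTE (l0 a)). Qed.

Lemma cosupport_act l x : torus_Lambda l -> cosupport (act l x) = cosupport x.
Proof. by move=> lT; apply/setP => a; rewrite !inE act_eq0. Qed.

Lemma orbit_B_refl x : orbit_B x x.
Proof. by exists [ffun=> 1]; [exact: torus_B1 | rewrite act1]. Qed.

Lemma orbit_B_act l x y : torus_B l -> orbit_B x y -> orbit_B x (act l y).
Proof. by move=> lB [m mB <-]; exists (act l m); [exact: torus_BM | rewrite actA]. Qed.

Lemma orbit_B_eq x y : orbit_B x y -> orbit_B x = orbit_B y.
Proof.
case=> l lB <-; apply/seteqP; split=> z [m mB <-]; last first.
  by exists (act m l); [exact: torus_BM | rewrite actA].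
exists (act m (torus_inv l)); first by apply/torus_BM/torus_BV.
by rewrite -actA act_invK //; apply: torus_B_Lambda.
Qed.

End Torus.

(** * Stable representations *)

Section Polynomials.
Variables (R : realType) (T : brane_tiling).
Local Notation C := R[i].
Implicit Types (a b : edge T) (x y z l : rep R T) (c : {ffun edge T -> int}).
Implicit Types (p q : {mpoly C[#|edge T|]}).

Definition peval x p : C := p.@[fun i => x (enum_val i)].

Definition coord a : {mpoly C[#|edge T|]} := 'X_(enum_rank a).

Lemma peval_coord x a : peval x (coord a) = x a.
Proof. by rewrite /peval mevalXU enum_rankK. Qed.

Lemma pevalD x p q : peval x (p + q) = peval x p + peval x q.
Proof. exact: mevalD. Qed.

Lemma pevalB x p q : peval x (p - q) = peval x p - peval x q.
Proof. exact: mevalB. Qed.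

Lemma pevalM x p q : peval x (p * q) = peval x p * peval x q.
Proof. exact: mevalM. Qed.

Lemma pevalC x (k : C) : peval x k%:MP = k.
Proof. exact: mevalC. Qed.

Lemma pevalXn x p n : peval x (p ^+ n) = peval x p ^+ n.
Proof. exact: rmorphXn. Qed.

Lemma peval_prod x (I : Type) (r : seq I) (P : pred I) (F : I -> _) :
  peval x (\prod_(i <- r | P i) F i) = \prod_(i <- r | P i) peval x (F i).
Proof. exact: rmorph_prod. Qed.

(* The numerator of the Laurent monomial with exponent [c]; its denominator is
   the numerator for [- c]. *)
Definition numer c : {mpoly C[#|edge T|]} :=
  \prod_a coord a ^+ `|Num.max (c a) 0|%N.

Lemma laurent_numer x c : (forall a, x a = 0 -> c a = 0) ->
  laurent x c * peval x (numer (- c)) = peval x (numer c).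
Proof.
move=> xc; rewrite !peval_prod /laurent -big_split; apply: eq_bigr => a _ /=.
rewrite !pevalXn peval_coord ffunE.
have [/eqP xa|xa] := boolP (x a == 0); first by rewrite (xc a xa) oppr0 maxxx expr0z mul1r.
have [ca|ca] := lerP 0 (c a).
  rewrite [Num.max (- _) 0]max_r ?oppr_le0 // expr0 mulr1.
  by rewrite exprnP gez0_abs.
rewrite max_l ?oppr_ge0 ?ltW //.
have e : (`|- c a|%N : int) = - c a by rewrite gez0_abs // oppr_ge0 ltW.
by rewrite !exprnP e -expfzDr // addrN.
Qed.

Lemma peval_numer_neq0 x c : (forall a, x a = 0 -> c a = 0) ->
  peval x (numer c) != 0.
Proof.
move=> xc; rewrite peval_prod; apply/prodf_neq0 => a _.
rewrite pevalXn peval_coord.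
have [/eqP xa|xa] := boolP (x a == 0); last by rewrite expf_neq0.
by rewrite xc // maxxx expr0 oner_neq0.
Qed.

Definition rescale l p : {mpoly C[#|edge T|]} :=
  p \mPo [tuple l (enum_val i) *: 'X_i | i < #|edge T|].

Lemma peval_rescale l x p : peval x (rescale l p) = peval (act l x) p.
Proof.
rewrite /peval /rescale comp_mpoly_meval; apply: meval_eq => i.
by rewrite tnth_mktuple mevalZ mevalXU actE.
Qed.

End Polynomials.

Arguments coord {R T} a.
Arguments numer {R T} c.

Section Semistable.
Variables (R : realType) (T : brane_tiling) (theta : face T -> int).
Local Notation C := R[i].
Implicit Types (a b : edge T) (x y z l : rep R T) (i j : face T).
Implicit Types (c : {ffun edge T -> int}) (v w : vertex T).

Definition support x : {set edge T} := [set a | x a != 0]%SET.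

Lemma setC_cosupport x : (~: cosupport x)%SET = support x.
Proof. by apply/setP => a; rewrite !inE. Qed.

(** Fewer vanishing arrows leave fewer subrepresentations to test. *)
Lemma semistable_cosupport x y :
  cosupport y \subset cosupport x -> semistable theta x -> semistable theta y.
Proof.
move=> /fintype.subsetP yx xss Y Yy; apply: xss => a v va.
have [/eqP xa|xa] := boolP (x a == 0); first by rewrite xa scale0r mem0v.
have ya : y a != 0 by apply: contra xa => ya; have := yx a; rewrite !inE => ->.
have /(memvZ (x a / y a)) := Yy a v va.
by rewrite scalerA divfK.
Qed.

Lemma relations_act l x :
  torus_Lambda l -> satisfies_relations x -> satisfies_relations (act l x).
Proof.
move=> [l0 lv] /relationsP xr; apply/relationsP => a.
rewrite [LHS](eq_bigr (fun b => l b * x b)) => [|b _]; last by rewrite actE.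
rewrite [RHS](eq_bigr (fun b => l b * x b)) => [|b _]; last by rewrite actE.
rewrite !big_split /= xr; congr (_ * _); apply: (mulfI (l0 a)).
have := lv (white_end a) (black_end a).
by rewrite (bigD1 a) ?white_end_in //= [RHS](bigD1 a) ?black_end_in.
Qed.

Lemma semistable_locus_act l x :
  torus_Lambda l -> semistable_locus theta x -> semistable_locus theta (act l x).
Proof.
move=> lT [xr xs]; split; first exact: relations_act.
by apply: semistable_cosupport xs; rewrite cosupport_act.
Qed.

Hypotheses (theta_B : in_B theta) (theta_generic : generic theta).

(* A union of connected components of the support, together with its
   complement, would give two subrepresentations whose slopes add up to 0. *)
Lemma semistable_connected x (X : {set face T}) : semistable theta x ->
  (exists i, i \in X) -> (forall a, x a != 0 -> (src a \in X) = (tgt a \in X)) ->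
  forall i, i \in X.
Proof.
move=> xss [i0 i0X] Xclosed i; apply: contraT => iX.
pose Y (A : {set face T}) j : {vspace C^o} := if j \in A then fullv else 0%VS.
have full0 : (fullv : {vspace C^o}) != 0%VS by rewrite -dimv_eq0 dimvf.
have slope (A : {set face T}) : (forall a, x a != 0 -> (src a \in A) = (tgt a \in A)) ->
    (exists j, j \in A) -> (exists j, j \notin A) ->
    0 <= \sum_j theta j * (j \in A)%:Z.
  move=> AQ [j jA] [k kA].
  have -> : \sum_j theta j * (j \in A)%:Z = \sum_j theta j * (\dim (Y A j))%:Z.
    apply: eq_bigr => h _; rewrite /Y; case: ifP; first by rewrite dimvf.
    by rewrite dimv0.
  apply: xss.
  - move=> a u; have [/eqP ->|xa] := boolP (x a == 0).
      by rewrite scale0r mem0v.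
    by rewrite /Y (AQ a xa); case: ifP => _; rewrite ?memvf // !memv0 => /eqP ->;
       rewrite scaler0.
  - by exists j; rewrite /Y jA.
  - by exists k; rewrite /Y (negbTE kA) eq_sym.
have s1 := slope X Xclosed (ex_intro _ i0 i0X) (ex_intro _ i iX).
have s2 : 0 <= \sum_j theta j * (j \in ~: X)%SET%:Z.
  apply: slope; first by move=> a /Xclosed; rewrite !inE => ->.
    by exists i; rewrite inE.
  by exists i0; rewrite inE negbK.
have s12 : \sum_j theta j * (j \in X)%:Z + \sum_j theta j * (j \in ~: X)%SET%:Z = 0.
  rewrite -big_split -[RHS]theta_B; apply: eq_bigr => j _ /=.
  by rewrite -mulrDr inE; case: (j \in X); rewrite /= ?addr0 ?add0r mulr1.
have := @theta_generic (fun j => (j \in X)%:Z).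
rewrite (_ : \sum_j _ = 0) ?eqxx; last first.
  by apply/eqP; rewrite eq_le s1 andbT -(lerD2r (\sum_j theta j * (j \in ~: X)%SET%:Z)) s12 add0r.
apply=> [j||]; first by case: (j \in X).
  by exists i0; rewrite i0X.
by exists i; rewrite (negbTE iX).
Qed.

End Semistable.

(** * Normal forms and closedness of T_B-orbits *)

Section Paths.
Variables (R : realType) (T : brane_tiling).
Local Notation C := R[i].
Implicit Types (a b : edge T) (x y z l : rep R T) (i j : face T).
Implicit Types (c : {ffun edge T -> int}) (S : {set edge T}).

(* [c] is the class of a path in Q from [i] to [j] using arrows of [S] and
   their formal inverses. *)
Definition is_path S i j c : Prop :=
  [/\ supported S c,
      forall f : face T -> rat,
        \sum_a (c a)%:~R * (f (tgt a) - f (src a)) = f j - f i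
    & forall g : face T -> C, (forall i, g i != 0) ->
        laurent (gauge g) c = g j / g i].

Lemma is_path0 S i : is_path S i i 0.
Proof.
split=> [|f|g g0]; first exact: supported0.
  by rewrite subrr big1 // => a _; rewrite ffunE mul0r.
by rewrite laurent0 divff.
Qed.

Lemma is_path_delta S a : a \in S -> is_path S (src a) (tgt a) (delta a).
Proof.
move=> aS; split=> [|f|g g0]; first exact: supported_delta.
  rewrite (bigD1 a) //= ffunE eqxx mul1r big1 ?addr0 // => b ba.
  by rewrite ffunE (negbTE ba) mul0r.
by rewrite laurent_delta ffunE.
Qed.

Lemma is_pathN S i j c : is_path S i j c -> is_path S j i (- c).
Proof.
move=> [cS cf cg]; split=> [|f|g g0]; first exact: supportedN.
  rewrite -opprB -cf -sumrN; apply: eq_bigr => a _.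
  by rewrite ffunE rmorphN mulNr.
by rewrite laurentN cg // invfM invrK mulrC.
Qed.

Lemma is_pathD S i j k c d :
  is_path S i j c -> is_path S j k d -> is_path S i k (c + d).
Proof.
move=> [cS cf cg] [dS df dg]; split=> [|f|g g0]; first exact: supportedD.
  rewrite -[RHS](subrKA (f j)) -cf -df addrC -big_split; apply: eq_bigr => a _.
  by rewrite ffunE rmorphD mulrDl.
rewrite laurentD_neq0 => [|a]; last exact: gauge_neq0.
rewrite cg // dg //; by rewrite mulrC mulrA divfK.
Qed.

Definition path_system S i0 (gamma : face T -> {ffun edge T -> int}) : Prop :=
  forall i, is_path S i0 i (gamma i).

Variable theta : face T -> int.
Hypotheses (theta_B : in_B theta) (theta_generic : generic theta).

(** The faces reachable from [i0] along arrows of the support and their inverses form a union of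
    components of the support, hence all of Q_0. *)
Lemma path_systemP x : semistable theta x ->
  exists i0 gamma, path_system (support x) i0 gamma.
Proof.
move=> xss; have [a0 _] := edge_inhabited T; pose i0 := src a0; exists i0.
apply: (fin_all_exists (P := fun i c => is_path (support x) i0 i c)).
pose X := [set i | `[< exists c, is_path (support x) i0 i c >]]%SET.
suff XT i : i \in X by move=> i; have := XT i; rewrite inE => /asboolP.
apply: (semistable_connected theta_B theta_generic xss) => {i}.
  by exists i0; rewrite inE; apply/asboolP; exists 0; apply: is_path0.
move=> a xa; have ap : is_path (support x) (src a) (tgt a) (delta a).
  by apply: is_path_delta; rewrite inE.
rewrite !inE; apply/asboolP/asboolP => -[c cp].
  by exists (c + delta a); apply: is_pathD ap.
by exists (c - delta a); apply: is_pathD cp _; apply: is_pathN.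
Qed.

Section Normalize.
Variables (S : {set edge T}) (i0 : face T) (gamma : face T -> {ffun edge T -> int}).
Hypothesis gammaP : path_system S i0 gamma.

(* The point of the T_B-orbit of [z] at which all paths [gamma i] act by 1. *)
Definition normalize z : rep R T :=
  [ffun a => z a * laurent z (gamma (src a) - gamma (tgt a))].

Lemma normalizeA z a :
  normalize z a = z a * laurent z (gamma (src a) - gamma (tgt a)).
Proof. by rewrite ffunE. Qed.

(** The closed path from [i0] to the source of [a], along [a], and back to [i0]: the fundamental
    cycle of [a] relative to the paths [gamma]. *)
Definition cycle_class a : {ffun edge T -> int} :=
  delta a + (gamma (src a) - gamma (tgt a)).

Lemma supported_gamma i : supported S (gamma i).
Proof. by case: (gammaP i). Qed.

Lemma supported_gammaB i j : supported S (gamma i - gamma j).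
Proof. exact: supportedB (supported_gamma i) (supported_gamma j). Qed.

Lemma laurent_gammaB g i j : (forall k, g k != 0) ->
  laurent (gauge g : rep R T) (gamma i - gamma j) = g i / g j.
Proof.
move=> g0; rewrite laurentD_neq0 => [|a]; last exact: gauge_neq0.
have [_ _ gi] := gammaP i; have [_ _ gj] := gammaP j.
by rewrite laurentN gi // gj // invfM invrK mulrACA [(g i0)^-1 * _]mulrC mulfV // mulr1.
Qed.

Lemma is_path_cycle_class a : a \in S -> is_path S i0 i0 (cycle_class a).
Proof.
move=> aS; rewrite /cycle_class addrCA addrA.
apply: is_pathD (is_pathN (gammaP (tgt a))).
by apply: is_pathD (gammaP _) (is_path_delta aS).
Qed.

Lemma normalize_act l z : torus_B l -> normalize (act l z) = normalize z.
Proof.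
case=> g g0 ->; apply/ffunP => a; rewrite !ffunE.
rewrite (laurent_act (gauge g)) laurent_gammaB // mulrACA.
rewrite (_ : _ / _ * _ = 1) ?mul1r //.
by rewrite mulrACA [X in _ * X]mulrC -mulrACA !mulfV ?mulr1.
Qed.

(** With [normalize_act], this makes [normalize] a section of the quotient by T_B over the points
    whose support contains [S]. *)
Lemma normalize_orbit z : S \subset support z -> orbit_B z (normalize z).
Proof.
move=> /fintype.subsetP Sz.
have zS a : a \in S -> z a != 0 by move=> /Sz; rewrite inE.
pose h i := (laurent z (gamma i))^-1.
have h0 i : h i != 0.
  by rewrite invr_eq0 (laurent_neq0 zS) //; apply: supported_gamma.
exists (gauge h); first exact: torus_B_gauge.
apply/ffunP => a; rewrite !ffunE mulrC /h.
rewrite (laurentD zS (supported_gamma _)) ?laurentN ?invrK 1?mulrC //.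
  by rewrite mulrC [_^-1 * _]mulrC.
exact: supportedN (supported_gamma _).
Qed.

Lemma normalizeE z a : S \subset support z -> a \in S ->
  normalize z a = laurent z (cycle_class a).
Proof.
move=> /fintype.subsetP Sz aS; rewrite ffunE /cycle_class.
have zS b : b \in S -> z b != 0 by move=> /Sz; rewrite inE.
by rewrite (laurentD zS (supported_delta aS) (supported_gammaB _ _)) laurent_delta.
Qed.

End Normalize.

(* Vanishing of the polynomial below, for fixed [x], means that [z] and [x] have
   the same normalization. *)
Definition normalize_equation (gamma : face T -> {ffun edge T -> int}) x a :
    {mpoly C[#|edge T|]} :=
  let c := gamma (src a) - gamma (tgt a) in
  coord a * numer c - (normalize gamma x a)%:MP * numer (- c).

Lemma normalize_equationP S i0 gamma x z a : path_system S i0 gamma ->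
  S \subset support z ->
  peval z (normalize_equation gamma x a) = 0 <-> normalize gamma z a = normalize gamma x a.
Proof.
move=> gammaP /fintype.subsetP Sz; rewrite pevalB !pevalM peval_coord pevalC.
set c := gamma _ - _.
have zc b : z b = 0 -> c b = 0.
  move=> zb; apply: (supported_gammaB gammaP); apply: contraPN zb => /Sz.
  by rewrite inE => /eqP.
rewrite -(laurent_numer zc) mulrA -mulrBl -(normalizeA gamma z a); split=> [/eqP|->]; last first.
  by rewrite subrr mul0r.
rewrite mulf_eq0 subr_eq0 (negbTE (peval_numer_neq0 (c := - c) _)) ?orbF => [/eqP//|].
by move=> b zb; rewrite ffunE zc.
Qed.

Local Notation SS := (semistable_locus (R := R) theta).

Lemma closed_inP (X Z : set (rep R T)) : closed_in X Z ->
  exists J : set {mpoly C[#|edge T|]},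
    forall x, X x -> (Z x <-> forall p, J p -> peval x p = 0).
Proof.
case=> A [J ->] ->; exists J => x Xx; split; first by case.
by move=> xJ; split.
Qed.

Lemma closed_in_zeros (X Z : set (rep R T)) (J : set {mpoly C[#|edge T|]}) :
  Z `<=` X -> (forall x, X x -> (Z x <-> forall p, J p -> peval x p = 0)) ->
  closed_in X Z.
Proof.
move=> ZX ZJ; exists [set x | forall p, J p -> peval x p = 0]; first by exists J.
by apply/seteqP; split=> x => [Zx|[Xx xJ]]; [split; [exact: ZX|apply/ZJ; [exact: ZX|]]|apply/ZJ].
Qed.

Lemma closure_inP (X Y : set (rep R T)) z : Y `<=` X -> closure_in X Y z ->
  X z /\ forall p, (forall y, Y y -> peval y p = 0) -> peval z p = 0.
Proof.
move=> YX [Xz zY]; split=> // p Yp.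
pose Z := [set x | X x /\ peval x p = 0].
suff [] : Z z by [].
apply: zY => [|y Yy]; last by split; [exact: YX|exact: Yp].
apply: (closed_in_zeros (J := [set p])) => x; first by case.
by move=> Xx; split=> [[_ xp] q -> //|xJ]; split=> //; apply: xJ.
Qed.

Lemma subset_closure_in (X Y : set (rep R T)) y : X y -> Y y -> closure_in X Y y.
Proof. by move=> Xy Yy; split=> // Z _; apply. Qed.

Lemma orbit_B_sub x : SS x -> orbit_B x `<=` SS.
Proof.
move=> xss _ [l lB <-]; apply: semistable_locus_act => //.
exact: torus_B_Lambda.
Qed.

(* Semistable points are stable, hence have closed orbits. *)
Lemma closure_orbit_B x z : SS x -> closure_in SS (orbit_B x) z -> orbit_B x z.
Proof.
move=> xss /(closure_inP (orbit_B_sub xss))[zss zx].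
(* The paths run in the support of the limit [z]. It lies in that of [x], so they normalize both
   points. *)
have [i0 [gamma gammaP]] := path_systemP zss.2.
have Szx : support z \subset support x.
  apply/fintype.subsetP => a; rewrite !inE; apply: contra => /eqP xa.
  rewrite -(peval_coord z) zx // => _ [l lB <-].
  by rewrite peval_coord actE xa mulr0.
have znx : normalize gamma z = normalize gamma x.
  apply/ffunP => a; apply/(normalize_equationP _ _ gammaP) => //.
  apply: zx => _ [l lB <-]; apply/(normalize_equationP _ _ gammaP).
    apply: fintype.subset_trans Szx _; apply/fintype.subsetP => b.
    by rewrite !inE act_eq0 //; apply: torus_B_Lambda.
  by rewrite (normalize_act gammaP).
have xz := normalize_orbit gammaP Szx.
have := normalize_orbit gammaP (fintype.subxx (support z)).
by rewrite znx (orbit_B_eq xz) => /orbit_B_eq <-; apply: orbit_B_refl.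
Qed.

Lemma moduli_pointE x : SS x -> moduli_point theta x = orbit_B x.
Proof.
move=> xss; apply/seteqP; split=> y.
  case=> yss [z [zx zy]].
  have /orbit_B_eq -> := closure_orbit_B xss zx.
  by have /orbit_B_eq <- := closure_orbit_B yss zy; apply: orbit_B_refl.
move=> xy; have yss := orbit_B_sub xss xy; split=> //; exists y; split.
  exact: subset_closure_in.
exact/subset_closure_in/orbit_B_refl.
Qed.

End Paths.

(** * Chains of irreducible loci *)

Lemma linear_dependence (K : fieldType) (X Y : finType) (M : X -> Y -> K) :
  (#|Y| < #|X|)%N ->
  exists2 c : X -> K, (exists x, c x != 0) & forall y, \sum_x c x * M x y = 0.
Proof.
move=> YX; pose A : 'M[K]_(#|X|, #|Y|) := \matrix_(i, j) M (enum_val i) (enum_val j).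
have kA : kermx A != 0.
  rewrite -mxrank_eq0 mxrank_ker subn_eq0 -ltnNge.
  exact: leq_ltn_trans (rank_leq_col A) YX.
pose u := nz_row (kermx A).
have uA : u *m A = 0 by apply/sub_kermxP; apply: nz_row_sub.
have u0 : u != 0 by rewrite nz_row_eq0.
exists (fun x => u 0 (enum_rank x)).
  have [i ui] : exists i, u 0 i != 0.
    apply/existsP; apply: contraNT u0; rewrite negb_exists => /forallP u0.
    by apply/eqP/rowP => i; rewrite mxE; apply/eqP; have := u0 i; rewrite negbK.
  by exists (enum_val i); rewrite enum_valK.
move=> y; have /rowP/(_ (enum_rank y)) := uA; rewrite !mxE => uAy; rewrite -[RHS]uAy.
rewrite (reindex (@enum_val X X)); last by apply: onW_bij; apply: enum_val_bij.
by apply: eq_bigr => i _; rewrite enum_valK !mxE enum_rankK.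
Qed.

Section Monomials.
Variables (K : fieldType) (n D : nat).

(** Multi-indices with [m] entries at most [D], nested so that induction splits off the last
    entry. *)
Fixpoint exponents m : finType :=
  if m is m'.+1 then (exponents m' * 'I_D.+1)%type else unit.

Lemma card_exponents m : #|exponents m| = (D.+1 ^ m)%N.
Proof.
elim: m => [|m IHm]; first by rewrite card_unit.
by rewrite card_prod IHm card_ord expnSr.
Qed.

Variable f : nat -> {mpoly K[n]}.

Fixpoint monomial m : exponents m -> {mpoly K[n]} :=
  match m with
  | 0 => fun _ => 1
  | m'.+1 => fun e => @monomial m' e.1 * f m' ^+ e.2
  end.

(** The vanishing ideal of [B] is prime, so this is irreducibility of the Zariski closure of [B]. *)
Definition prime_locus (B : set ('I_n -> K)) : Prop :=
  B !=set0 /\ forall p q : {mpoly K[n]},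
    (forall v, B v -> p.@[v] * q.@[v] = 0) ->
    (forall v, B v -> p.@[v] = 0) \/ (forall v, B v -> q.@[v] = 0).

(* If [f i] separates two consecutive members of a chain of irreducible loci,
   the [f i] are algebraically independent on the last member: dividing a
   relation by a power of the last [f i] and restricting it to the last but one
   member yields a relation between the others. *)
Lemma monomial_free m (B : nat -> set ('I_n -> K)) :
    (forall i, (i <= m)%N -> prime_locus (B i)) ->
    (forall i, (i < m)%N -> B i `<=` B i.+1) ->
    (forall i, (i < m)%N -> forall v, B i v -> (f i).@[v] = 0) ->
    (forall i, (i < m)%N -> exists2 v, B i.+1 v & (f i).@[v] != 0) ->
  forall c : exponents m -> K,
    (forall v, B m v -> \sum_e c e * (monomial e).@[v] = 0) ->
  forall e, c e = 0.
Proof.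
elim: m => [|m IHm] Bprime Bsub f0 f1 c cB.
  have [[v Bv] _] := Bprime 0%N isT => -[].
  have := cB v Bv; rewrite (bigD1 tt) //= big1 => [|[] //].
  by rewrite meval1 mulr1 addr0.
have {}IHm := IHm (fun i im => Bprime i (leqW im)) (fun i im => Bsub i (leqW im))
  (fun i im => f0 i (leqW im)) (fun i im => f1 i (leqW im)).
suff cj (j : nat) (jD : (j < D.+1)%N) e : c (e, Ordinal jD) = 0.
  by case=> e [j jD]; apply: cj.
(* Coefficients with a smaller exponent of [f m] vanish already, so the relation is divisible by
   [f m ^+ j]; on [B m], where [f m] is 0, only the terms with exponent exactly [j] survive the
   division. *)
elim/ltn_ind: j jD e => j IHj jD; apply: IHm => v Bmv.
pose p : {mpoly K[n]} := \sum_(e : exponents m.+1 | (j <= e.2)%N)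
  c e *: (monomial e.1 * f m ^+ (e.2 - j)).
have pE w : p.@[w] = \sum_(e : exponents m.+1 | (j <= e.2)%N)
    c e * ((monomial e.1).@[w] * (f m).@[w] ^+ (e.2 - j)).
  by rewrite /p raddf_sum; apply: eq_bigr => e _; rewrite /= mevalZ mevalM rmorphXn.
have [Bm1 Bm2] := Bprime _ (leqnn m.+1).
have [w|fj|pB] := Bm2 (f m ^+ j) p.
- move=> Bw; rewrite -[RHS](cB w Bw) pE mulr_sumr.
  rewrite [RHS](bigID (fun e : exponents m.+1 => (j <= e.2)%N)) /=.
  rewrite [X in _ = _ + X]big1 ?addr0 => [|[e [k kD]] /=]; last first.
    by rewrite -ltnNge => kj; rewrite IHj ?mul0r.
  apply: eq_bigr => e je; rewrite rmorphXn mevalM rmorphXn /=.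
  by rewrite mulrCA; congr (_ * _); rewrite mulrCA -exprD subnKC.
- have [w Bw fw] := f1 m (ltnSn m).
  by have := fj w Bw; rewrite rmorphXn => /eqP; rewrite expf_eq0 (negbTE fw) andbF.
have := pB v (Bsub m (ltnSn m) v Bmv); rewrite pE => e0; rewrite -[RHS]e0.
pose F (e : exponents m) (k : 'I_D.+1) := if (j <= k)%N then
  c (e, k) * ((monomial e).@[v] * (f m).@[v] ^+ (k - j)) else 0.
rewrite [RHS]big_mkcond [RHS](eq_bigr (fun e => F e.1 e.2)); last first.
  by case=> e k _.
rewrite -(pair_bigA _ F) /F /=.
apply: eq_bigr => e _; rewrite (bigD1 (Ordinal jD)) //= leqnn subnn expr0 mulr1.
rewrite big1 ?addr0 // => k kj; case: leqP => // jk.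
rewrite f0 ?expr0n ?subn_eq0 //; case: leqP; rewrite ?mulr0 // => kj'.
by case/eqP: kj; apply/val_inj/eqP; rewrite eqn_leq kj' jk.
Qed.

End Monomials.

Section Dependence.
Variables (K : fieldType) (n : nat) (f : nat -> {mpoly K[n]}).

(** [msize] is the degree plus one; the summand 2 per factor absorbs the additive constants lost
    when bounding the size of a product. *)
Lemma msize_monomial D d m (e : exponents D m) :
    (forall i, (i < m)%N -> (msize (f i) < d)%N) ->
  (msize (monomial f e) <= (m * (D * d + 2)).+1)%N.
Proof.
elim: m e => [|m IHm] e fd; first by rewrite msize1.
case: e => e h /=.
have fX k : (k <= D)%N -> (msize (f m ^+ k) <= (k * d).+1)%N.
  elim: k => [|k IHk] kD; first by rewrite expr0 msize1.
  rewrite exprS; apply: leq_trans (msizeM_le _ _) _.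
  have := leq_add (fd m (ltnSn m)) (IHk (ltnW kD)); rewrite mulSn; lia.
apply: leq_trans (msizeM_le _ _) _.
have hD : (h <= D)%N by rewrite -ltnS.
have := leq_add (IHm e (fun i im => fd i (leqW im))) (fX h hD).
have : (h * d <= D * d)%N by rewrite leq_mul2r hD orbT.
rewrite mulSn; lia.
Qed.

(* The values of the polynomials of degree at most [d] at points whose
   coordinates are, up to [N]-th roots and constants, Laurent monomials in [r]
   parameters span a space of dimension O(d^r). *)
Lemma monomial_dependent (m r N : nat) (L : Type) (v : L -> 'I_n -> K)
    (eta : 'I_n -> K) (xi : L -> 'I_n -> K) (zeta : L -> 'I_r -> K)
    (nu : 'I_n -> 'I_r -> int) :
    (r < m)%N ->
    (forall l i, v l i = eta i * xi l i) ->
    (forall l j, zeta l j != 0) ->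
    (forall l i, xi l i ^+ N.+1 = \prod_j zeta l j ^ nu i j) ->
  exists D, exists2 c : exponents D m -> K, (exists e, c e != 0) &
    forall l, \sum_e c e * (monomial f e).@[v l] = 0.
Proof.
move=> rm vE zeta0 xiN.
pose d := (\max_(i < m) msize (f i)).+1%N.
have fd i : (i < m)%N -> (msize (f i) < d)%N.
  by move=> im; rewrite ltnS (leq_bigmax (Ordinal im)).
pose A := (\sum_i \sum_j `|nu i j|)%N.
(* [Delta] below bounds the exponents of the parameters. The choice of [B] gives 2 Delta + 1 <= B
   (D+1), so there are at most (N+1)^n B^r (D+1)^r = D (D+1)^r classes, fewer than the (D+1)^m
   multi-indices. *)
pose B := (2 * (A * (m * (d + 2))) + 1)%N.
pose D := (N.+1 ^ n * B ^ r)%N.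
pose Delta := (A * (m * (D * d + 2)))%N.
pose expo (mu : 'X_{1..n}) j : int := \sum_i nu i j * (mu i %/ N.+1)%:Z.
(* Up to a constant from [eta], the value of a monomial depends on its class alone: the exponents
   mod N+1 and, from the quotients, the exponents of the parameters, shifted by [Delta] to be
   natural numbers. *)
pose cls (mu : 'X_{1..n}) : {ffun 'I_n -> 'I_N.+1} * {ffun 'I_r -> 'I_(2 * Delta).+1} :=
  ([ffun i => inord (mu i %% N.+1)], [ffun j => inord (absz (expo mu j + Delta%:Z))]).
pose chi (l : L) (k : {ffun 'I_n -> 'I_N.+1} * {ffun 'I_r -> 'I_(2 * Delta).+1}) :=
  (\prod_i xi l i ^+ k.1 i) * \prod_j zeta l j ^ ((k.2 j : nat)%:Z - Delta%:Z).
have expo_bound mu j : (mdeg mu <= m * (D * d + 2))%N -> `|expo mu j| <= Delta%:Z.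
  move=> muD; apply: le_trans (ler_norm_sum _ _ _) _.
  rewrite /Delta /A PoszM (@big_morph _ _ Posz 0 +%R) // mulr_suml.
  apply: ler_sum => i _; rewrite normrM; apply: ler_pM => //.
    by rewrite (bigD1 j) //=; lia.
  have : (mu i %/ N.+1 <= m * (D * d + 2))%N.
    apply: leq_trans muD; rewrite mdegE (bigD1 i) //=.
    by apply: leq_trans (leq_addr _ _); apply: leq_div.
  by rewrite -lez_nat.
have muE mu l : (mdeg mu <= m * (D * d + 2))%N ->
    \prod_i v l i ^+ mu i = (\prod_i eta i ^+ mu i) * chi l (cls mu).
  move=> muD; rewrite /chi mulrA -big_split /=.
  under eq_bigr do rewrite vE exprMn.
  rewrite [LHS]big_split big_split -mulrA; congr (_ * _).
  under eq_bigr do rewrite [X in _ ^+ X](divn_eq _ N.+1) mulnC exprD exprM xiN.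
  rewrite big_split mulrC; congr (_ * _) => /=.
    under eq_bigr do rewrite -prodrXl.
    rewrite exchange_big; apply: eq_bigr => j _ /=.
    rewrite ffunE inordK; last first.
      by have := expo_bound mu j muD; lia.
    have -> : (absz (expo mu j + Delta%:Z))%:Z - Delta%:Z = expo mu j.
      by have := expo_bound mu j muD; lia.
    rewrite /expo (@big_morph _ _ (fun x => zeta l j ^ x) 1 *%R 0 +%R); last 2 first.
    - by move=> x y; rewrite expfzDr.
    - by [].
    by apply: eq_bigr => i _; rewrite -exprz_exp.
  by apply: eq_bigr => i _; rewrite ffunE inordK ?ltn_mod.
pose M (e : exponents D m) k := \sum_(mu <- msupp (monomial f e) | cls mu == k)
  (monomial f e)@_mu * \prod_i eta i ^+ mu i.
have [|c c0 cM] := @linear_dependence K _ _ M.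
  rewrite card_exponents card_prod !card_ffun !card_ord.
  apply: (@leq_ltn_trans (D * D.+1 ^ r)); last first.
    by rewrite -(subnK rm) expnD expnS; nia.
  have DE : D = (N.+1 ^ n * B ^ r)%N by [].
  rewrite {1}DE -mulnA leq_mul2l -expnMn; apply/orP; right.
  have [->|r0] := posnP r; first by rewrite !expn0.
  rewrite leq_exp2r // /Delta /B; clear DE; clearbody D.
  have le : (D * d + 2 <= (d + 2) * D.+1)%N by nia.
  apply: (@leq_trans (2 * (A * (m * ((d + 2) * D.+1)))).+1).
    by rewrite ltnS !leq_mul2l le !orbT.
  by rewrite !mulnA mulnDl mul1n -[leqLHS]addn1 leq_add2l.
exists D, c => // l.
transitivity (\sum_k (\sum_e c e * M e k) * chi l k); last first.
  by rewrite big1 // => k _; rewrite cM mul0r.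
under [RHS]eq_bigr do rewrite mulr_suml.
rewrite exchange_big; apply: eq_bigr => e _ /=.
under [RHS]eq_bigr do rewrite -mulrA.
rewrite -mulr_sumr; congr (_ * _); rewrite mevalE.
under [RHS]eq_bigr do rewrite mulr_suml.
rewrite (exchange_big_dep predT) //= big_seq [RHS]big_seq; apply: eq_bigr => mu mue.
rewrite (big_pred1 (cls mu)) => [|k]; last by rewrite eq_sym.
rewrite muE ?mulrA // -ltnS.
by apply: leq_trans (msize_mdeg_lt mue) _; apply: msize_monomial.
Qed.

End Dependence.

(** * The lattice of cycles in the support *)

Lemma sum_indicatorB (R : nzRingType) (X : finType) (x y : X) :
  \sum_z ((z == x)%:R - (z == y)%:R) = 0 :> R.
Proof.
have ind u : \sum_z (z == u)%:R = 1 :> R.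
  by rewrite (bigD1 u) //= eqxx big1 ?addr0 // => z /negbTE->.
by rewrite sumrB !ind subrr.
Qed.

Section FinMatrix.
Variables (K : fieldType).
Implicit Types (X Y Z : finType).

Definition vec X (f : X -> K) : 'rV_#|X| := \row_i f (enum_val i).

Definition fmx X Y (A : X -> Y -> K) : 'M_(#|X|, #|Y|) :=
  \matrix_(i, j) A (enum_val i) (enum_val j).

Lemma sum_enum_val X (f : X -> K) : \sum_(i < #|X|) f (enum_val i) = \sum_x f x.
Proof.
rewrite [RHS](reindex (@enum_val X X)) //; apply: onW_bij; exact: enum_val_bij.
Qed.

Lemma vec_entries X (u : 'rV_#|X|) : u = vec (fun x => u 0 (enum_rank x)).
Proof. by apply/rowP => i; rewrite mxE enum_valK. Qed.

Lemma vec_inj X (f g : X -> K) : vec f = vec g -> f =1 g.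
Proof. by move=> /rowP e x; have := e (enum_rank x); rewrite !mxE enum_rankK. Qed.

Lemma eq_vec X (f g : X -> K) : f =1 g -> vec f = vec g.
Proof. by move=> fg; apply/rowP => i; rewrite !mxE fg. Qed.

Lemma vec_eq0 X (f : X -> K) : vec f = 0 <-> forall x, f x = 0.
Proof.
split=> [/rowP e x|f0]; first by have := e (enum_rank x); rewrite !mxE enum_rankK.
by apply/rowP => i; rewrite !mxE f0.
Qed.

Lemma mul_vec_fmx X Y (f : X -> K) (A : X -> Y -> K) :
  vec f *m fmx A = vec (fun y => \sum_x f x * A x y).
Proof.
apply/rowP => j; rewrite !mxE -[RHS]sum_enum_val; apply: eq_bigr => i _.
by rewrite !mxE.
Qed.

Lemma row_fmx X Y (A : X -> Y -> K) i : row i (fmx A) = vec (A (enum_val i)).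
Proof. by apply/rowP => j; rewrite !mxE. Qed.

Lemma submx_vecP m X (A : 'M_(m, #|X|)) p (B : 'M_(p, #|X|)) :
  (forall f : X -> K, (vec f <= A)%MS -> (vec f <= B)%MS) <-> (A <= B)%MS.
Proof.
split=> [h|AB f fA]; last exact: submx_trans AB.
by apply/rV_subP => v; rewrite (vec_entries v); apply: h.
Qed.

Lemma fmx_sub_vecP X Y (A : X -> Y -> K) p (B : 'M_(p, #|Y|)) :
  (forall x, (vec (A x) <= B)%MS) -> (fmx A <= B)%MS.
Proof. by move=> h; apply/row_subP => i; rewrite row_fmx. Qed.

Lemma sub_fmx_vecP X Y (A : X -> Y -> K) (f : Y -> K) :
  (vec f <= fmx A)%MS <-> exists g : X -> K, forall y, f y = \sum_x g x * A x y.
Proof.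
split=> [/submxP[u]|[g fg]].
  by rewrite (vec_entries u) mul_vec_fmx => /vec_inj; exists (fun x => u 0 (enum_rank x)).
by apply/submxP; exists (vec g); rewrite mul_vec_fmx; apply: eq_vec.
Qed.

Lemma vec_kermxP X Y (A : X -> Y -> K) (f : X -> K) :
  (vec f <= kermx (fmx A))%MS <-> forall y, \sum_x f x * A x y = 0.
Proof. by rewrite -vec_eq0 -mul_vec_fmx; split=> /sub_kermxP. Qed.

Lemma rank_vec X (f : X -> K) x : f x != 0 -> \rank (vec f) = 1%N.
Proof.
move=> fx; rewrite rank_rV; case: eqP => // /vec_eq0 f0.
by rewrite f0 eqxx in fx.
Qed.

End FinMatrix.

Lemma common_denominator (I : finType) (q : I -> rat) :
  exists N, exists z : I -> int, forall i, N.+1%:R * q i = (z i)%:~R.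
Proof.
pose N := (\prod_i `|denq (q i)|)%N.
have N0 : (0 < N)%N by apply: prodn_gt0 => i; rewrite absz_gt0 denq_eq0.
exists N.-1; rewrite prednK //.
exists (fun i => numq (q i) * (\prod_(j | j != i) `|denq (q j)|)%N%:Z) => i.
rewrite /N (bigD1 i) //= natrM mulrAC rmorphM /= pmulrn; congr (_ * _).
by rewrite -{2}[q i]divq_num_den absz_denq mulrC divfK // intr_eq0 denq_eq0.
Qed.

Section Nullity.
Variables (T : brane_tiling).
Implicit Types (a b : edge T) (v w : vertex T) (i j : face T) (I S : {set edge T}).
Implicit Types (psi : vertex T -> rat).

(* The combinations of the [d_2 F] with total weight 0 (these vanish in Lambda)
   that do not involve the edges of [I]. *)
Definition star_relations I : 'M[rat]_#|vertex T| :=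
  kermx (row_mx (fmx (fun v a => ((a \in I) && (a \in star v))%:R))
                (fmx (fun _ (_ : unit) => 1))).

Lemma sum_psi_star psi a (P : pred (edge T)) : P a ->
  \sum_v psi v * ((P a) && (a \in star v))%:R = psi (white_end a) + psi (black_end a).
Proof.
move=> ->; rewrite (bigD1 (white_end a)) //= white_end_in mulr1; congr (_ + _).
rewrite (bigD1 (black_end a)) //= black_end_in mulr1 big1 ?addr0 // => v.
by rewrite in_star; case: eqP; case: eqP => // _ _ _; rewrite mulr0.
Qed.

Lemma star_relationsP I psi : (vec psi <= star_relations I)%MS <->
  \sum_v psi v = 0 /\ forall a, a \in I -> psi (white_end a) + psi (black_end a) = 0.
Proof.
have -> : (vec psi <= star_relations I)%MS <->
  (vec psi *m row_mx (fmx (fun v a => ((a \in I) && (a \in star v))%:R))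
                (fmx (fun _ (_ : unit) => 1)) = 0).
  by split=> /sub_kermxP.
rewrite mul_mx_row -row_mx0 !mul_vec_fmx; split=> [/eq_row_mx[/vec_eq0 e1 /vec_eq0 e2]|[e1 e2]].
  split=> [|a aI]; first by rewrite -[RHS](e2 tt); apply: eq_bigr => v _; rewrite mulr1.
  by have := e1 a; rewrite (sum_psi_star psi (P := mem I)).
congr row_mx; [apply/vec_eq0 => a|apply/vec_eq0 => _]; last first.
  by rewrite -[RHS]e1; apply: eq_bigr => v _; rewrite mulr1.
case: (boolP (a \in I)) => aI.
  rewrite -[RHS](e2 a aI) -(sum_psi_star psi (P := mem I)) //.
  by apply: eq_bigr => v _; rewrite /= aI.
by rewrite big1 // => v _; rewrite mulr0.
Qed.

Definition sign v : rat := if v is inl _ then 1 else -1.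

Hypothesis balanced : nwhite T = nblack T.

Lemma sum_sign : \sum_v sign v = 0.
Proof. by rewrite sum_white_black balanced subrr. Qed.

(** Along each edge the value changes sign, so connectedness leaves only the multiples of [sign]. *)
Lemma rank_star_relationsT : \rank (star_relations [set: edge T]%SET) = 1%N.
Proof.
have [a0 _] := edge_inhabited T.
have rel_sign : (vec sign <= star_relations [set: edge T]%SET)%MS.
  apply/star_relationsP; split=> [|a _]; first exact: sum_sign.
  by rewrite /= addrN.
have sign_rel : (star_relations [set: edge T]%SET <= vec sign)%MS.
  apply/submx_vecP => psi /star_relationsP[_ psi0].
  suff e v : psi v = psi (white_end a0) * sign v.
    apply/submxP; exists (psi (white_end a0))%:M; rewrite mul_scalar_mx.
    by apply/rowP => i; rewrite !mxE e.
  apply: (vertex_ind (P := fun v => psi v = psi (white_end a0) * sign v) _ (v := white_end a0)).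
    move=> a; have := psi0 a; rewrite inE => /(_ isT)/eqP.
    rewrite addr_eq0 => /eqP -> /=; rewrite mulr1 mulrN1.
    by split=> [<-|->]; rewrite opprK.
  by rewrite mulr1.
transitivity (\rank (vec sign)); last exact: (@rank_vec _ _ _ (white_end a0)).
by apply/eqP; rewrite eqn_leq !mxrankS.
Qed.

End Nullity.

(** * The rank of the cycles of the support in Lambda *)

Section CycleRank.
Variables (R : realType) (T : brane_tiling).
Implicit Types (a b : edge T) (v w : vertex T) (i j : face T).
Implicit Types (psi : vertex T -> rat) (f : edge T -> rat).
Hypothesis balanced : nwhite T = nblack T.

Variables (S : {set edge T}) (i0 : face T) (gamma : face T -> {ffun edge T -> int}).
Hypothesis gammaP : path_system R S i0 gamma.
Hypothesis S_connected : forall X : {set face T}, (exists i, i \in X) ->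
  (forall a, a \in S -> (src a \in X) = (tgt a \in X)) -> forall i, i \in X.

Local Notation I := (~: S)%SET.

Definition cyc a : {ffun edge T -> int} :=
  if a \in S then cycle_class gamma a else 0.

Lemma is_path_cyc a : is_path R S i0 i0 (cyc a).
Proof.
rewrite /cyc; case: ifP => [|_]; last exact: is_path0.
exact: (is_path_cycle_class gammaP).
Qed.

Definition cycles := fmx (fun a b => (cyc a b)%:~R : rat).
Definition incidence := fmx (fun v b => (b \in star v)%:R : rat).
(* Lambda is the quotient by the integral points of this row space. *)
Definition face_relations := kermx (fmx (fun v (_ : unit) => 1 : rat)) *m incidence.
(* Hom(Lambda, Q) *)
Definition dual_Lambda := kermx face_relations^T.
Definition boundary : 'M[rat]_(#|edge T|, #|face T|) :=
  fmx (fun a i => (tgt a == i)%:R - (src a == i)%:R).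
Definition select : 'M[rat]_(#|S|, #|edge T|) :=
  \matrix_(h, j) (enum_val h == enum_val j)%:R.
Definition pairing := cycles *m dual_Lambda^T.
Definition cycle_rank := \rank pairing.

Lemma sub_selectP f : (vec f <= select)%MS <-> forall a, a \notin S -> f a = 0.
Proof.
split=> [/submxP[u /rowP e] a aS|f0].
  have := e (enum_rank a); rewrite !mxE enum_rankK => ->.
  rewrite big1 // => h _; rewrite !mxE enum_rankK.
  case: eqP => [ha|_]; last by rewrite mulr0.
  by have := enum_valP h; rewrite ha (negbTE aS).
apply/submxP; exists (\row_h f (enum_val h)); apply/rowP => j; rewrite !mxE.
have [aS|aS] := boolP (enum_val j \in S).
  rewrite (bigD1 (enum_rank_in aS (enum_val j))) //= !mxE enum_rankK_in // eqxx mulr1.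
  rewrite big1 ?addr0 // => h hj; rewrite !mxE.
  case: eqP => [e|]; rewrite ?mulr0 //; case/eqP: hj.
  by apply: enum_val_inj; rewrite enum_rankK_in.
rewrite f0 // big1 // => h _; rewrite !mxE.
case: eqP => [e|]; rewrite ?mulr0 //.
by have := enum_valP h; rewrite e (negbTE aS).
Qed.

Lemma rank_select : \rank select = #|S|.
Proof.
apply/eqP/row_freeP; exists select^T; apply/matrixP => h k; rewrite !mxE.
rewrite (bigD1 (enum_rank (enum_val h))) //= !mxE enum_rankK eqxx mul1r.
rewrite big1 ?addr0 => [|j jh].
  by rewrite eq_sym (inj_eq enum_val_inj).
rewrite !mxE; case: eqP => [e|]; rewrite ?mul0r //.
by case/eqP: jh; rewrite e enum_valK.
Qed.

Lemma sub_kernel_boundaryP f : (vec f <= kermx boundary)%MS <->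
  forall g : face T -> rat, \sum_a f a * (g (tgt a) - g (src a)) = 0.
Proof.
rewrite vec_kermxP; split=> [fb g|fg i]; last first.
  by rewrite -[RHS](fg (fun j => (j == i)%:R)).
transitivity (\sum_i g i * \sum_a f a * ((tgt a == i)%:R - (src a == i)%:R)).
  under [RHS]eq_bigr do rewrite mulr_sumr.
  rewrite exchange_big; apply: eq_bigr => a _ /=.
  rewrite (eq_bigr (fun i => f a * (g i * (tgt a == i)%:R - g i * (src a == i)%:R))).
    rewrite -mulr_sumr sumrB; congr (_ * (_ - _)).
      by rewrite (bigD1 (tgt a)) //= eqxx mulr1 big1 ?addr0 // => i /negbTE;
        rewrite eq_sym => ->; rewrite mulr0.
    by rewrite (bigD1 (src a)) //= eqxx mulr1 big1 ?addr0 // => i /negbTE;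
        rewrite eq_sym => ->; rewrite mulr0.
  by move=> i _; rewrite mulrCA mulrBr.
by rewrite big1 // => i _; rewrite fb mulr0.
Qed.

(** A flow on [S] without boundary is the combination of the fundamental cycles with its own values
    as coefficients: the contributions of [gamma] cancel because the boundary is 0. *)
Lemma sub_cyclesP f : (vec f <= cycles)%MS <->
  (vec f <= select :&: kermx boundary)%MS.
Proof.
split=> [|].
  move=> h; apply: submx_trans h _; apply: fmx_sub_vecP => a.
  have [cS cf _] := is_path_cyc a.
  rewrite sub_capmx; apply/andP; split; first by apply/sub_selectP => b /cS ->.
  by apply/sub_kernel_boundaryP => g; rewrite cf subrr.
rewrite sub_capmx => /andP[/sub_selectP fS /sub_kernel_boundaryP fb].
apply/sub_fmx_vecP; exists f => b.
transitivity (\sum_a f a * (delta a b)%:~R +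
  \sum_a f a * ((gamma (src a) b)%:~R - (gamma (tgt a) b)%:~R)).
  have -> : \sum_a f a * ((gamma (src a) b)%:~R - (gamma (tgt a) b)%:~R) = 0 :> rat.
    transitivity (- \sum_a f a * ((gamma (tgt a) b)%:~R - (gamma (src a) b)%:~R)).
      by rewrite -sumrN; apply: eq_bigr => a _; rewrite -mulrN opprB.
    by rewrite (fb (fun i => (gamma i b)%:~R)) oppr0.
  rewrite addr0 (bigD1 b) //= ffunE eqxx mulr1 big1 ?addr0 // => a ab.
  by rewrite ffunE eq_sym (negbTE ab) mulr0.
rewrite -big_split; apply: eq_bigr => a _ /=; rewrite /cyc.
case: ifP => [_|/negbT/fS ->]; last by rewrite !mul0r addr0.
rewrite -mulrDr /cycle_class; congr (_ * _).
by rewrite !ffunE -rmorphB -rmorphD.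
Qed.

Lemma sum_delta (g : face T -> rat) i : \sum_j g j * (i == j)%:R = g i.
Proof.
rewrite (bigD1 i) //= eqxx mulr1 big1 ?addr0 // => j ji.
by rewrite eq_sym (negbTE ji) mulr0.
Qed.

Lemma sub_kermx_select_boundaryP (g : face T -> rat) :
  (vec g <= kermx (select *m boundary)^T)%MS <->
  forall a, a \in S -> g (tgt a) = g (src a).
Proof.
have sbE h : (vec g *m (select *m boundary)^T) 0 h =
    g (tgt (enum_val h)) - g (src (enum_val h)).
  rewrite mxE -!sum_delta -sumrB -[RHS]sum_enum_val; apply: eq_bigr => j _.
  rewrite !mxE -mulrBr; congr (_ * _).
  rewrite (bigD1 (enum_rank (enum_val h))) //= !mxE enum_rankK eqxx mul1r.
  rewrite big1 ?addr0 // => k kh; rewrite !mxE.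
  case: eqP => [e|]; rewrite ?mul0r //.
  by case/eqP: kh; rewrite e enum_valK.
split=> [/sub_kermxP/rowP e a aS|gS].
  have := e (enum_rank_in aS a); rewrite sbE enum_rankK_in // mxE => /eqP.
  by rewrite subr_eq0 => /eqP.
apply/sub_kermxP/rowP => h; rewrite sbE mxE gS ?subrr //; exact: enum_valP.
Qed.

(** The kernel of the transpose consists of the functions on Q_0 with equal values at the ends of
    each arrow of [S], that is, of the constants. *)
Lemma rank_select_boundary : (\rank (select *m boundary)).+1 = #|face T|.
Proof.
rewrite -mxrank_tr.
have e := mxrank_ker (select *m boundary)^T.
have rk1 : \rank (kermx (select *m boundary)^T) = 1%N.
  pose one : face T -> rat := fun=> 1.
  have kone : (vec one <= kermx (select *m boundary)^T)%MS by apply/sub_kermx_select_boundaryP.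
  have onek : (kermx (select *m boundary)^T <= vec one)%MS.
    apply/submx_vecP => g /sub_kermx_select_boundaryP gS; apply/submxP; exists (g i0)%:M.
    rewrite mul_scalar_mx; apply/rowP => h; rewrite !mxE mulr1.
    pose X := [set i | g i == g i0]%SET.
    suff : enum_val h \in X by rewrite inE => /eqP.
    apply: S_connected; first by exists i0; rewrite inE.
    by move=> a aS; rewrite !inE gS.
  transitivity (\rank (vec one)); last exact: (@rank_vec _ _ _ i0).
  by apply/eqP; rewrite eqn_leq !mxrankS.
have rF : (\rank (select *m boundary)^T < #|face T|)%N by rewrite -subn_gt0 -e rk1.
by rewrite -addn1 -rk1 e subnKC // ltnW.
Qed.

(** First Betti number of the connected graph on Q_0 with edge set [S]. *)
Lemma rank_cycles : (\rank cycles + #|face T| = #|S|.+1)%N.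
Proof.
have -> : \rank cycles = \rank (select :&: kermx boundary)%MS.
  by apply/eqP; rewrite eqn_leq !mxrankS //; apply/submx_vecP => f /sub_cyclesP.
have h1 := rank_select_boundary; have h2 := mxrank_mul_ker select boundary.
rewrite rank_select in h2; move: h1 h2.
by move: (\rank _) (\rank _) => p q; lia.
Qed.

Lemma sub_face_relationsP f : (vec f <= face_relations)%MS <->
  exists2 psi, \sum_v psi v = 0 &
    forall a, f a = psi (white_end a) + psi (black_end a).
Proof.
have sumE psi a : \sum_v psi v * (a \in star v)%:R =
    psi (white_end a) + psi (black_end a).
  exact: (@sum_psi_star _ psi a predT).
have kerP psi : (vec psi <= kermx (fmx (fun v (_ : unit) => 1%R : rat)))%MS <->
    \sum_v psi v = 0.
  have e1 : \sum_v psi v * 1 = \sum_v psi v by apply: eq_bigr => v _; rewrite mulr1.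
  by rewrite vec_kermxP e1; split=> [/(_ tt)|].
split=> [/submxP[u]|[psi psi0 fE]].
  rewrite mulmxA (vec_entries (u *m _)) mul_vec_fmx => /vec_inj e.
  exists (fun v => (u *m kermx (fmx (fun v (_ : unit) => 1%R : rat))) 0 (enum_rank v)).
    by apply/kerP; rewrite -vec_entries submxMl.
  by move=> a; rewrite e sumE.
have -> : vec f = vec psi *m incidence.
  by rewrite mul_vec_fmx; apply: eq_vec => a; rewrite fE sumE.
by apply/submxMr/kerP.
Qed.

(** Stars are closed paths in Q, so [incidence] maps [star_relations I] onto this intersection. The
    kernel is spanned by [sign], whence the difference 1. *)
Lemma rank_cycles_relations :
  ((\rank (cycles :&: face_relations)%MS).+1 = \rank (star_relations I))%N.
Proof.
rewrite -(mxrank_mul_ker (star_relations I) incidence) -addn1; congr addn.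
  have h1 : (cycles :&: face_relations <= star_relations I *m incidence)%MS.
    apply/submx_vecP => f; rewrite sub_capmx => /andP[/sub_cyclesP fC /sub_face_relationsP[psi psi0 fE]].
    have -> : vec f = vec psi *m incidence.
      by rewrite mul_vec_fmx; apply: eq_vec => a; rewrite fE (@sum_psi_star _ psi a predT).
    apply/submxMr/star_relationsP; split=> // a; rewrite inE => aS.
    by move: fC; rewrite sub_capmx => /andP[/sub_selectP fS _]; rewrite -fE fS.
  have h2 : (star_relations I *m incidence <= cycles :&: face_relations)%MS.
    apply/submx_vecP => f /submxP[u].
    rewrite mulmxA (vec_entries (u *m _)) mul_vec_fmx => /vec_inj e.
    set psi := fun v => (u *m star_relations I) 0 (enum_rank v) in e.
    have /star_relationsP[psi0 psiI] : (vec psi <= star_relations I)%MS.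
      by rewrite -vec_entries submxMl.
    have fE a : f a = psi (white_end a) + psi (black_end a).
      by rewrite e (@sum_psi_star _ psi a predT).
    rewrite sub_capmx; apply/andP; split; last by apply/sub_face_relationsP; exists psi.
    apply/sub_cyclesP; rewrite sub_capmx; apply/andP; split.
      by apply/sub_selectP => a aS; rewrite fE psiI // inE.
    apply/sub_kernel_boundaryP => g.
    transitivity (\sum_v \sum_(a in star v) psi v * (g (tgt a) - g (src a))).
      by rewrite sum_star; apply: eq_bigr => a _; rewrite fE mulrDl.
    rewrite big1 // => v _; rewrite -mulr_sumr sumrB.
    by rewrite (@star_reindex T _ _ +%R g) subrr mulr0.
  by apply/eqP; rewrite eqn_leq !mxrankS.
rewrite -(rank_star_relationsT balanced).
apply/eqP; rewrite eqn_leq !mxrankS //; apply/submx_vecP => psi.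
  rewrite sub_capmx => /andP[/star_relationsP[psi0 _] /vec_kermxP psiT].
  apply/star_relationsP; split=> // a _.
  by rewrite -(@sum_psi_star _ psi a predT) // psiT.
move=> /star_relationsP[psi0 psiT]; rewrite sub_capmx; apply/andP; split.
  by apply/star_relationsP; split=> // a _; apply: psiT; rewrite inE.
apply/vec_kermxP => a; rewrite (@sum_psi_star _ psi a predT) // psiT //.
Qed.

Lemma kermx_dual_Lambda : (kermx dual_Lambda^T <= face_relations)%MS.
Proof.
have le : (face_relations <= kermx dual_Lambda^T)%MS.
  by apply/sub_kermxP; apply: trmx_inj; rewrite trmx_mul trmxK trmx0 mulmx_ker.
have := mxrank_leqif_eq le; rewrite !mxrank_ker mxrank_tr mxrank_ker mxrank_tr.
rewrite subKn ?rank_leq_col //; case=> _; rewrite eqxx => /esym/andP[].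
done.
Qed.

(** With n the rank of [star_relations I], [rank_cycles] and [rank_cycles_relations] give r = (|S| -
    |Q_0| + 1) - (n - 1), and |S| - |Q_0| = |V| - |I| by Euler's formula. *)
Lemma cycle_rankE :
  (cycle_rank + #|I| + \rank (star_relations I) = #|vertex T| + 2)%N.
Proof.
have e1 := mxrank_mul_ker cycles dual_Lambda^T.
have e2 : \rank (cycles :&: kermx dual_Lambda^T)%MS =
          \rank (cycles :&: face_relations)%MS.
  have le : (face_relations <= kermx dual_Lambda^T)%MS.
    by apply/sub_kermxP; apply: trmx_inj; rewrite trmx_mul trmxK trmx0 mulmx_ker.
  apply/eqP; rewrite eqn_leq !mxrankS // capmxS //; exact: kermx_dual_Lambda.
have := rank_cycles; have := rank_cycles_relations; have := card_edge T.
have := cardsC S; move: e1; rewrite e2 /cycle_rank /pairing.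
by move: (\rank _) (\rank _) (\rank _) (\rank _) => p q s t; lia.
Qed.

(** Grouped by vertices, the product is the common value of [l] on all stars raised to the power
    [\sum_v psi v]. *)
Lemma torus_Lambda_relation (l : rep R T) (psi : vertex T -> int) :
  torus_Lambda l -> \sum_v psi v = 0 ->
  \prod_a l a ^ (psi (white_end a) + psi (black_end a)) = 1.
Proof.
move=> [l0 lv] psi0.
rewrite (eq_bigr (fun a => l a ^ psi (white_end a) * l a ^ psi (black_end a))).
  rewrite -(prod_star (fun v a => l a ^ psi v)).
  have [a0 _] := edge_inhabited T.
  rewrite (eq_bigr (fun v => (\prod_(a in star (white_end a0)) l a) ^ psi v)).
    rewrite -(@big_morph _ _ (fun n => (\prod_(a in star (white_end a0)) l a) ^ n) 1 *%R 0 +%R) //.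
      by rewrite psi0.
    move=> n m; rewrite expfzDr //; apply/prodf_neq0 => a _; exact: l0.
  move=> v _; rewrite -(lv v).
  by rewrite (@big_morph _ _ (fun y => y ^ psi v) 1 *%R 1 *%R) ?exp1rz // => y z; rewrite expfzMl.
by move=> a _; rewrite expfzDr.
Qed.

(** [u] selects rows of [pairing] forming a basis of its row space. Every cycle is a combination of
    these up to a vector annihilated by Hom(Lambda, Q), which is a combination of stars with weights
    [psi] of sum 0; a right inverse of the selected rows yields the dual functionals [lam]. *)
Lemma cycle_relation : exists (u : 'I_cycle_rank -> edge T)
    (q : edge T -> 'I_cycle_rank -> rat) (psi : edge T -> vertex T -> rat)
    (lam : 'I_cycle_rank -> edge T -> rat),
  [/\ forall a b, (cyc a b)%:~R = \sum_s q a s * (cyc (u s) b)%:~R +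
        (psi a (white_end b) + psi a (black_end b)),
      forall a, \sum_v psi a v = 0,
      forall s v w, \sum_(a in star v) lam s a = \sum_(a in star w) lam s a
    & forall s t, \sum_a lam s a * (cyc (u t) a)%:~R = (s == t)%:R].
Proof.
pose h : 'I_cycle_rank -> 'I_#|edge T| := maxrankfun pairing.
have [Q pQ] : exists Q, pairing = Q *m rowsub h pairing.
  by apply/submxP; rewrite eq_maxrowsub.
have [X pX] : exists X, rowsub h pairing *m X = 1%:M.
  by apply/row_freeP; apply: maxrowsub_free.
have [L LE] : exists L, L = X^T *m dual_Lambda by eexists.
have cQ : (cycles - Q *m rowsub h cycles <= face_relations)%MS.
  apply: submx_trans kermx_dual_Lambda; apply/sub_kermxP.
  by rewrite mulmxBl -mulmxA mul_rowsub_mx -/pairing -pQ subrr.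
have /fin_all_exists[psi psiP] : forall a, exists p : vertex T -> rat,
    \sum_v p v = 0 /\ forall b, (cyc a b)%:~R -
      \sum_s Q (enum_rank a) s * (cyc (enum_val (h s)) b)%:~R =
      p (white_end b) + p (black_end b).
  move=> a.
  suff /sub_face_relationsP[psi psi0 psiE] : (vec (fun b => (cyc a b)%:~R -
      \sum_s Q (enum_rank a) s * (cyc (enum_val (h s)) b)%:~R) <= face_relations)%MS.
    by exists psi.
  have := row_subP cQ (enum_rank a); congr (_ <= _)%MS.
  apply/rowP => j; rewrite !mxE enum_rankK; congr (_ - _).
  by apply: eq_bigr => s _; rewrite !mxE.
exists (fun s => enum_val (h s)), (fun a s => Q (enum_rank a) s), psi.
exists (fun s a => L s (enum_rank a)); split.
- by move=> a b; have [_ <-] := psiP a; rewrite addrC subrK.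
- by move=> a; have [] := psiP a.
- move=> s v w; apply/eqP; rewrite -subr_eq0; apply/eqP.
  pose f a : rat := (a \in star v)%:R - (a \in star w)%:R.
  have /submxP[y fy] : (vec f <= face_relations)%MS.
    apply/sub_face_relationsP; exists (fun z => (z == v)%:R - (z == w)%:R) => [|a].
      exact: sum_indicatorB.
    rewrite /f !in_star addrACA -opprD; congr (_ - _).
      rewrite eq_sym [v == black_end a]eq_sym; case: eqP => [<-|_] //=.
      by rewrite add0r.
    rewrite eq_sym [w == black_end a]eq_sym; case: eqP => [<-|_] //=.
    by rewrite add0r.
  transitivity ((row s L *m (vec f)^T) 0 0).
    have sumL z : \sum_j L s j * (enum_val j \in star z)%:R =
        \sum_(a in star z) L s (enum_rank a).
      rewrite [RHS]big_mkcond -[RHS]sum_enum_val; apply: eq_bigr => j _.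
      by rewrite enum_valK; case: (_ \in _); rewrite ?mulr1 ?mulr0.
    apply: esym; rewrite mxE; under eq_bigr do rewrite !mxE mulrBr.
    by rewrite sumrB !sumL.
  rewrite fy trmx_mul mulmxA [row s L *m _](_ : _ = 0) ?mul0mx ?mxE //.
  by apply/sub_kermxP; rewrite LE row_mul submxMl.
move=> s t.
have := congr1 (fun A : 'M_cycle_rank => A t s) pX.
have LT : dual_Lambda^T *m X = L^T by rewrite LE [RHS]trmx_mul trmxK.
rewrite /pairing -mul_rowsub_mx -mulmxA LT.
rewrite mxE [RHS]mxE eq_sym => <-.
rewrite -sum_enum_val; apply: eq_bigr => j _.
by rewrite enum_valK !mxE mulrC.
Qed.

(** [cycle_relation] with denominators cleared. The selected cycles need not generate over Z, so
    only (N+1)-st powers of the other monomials are expressed, and the functionals are dual up to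
    the factor M+1. *)
Lemma cycle_basis : exists (u : 'I_cycle_rank -> edge T) (N M : nat)
    (nu : edge T -> 'I_cycle_rank -> int)
    (lam : 'I_cycle_rank -> {ffun edge T -> int}),
  [/\ forall (l : rep R T) a, torus_Lambda l ->
        laurent l (cyc a) ^+ N.+1 = \prod_s laurent l (cyc (u s)) ^ nu a s,
      forall s v w, \sum_(a in star v) lam s a = \sum_(a in star w) lam s a
    & forall s t, \sum_a lam s a * cyc (u t) a = if s == t then M.+1%:Z else 0].
Proof.
have [u [q [psi [lam [cE psi0 lam_star lam_cyc]]]]] := cycle_relation.
have [N [z zE]] := common_denominator (fun p : edge T * ('I_cycle_rank + vertex T) =>
  match p.2 with inl s => q p.1 s | inr v => psi p.1 v end).
have [M [y yE]] := common_denominator (fun p : 'I_cycle_rank * edge T => lam p.1 p.2).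
pose nu a s := z (a, inl s); pose chi a v := z (a, inr v).
have zq a s : N.+1%:R * q a s = (nu a s)%:~R := zE (a, inl s).
have zpsi a v : N.+1%:R * psi a v = (chi a v)%:~R := zE (a, inr v).
have yl s a : M.+1%:R * lam s a = (y (s, a))%:~R := yE (s, a).
exists u, N, M, nu, (fun s => [ffun a => y (s, a)]); split.
- move=> l a lT.
  have chi0 : \sum_v chi a v = 0.
    apply: (@intr_inj rat); rewrite rmorph_sum rmorph0.
    rewrite (eq_bigr (fun v => N.+1%:R * psi a v)) => [|v _]; last by rewrite zpsi.
    by rewrite -mulr_sumr psi0 mulr0.
  have cN b : cyc a b * N.+1%:Z =
      \sum_s nu a s * cyc (u s) b + (chi a (white_end b) + chi a (black_end b)).
    apply: (@intr_inj rat); rewrite rmorphM rmorphD rmorph_sum /= cE mulrC mulrDr.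
    rewrite mulr_sumr; congr (_ + _); last by rewrite mulrDr !zpsi rmorphD.
    by apply: eq_bigr => s _; rewrite mulrA zq rmorphM.
  transitivity (laurent l [ffun b => cyc a b * N.+1%:Z]); first by rewrite laurentX.
  have l0 := lT.1.
  transitivity (\prod_b (\prod_s (l b ^ cyc (u s) b) ^ nu a s) * 
      \prod_b l b ^ (chi a (white_end b) + chi a (black_end b))).
    rewrite -big_split; apply: eq_bigr => b _ /=.
    rewrite ffunE cN expfzDr //; congr (_ * _).
    rewrite (@big_morph _ _ (fun n => l b ^ n) 1 *%R 0 +%R) //; last first.
      by move=> n m; rewrite expfzDr.
    by apply: eq_bigr => s _; rewrite mulrC exprz_exp.
  rewrite torus_Lambda_relation // mulr1 exchange_big; apply: eq_bigr => s _ /=.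
  by rewrite -laurentX; apply: eq_bigr => b _; rewrite ffunE exprz_exp.
- move=> s v w; apply: (@intr_inj rat); rewrite !rmorph_sum /=.
  have h z' : \sum_(a in star z') ([ffun a => y (s, a)] a)%:~R =
      M.+1%:R * \sum_(a in star z') lam s a.
    by rewrite mulr_sumr; apply: eq_bigr => a _; rewrite ffunE -yl.
  by rewrite !h (lam_star s v w).
move=> s t; apply: (@intr_inj rat); rewrite rmorph_sum /=.
transitivity (M.+1%:R * \sum_a lam s a * (cyc (u t) a)%:~R).
  by rewrite mulr_sumr; apply: eq_bigr => a _; rewrite ffunE rmorphM /= -yl mulrA.
by rewrite lam_cyc; case: eqP; rewrite ?mulr1 ?mulr0.
Qed.

End CycleRank.

(** * Dimensions of orbits *)

Lemma poly_vanishing (K : numDomainType) (p : {poly K}) :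
  (forall s, p.[s] = 0) -> p = 0.
Proof.
move=> p0; apply/eqP; apply: contraT => pn0.
have := max_poly_roots pn0 (rs := [seq k%:R | k <- iota 0 (size p)]).
rewrite size_map size_iota ltnn; apply.
  by apply/allP => s _; apply/rootP.
by rewrite map_inj_uniq ?iota_uniq // => m n /eqP; rewrite eqr_nat => /eqP.
Qed.

(** * Functions with nowhere vanishing denominator *)

Section Regular.
Variables (K : fieldType) (A : nzRingType) (U : Type) (Om : set U).
Variables (ev : U -> A -> K) (cst : K -> A).
Hypotheses (evD : forall z p q, ev z (p + q) = ev z p + ev z q)
  (evM : forall z p q, ev z (p * q) = ev z p * ev z q)
  (evC : forall z k, ev z (cst k) = k).

(* quotients of functions in [A] whose denominator has no zeros on [Om] *)
Definition regular (phi : U -> K) : Prop := exists p d,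
  forall z, Om z -> ev z d != 0 /\ phi z * ev z d = ev z p.

Lemma regular_ev p : regular (ev^~ p).
Proof. by exists p, (cst 1) => z _; rewrite evC oner_neq0 mulr1. Qed.

Lemma regular_cst k : regular (fun=> k).
Proof. by exists (cst k), (cst 1) => z _; rewrite !evC oner_neq0 mulr1. Qed.

Lemma eq_regular phi psi : regular phi -> (forall z, Om z -> phi z = psi z) ->
  regular psi.
Proof. by move=> [p [d pd]] e; exists p, d => z Oz; rewrite -e //; apply: pd. Qed.

Lemma regularD phi psi : regular phi -> regular psi ->
  regular (fun z => phi z + psi z).
Proof.
move=> [p [d pd]] [q [e qe]]; exists (p * e + q * d), (d * e) => z Oz.
have [d0 pE] := pd z Oz; have [e0 qE] := qe z Oz.
rewrite evD !evM mulf_neq0 //; split=> //; rewrite -pE -qE mulrDl.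
by rewrite mulrA [psi z * _]mulrA [psi z * _ * _]mulrAC.
Qed.

Lemma regularM phi psi : regular phi -> regular psi ->
  regular (fun z => phi z * psi z).
Proof.
move=> [p [d pd]] [q [e qe]]; exists (p * q), (d * e) => z Oz.
have [d0 pE] := pd z Oz; have [e0 qE] := qe z Oz.
by rewrite !evM mulf_neq0 //; split=> //; rewrite -pE -qE mulrACA.
Qed.

Lemma regularV phi : regular phi -> (forall z, Om z -> phi z != 0) ->
  regular (fun z => (phi z)^-1).
Proof.
move=> [p [d pd]] phi0; exists d, p => z Oz.
have [d0 <-] := pd z Oz; rewrite mulf_neq0 ?phi0 //; split=> //.
by rewrite mulrA mulVf ?phi0 // mul1r.
Qed.

Lemma regular_sum (I : Type) (r : seq I) (P : pred I) (F : I -> U -> K) :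
  (forall i, P i -> regular (F i)) -> regular (fun z => \sum_(i <- r | P i) F i z).
Proof.
move=> FP; elim: r => [|i r IHr].
  by apply: eq_regular (regular_cst 0) _ => z _; rewrite big_nil.
have [Pi|Pi] := boolP (P i).
  by apply: eq_regular (regularD (FP i Pi) IHr) _ => z _; rewrite big_cons Pi.
by apply: eq_regular IHr _ => z _; rewrite big_cons (negbTE Pi).
Qed.

Lemma regular_prod (I : Type) (r : seq I) (P : pred I) (F : I -> U -> K) :
  (forall i, P i -> regular (F i)) -> regular (fun z => \prod_(i <- r | P i) F i z).
Proof.
move=> FP; elim: r => [|i r IHr].
  by apply: eq_regular (regular_cst 1) _ => z _; rewrite big_nil.
have [Pi|Pi] := boolP (P i).
  by apply: eq_regular (regularM (FP i Pi) IHr) _ => z _; rewrite big_cons Pi.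
by apply: eq_regular IHr _ => z _; rewrite big_cons (negbTE Pi).
Qed.

Lemma regularX phi n : regular phi -> regular (fun z => phi z ^+ n).
Proof.
move=> phiR; elim: n => [|n IHn]; first exact: regular_cst.
by apply: eq_regular (regularM phiR IHn) _ => z _; rewrite exprS.
Qed.

Lemma regularXz phi (n : int) : regular phi ->
  (n != 0 -> forall z, Om z -> phi z != 0) -> regular (fun z => phi z ^ n).
Proof.
move=> phiR phi0; have [->|n0] := eqVneq n 0; first exact: regular_cst.
case: n n0 => n n0 in phi0 *; first exact: regularX.
apply: regularV; first exact: regularX.
by move=> z Oz; rewrite expf_neq0 ?phi0.
Qed.

(** Used to clear denominators: along normalized coordinates, where [A] consists of polynomials on
    C^{Q_1}, and along curves, where it consists of polynomials in one variable. *)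
Lemma regular_meval n (v : U -> 'I_n -> K) (p : {mpoly K[n]}) :
  (forall i, regular (v^~ i)) -> regular (fun z => p.@[v z]).
Proof.
move=> vR; apply: (@eq_regular (fun z => \sum_(m <- msupp p) p@_m * \prod_i v z i ^+ m i)).
  apply: regular_sum => m _; apply: regularM; first exact: regular_cst.
  by apply: regular_prod => i _; apply: regularX.
by move=> z _; rewrite mevalE.
Qed.

End Regular.

(** * Closed sets and torus orbits in M_theta *)

Section Moduli.
Variables (R : realType) (T : brane_tiling) (theta : face T -> int).
Local Notation C := R[i].
Implicit Types (a b : edge T) (x y z l : rep R T) (i j : face T).
Hypotheses (theta_B : in_B theta) (theta_generic : generic theta).
Local Notation SS := (semistable_locus (R := R) theta).
Local Notation moduli_point := (moduli_point theta).

Lemma moduli_point_eq x y : SS x -> orbit_B x y -> moduli_point x = moduli_point y.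
Proof.
move=> xss xy; rewrite !(moduli_pointE theta_B theta_generic) //.
  exact: orbit_B_eq.
exact: orbit_B_sub xss _ xy.
Qed.

Lemma moduli_moduli_point x : SS x -> moduli theta (moduli_point x).
Proof. by exists x. Qed.

Lemma moduli_closedP (Z : set (set (rep R T))) : moduli_closed theta Z ->
  exists J : set {mpoly C[#|edge T|]}, forall x, SS x ->
    (Z (moduli_point x) <-> forall p, J p -> peval x p = 0).
Proof.
case=> ZM /closed_inP[J JP]; exists J => x xss; rewrite -(JP x xss).
by split=> [|[]].
Qed.

Definition vanishing (J : set {mpoly C[#|edge T|]}) : set (set (rep R T)) :=
  [set m | moduli theta m /\ forall x p, m x -> J p -> peval x p = 0].

(** Vanishing of [J] on a whole T_B-orbit is vanishing of all T_B-translates of [J] at one of its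
    points. *)
Lemma moduli_closed_vanishing J : moduli_closed theta (vanishing J).
Proof.
split=> [m []//|].
pose J' := [set q | exists l p, [/\ torus_B l, J p & q = rescale l p]].
apply: (closed_in_zeros (J := J')) => [x []//|x xss].
have mp := moduli_pointE theta_B theta_generic xss.
split=> [[_ [_ mJ]] _ [l [p [lB Jp ->]]]|xJ].
  rewrite peval_rescale; apply: mJ => //; rewrite mp.
  exact/orbit_B_act/orbit_B_refl.
split=> //; split; first exact: moduli_moduli_point.
move=> y p; rewrite mp => -[l lB <-] Jp; rewrite -peval_rescale.
by apply: xJ; exists l, p.
Qed.

Lemma orbit_M_moduli_point y : SS y ->
  orbit_M (moduli_point y) =
  [set m | exists2 l, torus_Lambda l & m = moduli_point (act l y)].
Proof.
move=> yss; have act_orbit l : torus_Lambda l ->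
    [set act l x | x in moduli_point y] = moduli_point (act l y).
  move=> lT; have lyss := semistable_locus_act lT yss.
  rewrite !(moduli_pointE theta_B theta_generic) //.
  apply/seteqP; split=> [_ [_ [m mB <-] <-]|_ [m mB <-]].
    by exists m => //; rewrite actC.
  by exists (act m y); [exists m|rewrite actC].
apply/seteqP; split=> [_ [l lT <-]|_ [l lT ->]]; exists l => //; by rewrite act_orbit.
Qed.

End Moduli.

(** * Upper bound for chains in an orbit *)

Section Dimension.
Variables (R : realType) (T : brane_tiling) (theta : face T -> int).
Local Notation C := R[i].
Implicit Types (a b : edge T) (x z l : rep R T) (i j : face T).
Hypotheses (theta_B : in_B theta) (theta_generic : generic theta).
Local Notation SS := (semistable_locus (R := R) theta).
Local Notation moduli_point := (moduli_point theta).

Variable y : rep R T.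
Hypothesis yss : SS y.
Local Notation S := (support y).
Variables (i0 : face T) (gamma : face T -> {ffun edge T -> int}).
Hypothesis gammaP : path_system R S i0 gamma.
Local Notation r := (cycle_rank S gamma).
Local Notation X := (orbit_M (moduli_point y)).

Definition pt l := moduli_point (act l y).

Lemma orbit_ss l : torus_Lambda l -> SS (act l y).
Proof. by move=> lT; apply: semistable_locus_act. Qed.

Lemma orbit_pt m : X m <-> exists2 l, torus_Lambda l & m = pt l.
Proof. by rewrite orbit_M_moduli_point. Qed.

Lemma support_act l : torus_Lambda l -> support (act l y) = S.
Proof. by move=> lT; rewrite -!setC_cosupport cosupport_act. Qed.

Lemma support_orbit_B x z : orbit_B x z -> support z = support x.
Proof.
by case=> l /torus_B_Lambda lT <-; rewrite -!setC_cosupport cosupport_act.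
Qed.

Lemma pt_mem l x : torus_Lambda l -> pt l x -> orbit_B (act l y) x.
Proof. by move=> lT; rewrite /pt moduli_pointE //; apply: orbit_ss. Qed.

Lemma normalize_pt l x : torus_Lambda l -> pt l x ->
  support x = S /\ normalize gamma x = normalize gamma (act l y).
Proof.
move=> lT /(pt_mem lT) lx; split.
  by rewrite (support_orbit_B lx); exact: support_act.
case: lx => m mB <-; exact: normalize_act gammaP _ _ mB.
Qed.

Definition coordinates l (h : 'I_#|edge T|) : C :=
  normalize gamma (act l y) (enum_val h).

Definition locus (Z : set (set (rep R T))) : set ('I_#|edge T| -> C) :=
  [set v | exists l, [/\ torus_Lambda l, Z (pt l) & v = coordinates l]].

(** A normalized coordinate is a coordinate times a Laurent monomial in coordinates from [S], so its
    denominator has no zeros on points of support [S]. *)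
Lemma normalized_zeros (p : {mpoly C[#|edge T|]}) : exists g : {mpoly C[#|edge T|]},
  forall x, support x = S ->
    (peval x g = 0 <-> p.@[fun h => normalize gamma x (enum_val h)] = 0).
Proof.
have xS x a : support x = S -> a \in S -> x a != 0 by move=> <-; rewrite inE.
have [|g [d gd]] := @regular_meval _ _ _ [set x | support x = S] (@peval R T)
  (@mpolyC _ C) (@pevalD R T) (@pevalM R T) (@pevalC R T) _
  (fun x h => normalize gamma x (enum_val h)) p.
  move=> h; pose a := enum_val h.
  have [p1 [d1 pd]] : regular [set x | support x = S] (@peval R T)
      (fun x => x a * laurent x (gamma (src a) - gamma (tgt a))).
    apply: regularM; first exact: pevalM.
      apply: (eq_regular (regular_ev _ (@pevalC R T) (coord a))) => x _.
      exact: peval_coord.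
    apply: (regular_prod (@pevalM R T) (@pevalC R T)) => b _.
    apply: (regularXz (@pevalM R T) (@pevalC R T)).
      apply: (eq_regular (regular_ev _ (@pevalC R T) (coord b))) => x _.
      exact: peval_coord.
    move=> nz x xS'; apply: (xS x) => //; apply: contraT => bS.
    by rewrite (supported_gammaB gammaP) in nz.
  exists p1, d1 => x xS'; have := pd x xS'.
  by rewrite normalizeA.
exists g => x xS'; have [d0 <-] := gd x xS'.
split=> [/eqP|->]; last by rewrite mul0r.
by rewrite mulf_eq0 (negbTE d0) orbF => /eqP.
Qed.

(** If [p * q] vanishes on the locus, the closed sets cut out by [p] and by [q], pulled back to
    representations, cover [Z]. *)
Lemma prime_locus_irreducible Z :
  irreducible_closed theta X Z -> prime_locus (locus Z).
Proof.
case=> [[A0 _ ZA0] [m Zm] Zirr].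
have ZX m' : Z m' -> X m' by rewrite ZA0 => -[].
split.
  have /orbit_pt[l lT ml] := ZX m Zm; exists (coordinates l), l; split=> //.
  by rewrite -ml.
move=> p q pq.
pose V (g : {mpoly C[#|edge T|]}) := X `&` vanishing theta [set g].
have Vclosed g : moduli_closed_in theta X (V g).
  by exists (vanishing theta [set g]) => //; apply: moduli_closed_vanishing.
have VP f g : (forall x, support x = S -> (peval x g = 0 <->
      f.@[fun h => normalize gamma x (enum_val h)] = 0)) ->
    forall l, torus_Lambda l -> (V g (pt l) <-> f.@[coordinates l] = 0).
  move=> fg l lT; have lss := orbit_ss lT; split.
    case=> _ [_ /(_ (act l y) g)]; rewrite /pt moduli_pointE //.
    move=> /(_ (orbit_B_refl _) erefl) g0.
    exact: (fg _ (support_act lT)).1 g0.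
  move=> f0; split; first by apply/orbit_pt; exists l.
  split; first exact: moduli_moduli_point.
  move=> x _ /(normalize_pt lT)[xS xn] ->; apply: (fg x xS).2; rewrite xn; exact: f0.
have [gp gpP] := normalized_zeros p; have [gq gqP] := normalized_zeros q.
have [|Zp|Zq] := Zirr _ _ (Vclosed gp) (Vclosed gq).
- move=> m' Zm'; have /orbit_pt[l lT ml] := ZX m' Zm'; rewrite ml in Zm' *.
  have : p.@[coordinates l] * q.@[coordinates l] = 0 by apply: pq; exists l.
  by move=> /eqP; rewrite mulf_eq0 => /orP[] /eqP e; [left; apply/(VP p)|right; apply/(VP q)].
- by left=> v [l [lT Zl ->]]; apply/(VP p gp) => //; apply: Zp.
- by right=> v [l [lT Zl ->]]; apply/(VP q gq) => //; apply: Zq.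
Qed.

Lemma separate Z Z' : moduli_closed_in theta X Z -> Z' `<=` X ->
    Z `<=` Z' -> Z <> Z' ->
  exists f : {mpoly C[#|edge T|]}, (forall v, locus Z v -> f.@[v] = 0) /\
    exists2 v, locus Z' v & f.@[v] != 0.
Proof.
move=> [A /moduli_closedP[J JP] ZA] Z'X ZZ' ne.
have [m [Z'm nZm]] : exists m, Z' m /\ ~ Z m.
  apply: contrapT => h; apply: ne; apply/seteqP; split=> // m Z'm.
  by apply: contrapT => nZm; apply: h; exists m.
have [l lT ml] := (orbit_pt m).1 (Z'X m Z'm); rewrite ml in Z'm nZm.
have nB l' : torus_Lambda l' -> orbit_B (act l' y) (normalize gamma (act l' y)).
  by move=> l'T; apply: (normalize_orbit gammaP); rewrite support_act.
have ptn l' : torus_Lambda l' -> pt l' = moduli_point (normalize gamma (act l' y)).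
  by move=> l'T; apply: moduli_point_eq => //; [exact: orbit_ss|exact: nB].
have nss l' : torus_Lambda l' -> SS (normalize gamma (act l' y)).
  by move=> l'T; apply: (orbit_B_sub (orbit_ss l'T)); apply: nB.
have [f Jf fl] : exists2 f, J f & peval (normalize gamma (act l y)) f != 0.
  apply: contrapT => h; apply: nZm; rewrite ZA; split.
    by apply/orbit_pt; exists l.
  rewrite ptn //; apply/JP; first exact: nss.
  move=> f Jf; apply/eqP; apply: contraT => fl; exfalso; apply: h.
  by exists f.
exists f; split; last by exists (coordinates l) => //; exists l.
move=> v [l' [l'T]]; rewrite ZA => -[_]; rewrite ptn // => /JP.
by move=> /(_ (nss _ l'T) f Jf) e ->.
Qed.

Lemma laurent_cyc_gauge l a : torus_B l -> laurent l (cyc S gamma a) = 1.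
Proof.
have [_ _ cg] := is_path_cyc gammaP a.
by case=> g g0 ->; rewrite cg // divff.
Qed.

Lemma coordinatesE l h : torus_Lambda l -> let a := enum_val h in
  coordinates l h = normalize gamma y a * laurent l (cyc S gamma a).
Proof.
move=> lT a; rewrite /coordinates -/a /cyc; case: ifP => aS.
  rewrite !(normalizeE gammaP) ?support_act ?fintype.subxx //.
  by rewrite laurent_act mulrC.
have ya : y a = 0 by apply/eqP; move: aS; rewrite inE => /negbFE.
by rewrite (normalizeA _ (act l y) a) (normalizeA _ y a) (actE l y a) ya mulr0 !mul0r.
Qed.

(** For n > r, the polynomials separating consecutive members would have independent monomials by
    [monomial_free], against the relation found by [monomial_dependent]. *)
Lemma chain_length_le n : has_irreducible_chain theta X n -> (n <= r)%N.
Proof.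
move=> [Z Zirr Zmono]; rewrite leqNgt; apply/negP => rn.
have [u [N [_ [nu [_ [lE _ _]]]]]] := cycle_basis R S gamma.
pose B k := locus (Z (inord k)).
have lt_inord k : (k < n)%N -> (@inord n k < @inord n k.+1)%N.
  by move=> kn; rewrite !inordK // ltnS ltnW.
have Zclosed (i : 'I_n.+1) : moduli_closed_in theta X (Z i) by case: (Zirr i).
have /choice[f fP] : forall k, exists f : {mpoly C[#|edge T|]}, (k < n)%N ->
    (forall v, B k v -> f.@[v] = 0) /\ exists2 v, B k.+1 v & f.@[v] != 0.
  move=> k; have [kn|nk] := ltnP k n; last by exists 0.
  have [Zs Zn] := Zmono _ _ (lt_inord k kn).
  have [|f fP] := separate (Zclosed (inord k)) _ Zs Zn; last by exists f.
  by have [A _ ->] := Zclosed (inord k.+1) => m [].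
have [D [c [e ce] cE]] := @monomial_dependent _ _ f n r N
  {l : rep R T | torus_Lambda l} (fun g => coordinates (sval g))
  (fun h => normalize gamma y (enum_val h))
  (fun g h => laurent (sval g) (cyc S gamma (enum_val h)))
  (fun g s => laurent (sval g) (cyc S gamma (u s)))
  (fun h => nu (enum_val h)) rn
  (fun g h => coordinatesE h (svalP g))
  (fun g s => laurent_neq0_all _ (svalP g).1)
  (fun g h => lE _ _ (svalP g)).
suff c0 : forall e, c e = 0 by rewrite c0 eqxx in ce.
apply: (@monomial_free _ _ D f n B) => [k kn|k kn|k kn|k kn|].
- exact/prime_locus_irreducible/Zirr.
- move=> v [l [lT Zl ->]]; exists l; split=> //.
  by have [Zs _] := Zmono _ _ (lt_inord k kn); apply: Zs.
- by have [] := fP k kn.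
- by have [] := fP k kn.
by move=> v [l [lT _ ->]]; apply: (cE (exist _ l lT)).
Qed.

End Dimension.

(** * Lower bound: a chain of subtori *)

Section OneParameter.
Variables (R : realType) (T : brane_tiling) (n : nat).
Local Notation C := R[i].
Variable lam : 'I_n -> {ffun edge T -> int}.
Implicit Types (t : 'I_n -> C).

Definition one_param t : rep R T := [ffun a => \prod_s t s ^ lam s a].

Lemma prod_exprz (K : fieldType) (I : finType) (P : pred I) (x : K) (c : I -> int) :
  x != 0 -> \prod_(i | P i) x ^ c i = x ^ (\sum_(i | P i) c i).
Proof.
move=> x0; rewrite (@big_morph _ _ (fun m => x ^ m) 1 *%R 0 +%R) //.
by move=> p q; rewrite expfzDr.
Qed.

Lemma laurent_one_param t c : (forall s, t s != 0) ->
  laurent (one_param t) c = \prod_s t s ^ (\sum_a lam s a * c a).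
Proof.
move=> t0; rewrite /laurent.
transitivity (\prod_a \prod_s t s ^ (lam s a * c a)).
  apply: eq_bigr => a _; rewrite ffunE.
  rewrite (@big_morph _ _ (fun u => u ^ c a) 1 *%R 1 *%R) ?exp1rz //; last first.
    by move=> p q; rewrite expfzMl.
  by apply: eq_bigr => s _; rewrite exprz_exp.
by rewrite exchange_big; apply: eq_bigr => s _; rewrite prod_exprz.
Qed.

Lemma one_param_Lambda t : (forall s, t s != 0) ->
    (forall s (v w : vertex T), \sum_(a in star v) lam s a = \sum_(a in star w) lam s a) ->
  torus_Lambda (one_param t).
Proof.
move=> t0 lam_star; split=> [a|v w].
  by rewrite ffunE; apply/prodf_neq0 => s _; rewrite expfz_neq0.
have E z : \prod_(a in star z) one_param t a = \prod_s t s ^ (\sum_(a in star z) lam s a).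
  under eq_bigr do rewrite ffunE.
  by rewrite exchange_big; apply: eq_bigr => s _; rewrite prod_exprz.
by rewrite !E; apply: eq_bigr => s _; rewrite (lam_star s v w).
Qed.

(* The line through two points of (C^* )^n meets the complement of the torus in
   finitely many points. *)
Lemma one_param_irreducible (y : rep R T) t0 t1 (f0 f1 : {mpoly C[#|edge T|]}) :
    (forall s, t0 s != 0) -> (forall s, t1 s != 0) ->
    (forall t, (forall s, t s != 0) -> (forall s, t0 s = 1 -> t1 s = 1 -> t s = 1) ->
      peval (act (one_param t) y) f0 = 0 \/ peval (act (one_param t) y) f1 = 0) ->
  peval (act (one_param t0) y) f0 = 0 \/ peval (act (one_param t1) y) f1 = 0.
Proof.
move=> t00 t10 t01; pose tau s : {poly C} := (t0 s)%:P * (1 - 'X) + (t1 s)%:P * 'X.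
pose w := \prod_s tau s.
have tauE s k : (tau s).[k] = t0 s * (1 - k) + t1 s * k by rewrite !hornerE.
pose ev (k : C) (p : {poly C}) := p.[k].
have evD k p q : ev k (p + q) = ev k p + ev k q by rewrite /ev hornerD.
have evM k p q : ev k (p * q) = ev k p * ev k q by rewrite /ev hornerM.
have evC k (c : C) : ev k c%:P = c by rewrite /ev hornerC.
pose Om := [set k : C | w.[k] != 0].
pose cu k := act (one_param (fun s => (tau s).[k])) y.
have w0 k : Om k -> forall s, (tau s).[k] != 0.
  rewrite /Om /= /w horner_prod => /prodf_neq0 h s; exact: h.
have reg f : regular Om ev (fun k => peval (cu k) f).
  apply: (regular_meval evD evM evC) => h; set a := enum_val h.
  apply: (@eq_regular _ _ _ _ _ (fun k => (\prod_s (tau s).[k] ^ lam s a) * y a)).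
    apply: (regularM evM); last exact: (regular_cst _ evC).
    apply: (regular_prod evM evC) => s _; apply: (regularXz evM evC).
      exact: (regular_ev Om evC (tau s)).
    by move=> _ k Ok; apply: w0.
  by move=> k _; rewrite /cu !ffunE.
have [g0 [d0 gd0]] := reg f0; have [g1 [d1 gd1]] := reg f1.
have cu0 : cu 0 = act (one_param t0) y.
  by congr act; apply/ffunP => a; rewrite !ffunE; apply: eq_bigr => s _;
    rewrite tauE subr0 mulr1 mulr0 addr0.
have cu1 : cu 1 = act (one_param t1) y.
  by congr act; apply/ffunP => a; rewrite !ffunE; apply: eq_bigr => s _;
    rewrite tauE subrr mulr1 mulr0 add0r.
have Om0 : Om 0.
  by rewrite /Om /= horner_prod; apply/prodf_neq0 => s _; rewrite tauE subr0 mulr1 mulr0 addr0.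
have Om1 : Om 1.
  by rewrite /Om /= horner_prod; apply/prodf_neq0 => s _; rewrite tauE subrr mulr1 mulr0 add0r.
(* Where [w] does not vanish, the line is in the torus and one of [f0], [f1] vanishes. So this
   polynomial is 0 everywhere and one of its factors is 0. *)
have /eqP : g0 * g1 * w = 0.
  apply: poly_vanishing => k; rewrite !hornerM.
  have [->|wk] := eqVneq w.[k] 0; first by rewrite mulr0.
  have [_ e0] := gd0 k wk; have [_ e1] := gd1 k wk.
  rewrite -[g0.[k]]/(ev k g0) -e0 -[g1.[k]]/(ev k g1) -e1.
  have [||->|->] := t01 (fun s => (tau s).[k]); rewrite ?(mul0r, mulr0) //.
    exact: w0.
  by move=> s e2 e3; rewrite tauE e2 e3 !mul1r subrK.
rewrite !mulf_eq0 => /orP[/orP[]|] /eqP e.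
- left; have [nz] := gd0 0 Om0; rewrite e /ev horner0 cu0 => /eqP.
  by rewrite mulf_eq0 (negbTE nz) orbF => /eqP.
- right; have [nz] := gd1 1 Om1; rewrite e /ev horner0 cu1 => /eqP.
  by rewrite mulf_eq0 (negbTE nz) orbF => /eqP.
by move: Om0; rewrite /Om /= e horner0 eqxx.
Qed.

End OneParameter.

Section Dimension.
Variables (R : realType) (T : brane_tiling) (theta : face T -> int).
Local Notation C := R[i].
Implicit Types (a b : edge T) (x z l : rep R T).
Hypotheses (theta_B : in_B theta) (theta_generic : generic theta).
Local Notation SS := (semistable_locus (R := R) theta).

Variable y : rep R T.
Hypothesis yss : SS y.
Local Notation S := (support y).
Variables (i0 : face T) (gamma : face T -> {ffun edge T -> int}).
Hypothesis gammaP : path_system R S i0 gamma.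
Local Notation r := (cycle_rank S gamma).
Local Notation X := (orbit_M (moduli_point theta y)).

(** [Z i] is the closure in the orbit of the image of the subtorus [P i], whose parameters from the
    [i]-th on are 1. Torus points on the line joining two points of [P i] belong to [P i], which
    yields irreducibility. *)
Lemma chain_of_rank : has_irreducible_chain theta X r.
Proof.
have [u [_ [M [_ [lam [_ lam_star lamu]]]]]] := cycle_basis R S gamma.
pose P (i : nat) := [set t : 'I_r -> C | (forall s, t s != 0) /\
  forall s : 'I_r, (i <= s)%N -> t s = 1].
have tT i t : P i t -> torus_Lambda (one_param lam t).
  by case=> t0 _; apply: one_param_Lambda.
have PS i j t : (i <= j)%N -> P i t -> P j t.
  by move=> ij [t0 t1]; split=> // s js; apply: t1; apply: leq_trans js.
pose J i := [set f : {mpoly C[#|edge T|]} | forall t h, P i t -> torus_B h ->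
  peval (act h (act (one_param lam t) y)) f = 0].
pose Z i := X `&` vanishing theta (J i).
have ptss i t : P i t -> SS (act (one_param lam t) y).
  by move=> Pt; apply: semistable_locus_act (tT _ _ Pt) _.
have Zpt i t : P i t -> Z i (pt theta y (one_param lam t)).
  move=> Pt; have lT := tT i t Pt; split.
    by apply/(orbit_pt theta_B theta_generic yss); exists (one_param lam t).
  split; first exact/moduli_moduli_point/(ptss i).
  move=> x f /(pt_mem theta_B theta_generic yss lT) [h hB <-]; exact.
have Zclosed i : moduli_closed_in theta X (Z i).
  by exists (vanishing theta (J i)) => //; apply: moduli_closed_vanishing.
have Zmono i j : (i <= j)%N -> Z i `<=` Z j.
  move=> ij m [Xm [Mm mJ]]; split=> //; split=> // x f mx Jf; apply: mJ mx _ => t h Pt hB.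
  by apply: Jf => //; apply: PS Pt.
have P1 i : P i (fun=> 1) by split=> // s; rewrite oner_neq0.
exists (fun i : 'I_r.+1 => Z i) => [i|i j ij].
  split; first exact: Zclosed.
    by exists (pt theta y (one_param lam (fun=> 1))); apply: Zpt.
  have ZA A : moduli_closed_in theta X A ->
      (forall t, P i t -> A (pt theta y (one_param lam t))) -> Z i `<=` A.
    move=> [A' A'closed AE] PA m [Xm [Mm mJ]]; rewrite AE; split=> //.
    have [JA JAP] := moduli_closedP A'closed.
    have [l lT ml] := (orbit_pt theta_B theta_generic yss m).1 Xm.
    have lss := semistable_locus_act lT yss.
    rewrite ml; apply/(JAP _ lss) => f Jf; apply: mJ.
      rewrite ml /pt moduli_pointE //; exact: orbit_B_refl.
    move=> t h Pt hB; have tss := ptss i t Pt.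
    have hss := semistable_locus_act (torus_B_Lambda hB) tss.
    apply: (JAP _ hss).1 Jf.
    rewrite -(moduli_point_eq theta_B theta_generic tss); last by exists h.
    by have := PA t Pt; rewrite AE => -[].
  move=> A B Acl Bcl ZAB; have [PA|nPA] := pselect (forall t, P i t -> A (pt theta y (one_param lam t))).
    by left; apply: ZA.
  right; apply: ZA => // t1 Pt1; apply: contrapT => nB; apply: nPA => t0 Pt0.
  apply: contrapT => nA.
  have [A' A'cl AE] := Acl; have [B' B'cl BE] := Bcl.
  have [JA JAP] := moduli_closedP A'cl; have [JB JBP] := moduli_closedP B'cl.
  have sep (D D' : set (set (rep R T))) (JD : set {mpoly C[#|edge T|]}) t :
      D = X `&` D' ->
      (forall x, SS x -> (D' (moduli_point theta x) <-> forall p, JD p -> peval x p = 0)) ->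
      P i t -> ~ D (pt theta y (one_param lam t)) ->
      exists2 f, JD f & peval (act (one_param lam t) y) f != 0.
    move=> DE JDP Pt nD; apply: contrapT => h; apply: nD; rewrite DE; split.
      by apply/(orbit_pt theta_B theta_generic yss); exists (one_param lam t) => //; apply: tT Pt.
    apply/JDP; first exact: ptss Pt.
    move=> f Jf; apply/eqP; apply: contraT => fn; exfalso; apply: h.
    by exists f.
  have [f0 Jf0 f0n] := sep _ _ _ _ AE JAP Pt0 nA.
  have [f1 Jf1 f1n] := sep _ _ _ _ BE JBP Pt1 nB.
  have [||t tn t01|e|e] := @one_param_irreducible _ _ _ lam y t0 t1 f0 f1.
  - by case: Pt0.
  - by case: Pt1.
  - have Pt : P i t.
      by split=> // s si; apply: t01; [case: Pt0|case: Pt1] => _; apply.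
    have tss := ptss i t Pt.
    have [At|Bt] := ZAB _ (Zpt i t Pt).
      by left; move: At; rewrite AE => -[_ /(JAP _ tss)]; apply.
    by right; move: Bt; rewrite BE => -[_ /(JBP _ tss)]; apply.
  - by rewrite e eqxx in f0n.
  - by rewrite e eqxx in f1n.
split; first exact/Zmono/ltnW.
move=> Zij; have ir : (i < r)%N by apply: leq_trans ij _; rewrite -ltnS.
(* Strictness: on [Z i] the monomial of the cycle [u s0] has the constant value [k], but at the
   point [t] of [P j] it is k 2^(M+1). *)
pose s0 := Ordinal ir; pose t (s : 'I_r) : C := if s == s0 then 2 else 1.
have t0 s : t s != 0 by rewrite /t; case: ifP; rewrite ?oner_neq0 // pnatr_eq0.
have Pt : P j t.
  split=> // s js; rewrite /t; case: eqP => // e; move: js.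
  by rewrite e leqNgt ij.
have := Zpt j t Pt; rewrite -Zij => -[_ [_]].
pose c := cyc S gamma (u s0); pose k := laurent y c.
have cS a : y a = 0 -> c a = 0.
  move=> ya; have [cS _ _] := is_path_cyc gammaP (u s0).
  by apply: cS; rewrite inE ya eqxx.
have k0 : k != 0.
  apply: (@laurent_neq0 _ _ S) => [a|]; first by rewrite inE.
  by have [] := is_path_cyc gammaP (u s0).
have lE t' h : (forall s, t' s != 0) -> torus_B h ->
    laurent (act h (act (one_param lam t') y)) c = k * t' s0 ^+ M.+1.
  move=> t'0 hB; rewrite !laurent_act (laurent_cyc_gauge gammaP) // mul1r mulrC.
  congr (_ * _); rewrite laurent_one_param // (bigD1 s0) //= lamu eqxx.
  rewrite big1 ?mulr1 // => s ss0; by rewrite lamu (negbTE ss0).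
have tT1 := tT j t Pt.
move=> /(_ (act (one_param lam t) y) (numer c - k%:MP * numer (- c))).
rewrite /pt moduli_pointE //; last exact: ptss Pt.
move=> /(_ (orbit_B_refl _)).
have vE x : (forall a, x a = 0 -> c a = 0) ->
    peval x (numer c - k%:MP * numer (- c)) = (laurent x c - k) * peval x (numer (- c)).
  by move=> xc; rewrite pevalB pevalM pevalC -laurent_numer // mulrBl.
have xc t' h : torus_Lambda (one_param lam t') -> torus_B h ->
    forall a, act h (act (one_param lam t') y) a = 0 -> c a = 0.
  move=> t'T /torus_B_Lambda hT a /eqP; rewrite act_eq0 // act_eq0 // => /eqP.
  exact: cS.
have Jf : J i (numer c - k%:MP * numer (- c)).
  move=> t' h Pt' hB; rewrite vE; last by apply: xc => //; apply: tT Pt'.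
  by rewrite lE //; case: Pt' => // t'0 t'1; rewrite t'1 // expr1n mulr1 subrr mul0r.
have y1 : act [ffun=> 1] (act (one_param lam t) y) = act (one_param lam t) y by rewrite act1.
move=> /(_ Jf); rewrite -y1 => /eqP; rewrite vE; last by apply: xc => //; apply: torus_B1.
rewrite mulf_eq0 => /orP[|]; last first.
  apply/negP/peval_numer_neq0 => a /xc; rewrite ffunE => -> //; rewrite ?oppr0 //.
  exact: torus_B1.
rewrite lE //; last exact: torus_B1.
rewrite /t eqxx -{2}[k]mulr1 -mulrBr mulf_eq0 (negbTE k0) /= subr_eq0.
by rewrite -natrX pnatr_eq1 gtn_eqF // -{1}(exp1n M.+1) ltn_exp2r.
Qed.

Lemma has_dimension_rank n : has_dimension theta X n <-> n = r.
Proof.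
have le := chain_length_le theta_B theta_generic yss gammaP.
split=> [[cn nm]|->]; last by split; [exact: chain_of_rank|exact: le].
by apply/eqP; rewrite eqn_leq le // nm //; apply: chain_of_rank.
Qed.

End Dimension.

(** * Cosupports *)

Lemma rank_ge_dual (K : fieldType) (F X : finType) (psi : F -> X -> K) (p : F -> X)
    m (A : 'M[K]_(m, #|X|)) :
  (forall f, (vec (psi f) <= A)%MS) -> (forall f g, psi f (p g) = (f == g)%:R) ->
  (#|F| <= \rank A)%N.
Proof.
move=> psiA psip; have free : row_free (fmx psi).
  apply/row_freeP; exists (fmx (fun x g => (x == p g)%:R)).
  apply/matrixP => i j; rewrite !mxE (bigD1 (enum_rank (p (enum_val j)))) //=.
  rewrite !mxE !enum_rankK eqxx mulr1 psip (inj_eq enum_val_inj) big1 ?addr0 // => h hj.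
  rewrite !mxE; case: eqP => [e|]; rewrite ?mulr0 //.
  by case/eqP: hj; rewrite -e enum_valK.
by rewrite -(eqP free); apply/mxrankS/fmx_sub_vecP.
Qed.

Section Cosupport.
Variables (R : realType) (T : brane_tiling).
Implicit Types (a b : edge T) (v w : vertex T) (x y : rep R T).
(** Multiplied by [x b], the relation at an edge [b] equates the products over the two stars at its
    ends; so a zero in one star forces a zero in every star. *)
Lemma cosupport_star x v a : satisfies_relations x -> a \in cosupport x ->
  exists2 b, b \in cosupport x & b \in star v.
Proof.
move=> /relationsP xr aI.
have zeroP w : \prod_(b in star w) x b = 0 -> exists2 b, b \in cosupport x & b \in star w.
  by move=> /eqP /prodf_eq0[b bw xb]; exists b => //; rewrite inE.
apply: zeroP; apply: (vertex_ind (P := fun w => \prod_(b in star w) x b = 0) _ (v := white_end a)).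
  move=> b; rewrite (bigD1 b) ?white_end_in //= [in X in _ <-> X](bigD1 b) ?black_end_in //=.
  by rewrite xr.
rewrite (bigD1 a) ?white_end_in //=; move: aI; rewrite inE => /eqP ->.
by rewrite mul0r.
Qed.

Lemma cosupport_alone x a : satisfies_relations x ->
  (exists b, [/\ b \in cosupport x, b \in star (white_end a) & b != a]) <->
  (exists b, [/\ b \in cosupport x, b \in star (black_end a) & b != a]).
Proof.
move=> /relationsP xr.
have zeroP w : (exists b, [/\ b \in cosupport x, b \in star w & b != a]) <->
    \prod_(b in star w | b != a) x b = 0.
  split=> [[b [bI bw ba]]|/eqP /prodf_eq0[b /andP[bw ba] xb]].
    by apply/eqP/prodf_eq0; exists b; [rewrite bw|move: bI; rewrite inE].
  by exists b; rewrite inE.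
by rewrite !zeroP xr.
Qed.

Variable I : {set edge T}.

Definition isolated : {set edge T} := [set a in I | [forall b in I,
  (b \in star (white_end a)) || (b \in star (black_end a)) ==> (b == a)]]%SET.

Lemma isolatedP a : reflect (a \in I /\ forall b v, b \in I -> a \in star v ->
    b \in star v -> b = a) (a \in isolated).
Proof.
rewrite inE; apply: (iffP andP) => -[aI h]; split=> //.
  move=> b v bI; rewrite in_star => av bv; apply/eqP.
  move/forall_inP/(_ b bI)/implyP: h; apply.
  by case/orP: av => /eqP <-; rewrite bv ?orbT.
apply/forall_inP => b bI; apply/implyP => /orP[] ba; apply/eqP.
  exact: (h b _ bI (white_end_in a)).
exact: (h b _ bI (black_end_in a)).
Qed.

Hypothesis I_star : forall v, exists2 b, b \in I & b \in star v.
Hypothesis I_alone : forall a, a \in I ->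
  (exists b, [/\ b \in I, b \in star (white_end a) & b != a]) <->
  (exists b, [/\ b \in I, b \in star (black_end a) & b != a]).

Lemma not_isolatedP a v : a \in I -> a \notin isolated -> a \in star v ->
  exists b, [/\ b \in I, b \in star v & b != a].
Proof.
move=> aI; rewrite inE aI /= negb_forall => /existsP[b].
rewrite !negb_imply => /andP[bI /andP[ba nba]].
have ab := I_alone aI; rewrite in_star => /orP[] /eqP ->.
  by case/orP: ba => ba; [|apply/ab]; exists b.
by case/orP: ba => ba; [apply/ab|]; exists b.
Qed.

(** Let edges of [I] weigh 1, and isolated ones 2. Every star weighs at least 2, by one isolated
    edge or two others, and each edge is counted at two ends. *)
Lemma card_isolated : (#|vertex T| <= #|I| + #|isolated|)%N.
Proof.
have deg v : (2 <= \sum_(a in star v) ((a \in I) + (a \in isolated)))%N.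
  have [a aI av] := I_star v; rewrite (bigD1 a) //= aI.
  case: (boolP (a \in isolated)) => [//|aiso].
  have [b [bI bv ba]] := not_isolatedP aI aiso av.
  by rewrite (bigD1 b) /= ?bv // bI; lia.
have : (\sum_(v : vertex T) 2 <= \sum_v \sum_(a in star v) ((a \in I) + (a \in isolated)))%N.
  by apply: leq_sum => v _.
rewrite sum_nat_const sum_star.
rewrite (eq_bigr (fun a => ((a \in I) + (a \in isolated)) * 2)%N) => [|a _]; last first.
  by rewrite /= muln2 -addnn.
rewrite -big_distrl leq_pmul2r //= big_split /= -!sum1_card.
rewrite (big_mkcond (fun a => a \in I)) (big_mkcond (fun a => a \in isolated)) /=.
have E (A : {set edge T}) : (\sum_a (a \in A) = \sum_a (if a \in A then 1 else 0))%N.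
  by apply: eq_bigr => a _; case: ifP.
by rewrite !E.
Qed.

Hypothesis balanced : nwhite T = nblack T.

Definition edge_relation a v : rat := (v == white_end a)%:R - (v == black_end a)%:R.

Lemma edge_relation_white a b : edge_relation a (white_end b) = (white_end b == white_end a)%:R.
Proof. by rewrite /edge_relation subr0. Qed.

Lemma sum_edge_relation a : \sum_v edge_relation a v = 0.
Proof. exact: sum_indicatorB. Qed.

Lemma isolated_end a b v : a \in isolated -> b \in I -> a \in star v -> b \in star v -> b = a.
Proof. by move=> /isolatedP[_ h] bI; apply: h. Qed.

Lemma edge_relationP a : a \in isolated -> (vec (edge_relation a) <= star_relations I)%MS.
Proof.
move=> aiso; apply/star_relationsP; split=> [|b bI]; first exact: sum_edge_relation.
rewrite /edge_relation subr0 sub0r.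
have [->|ba] := eqVneq b a; first by rewrite !eqxx subrr.
have nw v : a \in star v -> b \in star v -> False.
  by move=> av bv; case/eqP: ba; apply: isolated_end bv.
case: eqP => [e|_]; first by case: (nw (white_end a)); rewrite ?white_end_in // -e white_end_in.
case: eqP => [e|_]; last by rewrite subrr.
by case: (nw (black_end a)); rewrite ?black_end_in // -e black_end_in.
Qed.

(** Evaluation at the white ends of the isolated edges and of the edges [p s] is dual to the
    relations of the isolated edges together with the [phi s]. *)
Lemma rank_star_relations_ge (X : finType) (phi : X -> vertex T -> rat)
    (p : X -> edge T) :
    (forall s, (vec (phi s) <= star_relations I)%MS) ->
    (forall s t, phi s (white_end (p t)) = (s == t)%:R) ->
    (forall s a, a \in isolated -> phi s (white_end a) = 0) ->
    (forall s, p s \in I /\ p s \notin isolated) ->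
  (#|isolated| + #|X| <= \rank (star_relations I))%N.
Proof.
move=> phiI phip phi0 pI.
pose F : finType := ({a | a \in isolated} + X)%type.
pose psi (f : F) := match f with inl a => edge_relation (val a) | inr s => phi s end.
pose q (f : F) := match f with inl a => white_end (val a) | inr s => white_end (p s) end.
have <- : #|F| = (#|isolated| + #|X|)%N by rewrite card_sum card_sig.
apply: (@rank_ge_dual _ F _ psi q) => [[a|s]|[a|s] [b|t]] /=.
- exact/edge_relationP/valP.
- exact: phiI.
- rewrite edge_relation_white; congr (_%:R); congr nat_of_bool.
  apply/eqP/eqP => [e|[->] //]; congr inl; apply/val_inj.
  apply/esym/(@isolated_end _ _ (white_end (val a)) (valP a)).
  + by have /isolatedP[] := valP b.
  + exact: white_end_in.
  + by rewrite -e white_end_in.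
- rewrite edge_relation_white; case: eqP => // e; have [pI1 pI2] := pI t.
  case/negP: pI2; rewrite (@isolated_end (val a) (p t) (white_end (val a))) ?white_end_in //.
  + exact: valP.
  + exact: valP.
  + by rewrite -e white_end_in.
- by rewrite phi0 //; exact: valP.
- by rewrite phip.
Qed.

(** Equals [sign] away from the isolated edges and 0 at their ends. *)
Definition residual v : rat := sign v - \sum_(a in isolated) edge_relation a v.

Lemma residual_relation : (vec residual <= star_relations I)%MS.
Proof.
apply/star_relationsP; split=> [|b bI].
  rewrite sumrB sum_sign // exchange_big big1 ?subrr // => a _.
  exact: sum_edge_relation.
rewrite /residual addrACA -opprD -big_split big1 /= ?subr0 ?subrr // => a aiso.
by have /star_relationsP[_] := edge_relationP aiso; apply.
Qed.

Lemma residual_white b : b \in I -> residual (white_end b) = (b \notin isolated)%:R.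
Proof.
move=> bI; rewrite /residual /=; under eq_bigr do rewrite edge_relation_white.
have [biso|bn] := boolP (b \in isolated).
  rewrite (bigD1 b) //= eqxx big1 ?addr0 ?subrr // => a /andP[aiso ab].
  case: eqP => // e; case/eqP: ab; apply: (@isolated_end _ _ (white_end b) biso).
  - by have /isolatedP[] := aiso.
  - exact: white_end_in.
  - by rewrite e white_end_in.
rewrite big1 ?subr0 // => a aiso; case: eqP => // e; case/negP: bn.
rewrite (@isolated_end a b (white_end a)) ?white_end_in //.
by rewrite -e white_end_in.
Qed.

Lemma rank_star_relations_ge1 b : b \in I -> b \notin isolated ->
  (#|isolated| < \rank (star_relations I))%N.
Proof.
move=> bI bn; rewrite -addn1 -card_unit.
apply: (rank_star_relations_ge (phi := fun=> residual) (p := fun=> b)) => //.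
- by move=> _; exact: residual_relation.
- by move=> [] []; rewrite residual_white // bn.
- move=> _ a aiso; rewrite residual_white ?aiso //.
  by have /isolatedP[] := aiso.
Qed.

(** The restriction [phi] of [sign] to [V] and the difference [residual - phi] are both relations,
    told apart by the white ends of [b] and [c]. *)
Lemma rank_star_relations_ge2 (V : {set vertex T}) b c :
    (forall a, a \in I -> (white_end a \in V) = (black_end a \in V)) ->
    \sum_(v in V) sign v = 0 -> (forall a, a \in isolated -> white_end a \notin V) ->
    b \in I -> b \notin isolated -> white_end b \in V ->
    c \in I -> c \notin isolated -> white_end c \notin V ->
  (#|isolated| + 2 <= \rank (star_relations I))%N.
Proof.
move=> Vclosed Vsum Viso bI bn bV cI cn cV; rewrite -card_bool.
pose phi v : rat := if v \in V then sign v else 0.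
have phiI : (vec phi <= star_relations I)%MS.
  apply/star_relationsP; split=> [|a aI]; first by rewrite -big_mkcond.
  by rewrite /phi Vclosed //; case: ifP => _; rewrite ?addr0 //= subrr.
have phiW a : phi (white_end a) = (white_end a \in V)%:R by rewrite /phi; case: ifP.
apply: (rank_star_relations_ge (p := fun s : bool => if s then b else c)
  (phi := fun (s : bool) v => if s then phi v else residual v - phi v)).
- case=> //; apply/star_relationsP.
  have /star_relationsP[p0 pI] := phiI; have /star_relationsP[q0 qI] := residual_relation.
  split=> [|a aI]; first by rewrite sumrB p0 q0 subrr.
  by rewrite addrACA -opprD pI // qI // subrr.
- by move=> [] []; rewrite ?phiW ?residual_white ?bV ?(negbTE cV) ?bn ?cn ?subrr ?subr0.
- move=> s a aiso; have /isolatedP[aI _] := aiso.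
  rewrite phiW (negbTE (Viso a aiso)) residual_white // aiso subr0.
  by case: s.
by case.
Qed.

End Cosupport.

(** * Perfect matchings and two-dimensional orbits *)

Section Matching.
Variables (T : brane_tiling) (P : {set edge T}).
Implicit Types (a b : edge T) (v : vertex T).
Hypothesis balanced : nwhite T = nblack T.
Hypothesis P_matching : perfect_matching P.

Lemma matching_star v : exists2 a, a \in P /\ a \in star v &
  forall b, b \in P -> b \in star v -> b = a.
Proof.
have /eqP/cards1P[a e] := P_matching v.
have : a \in (star v :&: P)%SET by rewrite e set11.
rewrite inE => /andP[av aP]; exists a => // b bP bv.
by apply/set1P; rewrite -e inE bv.
Qed.

Lemma matching_isolated : isolated P = P.
Proof.
apply/setP => a; apply/isolatedP/idP => [[]//|aP]; split=> // b v bP av bv.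
have [c _ cu] := matching_star v.
by rewrite (cu a) // (cu b).
Qed.

Lemma card_matching : #|vertex T| = (2 * #|P|)%N.
Proof.
have -> : #|vertex T| = (\sum_v \sum_(a in star v) (a \in P))%N.
  rewrite -sum1_card; apply: eq_bigr => v _.
  by rewrite -big_mkcondr sum1_card -(P_matching v); apply: eq_card => a; rewrite !inE.
rewrite sum_star -sum1_card big_distrr /= [RHS]big_mkcond.
by apply: eq_bigr => a _; case: (a \in P).
Qed.

(** Every vertex lies on exactly one edge of [P], so a relation is determined by its values at the
    white ends, which are arbitrary. *)
Lemma rank_star_relations_matching : \rank (star_relations P) = #|P|.
Proof.
apply/eqP; rewrite eqn_leq; apply/andP; split; last first.
  have := @rank_star_relations_ge T P void (fun s => match s with end)
    (fun s => match s with end).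
  rewrite card_void addn0 matching_isolated; apply.
  - by case.
  - by case.
  - by case.
  - by case.
pose psi (a : {a | a \in P}) := edge_relation (val a).
have -> : #|P| = #|{: {a | a \in P}}| by rewrite card_sig.
apply: leq_trans (rank_leq_row (fmx psi)); apply: mxrankS.
apply/submx_vecP => f /star_relationsP[_ fP].
apply/sub_fmx_vecP; exists (fun e => f (white_end (val e))) => v.
have [a [aP av] au] := matching_star v.
pose a' : {a | a \in P} := exist _ a aP.
have au' (b : {a | a \in P}) : b != a' -> v != white_end (val b) /\ v != black_end (val b).
  move=> ba; have nv : val b \notin star v.
    apply: contra ba => bv; rewrite -val_eqE /=; apply/eqP.
    by apply: au bv; apply: valP.
  by move: nv; rewrite in_star negb_or => /andP.
rewrite (bigD1 a') //= big1 ?addr0 => [|b /au'[bw bb]]; last first.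
  by rewrite /psi /edge_relation (negbTE bw) (negbTE bb) subrr mulr0.
rewrite /psi /edge_relation /=; move: av; rewrite in_star => /orP[] /eqP ->.
  by rewrite eqxx subr0 mulr1.
rewrite eqxx sub0r mulrN1; apply/eqP; rewrite -addr_eq0 addrC.
by rewrite fP.
Qed.

End Matching.

Section DimensionCosupport.
Variables (R : realType) (T : brane_tiling) (theta : face T -> int).
Implicit Types (a b : edge T) (x y : rep R T) (v : vertex T).
Hypotheses (theta_B : in_B theta) (theta_generic : generic theta).
Hypothesis balanced : nwhite T = nblack T.
Local Notation SS := (semistable_locus (R := R) theta).
Local Notation orbit y := (orbit_M (moduli_point theta y)).

Lemma orbit_dimension y : SS y -> exists r,
  (forall n, has_dimension theta (orbit y) n <-> n = r) /\
  (r + #|cosupport y| + \rank (star_relations (cosupport y)) = #|vertex T| + 2)%N.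
Proof.
move=> yss; have [i0 [gamma gammaP]] := path_systemP theta_B theta_generic yss.2.
exists (cycle_rank (support y) gamma); split.
  exact: (has_dimension_rank theta_B theta_generic yss gammaP).
have -> : cosupport y = (~: support y)%SET by rewrite -setC_cosupport finset.setCK.
apply: (cycle_rankE balanced gammaP) => A A0 AS.
apply: (semistable_connected theta_B theta_generic yss.2 A0) => a ya.
by apply: AS; rewrite inE.
Qed.

Lemma matching_dimension y : SS y -> perfect_matching (cosupport y) ->
  has_dimension theta (orbit y) 2.
Proof.
move=> yss yP; have [r [rP re]] := orbit_dimension yss; apply/rP.
have := card_matching yP; have := rank_star_relations_matching yP; move: re.
by move: (\rank _) => n; lia.
Qed.

(** Here n >= #isolated + 1, so r = |V| - |I| + 2 - n <= #isolated + 2 - n <= 1 by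
    [card_isolated]. *)
Lemma cosupport_not_isolated y b : SS y -> b \in cosupport y ->
    b \notin isolated (cosupport y) ->
  ~ has_dimension theta (orbit y) 2.
Proof.
move=> yss bI bn; have [r [rP re]] := orbit_dimension yss => /rP r2.
have star0 v := cosupport_star v yss.1 bI.
have alone a (_ : a \in cosupport y) := cosupport_alone a yss.1.
have := rank_star_relations_ge1 balanced bI bn.
have := card_isolated star0 alone; move: re; rewrite -r2.
by move: (\rank _) => n; lia.
Qed.

Lemma dimension_matching y : SS y -> has_dimension theta (orbit y) 2 ->
  perfect_matching (cosupport y).
Proof.
move=> yss y2; have [r [rP re]] := orbit_dimension yss.
have [I0|[b bI]] := set_0Vmem (cosupport y).
  (* With empty cosupport, r = 2 would make every function on the vertices a relation, but the
     indicator of one vertex does not have sum 0. *)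
  have r2 := (rP 2%N).1 y2; rewrite -r2 I0 cards0 addn0 addnC in re.
  have /eqP full := addIn re.
  have [a0 _] := edge_inhabited T.
  pose e v : rat := (v == white_end a0)%:R.
  have /star_relationsP[+ _] : (vec e <= star_relations (finset.set0 : {set edge T}))%MS.
    exact: submx_full.
  rewrite /e (bigD1 (white_end a0)) //= eqxx big1 ?addr0 => [/eqP|v /negbTE->//].
  by rewrite oner_eq0.
have iso c : c \in cosupport y -> c \in isolated (cosupport y).
  move=> cI; apply: contraT => cn.
  by case: (cosupport_not_isolated yss cI cn y2).
move=> v; have [c cI cv] := cosupport_star v yss.1 bI.
suff -> : (star v :&: cosupport y = [set c])%SET by rewrite cards1.
apply/setP => d; rewrite finset.in_setI finset.in_set1; apply/andP/eqP => [[dv dI]|->//].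
exact: (isolated_end (iso _ cI) dI cv dv).
Qed.

(* In a one-dimensional orbit a balanced union of components of the cosupport
   exhausts the components that are not isolated edges. *)
Lemma unique_big_part x (V : {set vertex T}) b c : SS x ->
    has_dimension theta (orbit x) 1 ->
    (forall a, a \in cosupport x -> (white_end a \in V) = (black_end a \in V)) ->
    \sum_(v in V) sign v = 0 ->
    (forall a, a \in isolated (cosupport x) -> white_end a \notin V) ->
    b \in cosupport x -> b \notin isolated (cosupport x) -> white_end b \in V ->
    c \in cosupport x -> white_end c \notin V ->
  c \in isolated (cosupport x).
Proof.
move=> xss x1 Vclosed Vsum Viso bI bn bV cI cV; apply: contraT => cn.
have [r [rP re]] := orbit_dimension xss; have r1 := (rP 1%N).1 x1.
have star0 v := cosupport_star v xss.1 bI.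
have alone a (_ : a \in cosupport x) := cosupport_alone a xss.1.
have := rank_star_relations_ge2 balanced Vclosed Vsum Viso bI bn bV cI cn cV.
have := card_isolated star0 alone; move: re; rewrite -r1.
by move: (\rank _) => n; lia.
Qed.

(** Off the matching the torus element must be z/y; on a matching edge it is chosen to make the
    product over the white star 1. The relations of [y] and [z] at that edge give the same for the
    black star. *)
Lemma matching_orbit y z : SS y -> SS z -> cosupport y = cosupport z ->
    perfect_matching (cosupport y) ->
  exists2 l, torus_Lambda l & z = act l y.
Proof.
move=> yss zss yz yP; pose P := cosupport y.
have y0 a : (y a == 0) = (a \in P) by rewrite inE.
have z0 a : (z a == 0) = (a \in P) by rewrite /P yz inE.
pose q a := z a / y a.
have star_prod (u : rep R T) v m : (forall a, (u a == 0) = (a \in P)) ->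
    m \in P -> m \in star v -> \prod_(b in star v | b != m) u b != 0.
  move=> u0 mP mv; apply/prodf_neq0 => b /andP[bv bm]; rewrite u0.
  have [c _ cu] := matching_star yP v; apply: contra bm => bP; apply/eqP.
  by rewrite (cu b) // (cu m).
pose l : rep R T := [ffun a => if a \in P then
  (\prod_(b in star (white_end a) | b != a) q b)^-1 else q a].
have qE v m : m \in P -> m \in star v ->
    \prod_(b in star v | b != m) l b = \prod_(b in star v | b != m) q b.
  move=> mP mv; apply: eq_bigr => b /andP[bv bm]; rewrite ffunE; case: ifP => // bP.
  have [c _ cu] := matching_star yP v; case/eqP: bm.
  by rewrite (cu b) // (cu m).
have q0 v m : m \in P -> m \in star v -> \prod_(b in star v | b != m) q b != 0.
  by move=> mP mv; rewrite big_split /= prodfV mulf_neq0 ?invr_neq0 //; apply: star_prod.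
have star1 v : \prod_(a in star v) l a = 1.
  have [m [mP mv] _] := matching_star yP v.
  rewrite (bigD1 m) //= qE // ffunE mP.
  suff -> : \prod_(b in star (white_end m) | b != m) q b =
            \prod_(b in star v | b != m) q b by rewrite mulVf ?q0.
  rewrite !big_split /= !prodfV.
  have /relationsP yr := yss.1; have /relationsP zr := zss.1.
  by move: mv; rewrite in_star => /orP[] /eqP -> //; rewrite yr zr.
have l0 a : l a != 0.
  rewrite ffunE; case: ifP => aP; first by rewrite invr_neq0 ?q0 ?white_end_in.
  by rewrite mulf_neq0 ?invr_neq0 ?y0 ?z0 ?aP.
exists l; first by split=> // v w; rewrite !star1.
apply/ffunP => a; rewrite actE ffunE; case: ifP => aP.
  have /eqP -> : z a == 0 by rewrite z0.
  by have /eqP -> : y a == 0; rewrite ?y0 // mulr0.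
by rewrite divfK // y0 aP.
Qed.

End DimensionCosupport.

(** * Smoothing a cycle of the cosupport *)

Lemma odd_ordS k (i : 'I_(k.*2)) : odd (ordS i) = ~~ odd i.
Proof.
have [lt|ge] := ltnP i.+1 k.*2; first by rewrite /= modn_small.
have e : i.+1 = k.*2 by apply/eqP; rewrite eqn_leq ge ltn_ord.
by rewrite /= e modnn -[odd i]negbK -oddS e odd_double.
Qed.

Lemma ordS_surj n (i : 'I_n) : exists j, i = ordS j.
Proof. by exists (ord_pred i); rewrite ord_predK. Qed.

Section Alternating.
Variables (T : brane_tiling) (I : {set edge T}) (k : nat).
Variables (a : 'I_(k.*2) -> edge T) (v : 'I_(k.*2) -> vertex T).
Implicit Types (b c : edge T) (w : vertex T).
Hypotheses (v_inj : injective v)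
  (a_star : forall i w, (a i \in star w) = (w == v i) || (w == v (ordS i)))
  (aI : forall i, a i \in I)
  (I_star : forall w, exists2 b, b \in I & b \in star w)
  (a_rest : forall b, b \in I -> (forall i, b != a i) -> b \in isolated I).

Definition evens : {set edge T} := [set a i | i : 'I_(k.*2) & ~~ odd i]%SET.
Definition odds : {set edge T} := [set a i | i : 'I_(k.*2) & odd i]%SET.

Hypothesis a_inj : injective a.

Lemma mem_evens i : (a i \in evens) = ~~ odd i.
Proof.
by apply/imsetP/idP => [[j] + /a_inj->|io]; rewrite ?inE //; exists i; rewrite ?inE.
Qed.

Lemma mem_odds i : (a i \in odds) = odd i.
Proof.
by apply/imsetP/idP => [[j] + /a_inj->|io]; rewrite ?inE //; exists i; rewrite ?inE.
Qed.

Lemma a_v i : a i \in star (v i).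
Proof. by rewrite a_star eqxx. Qed.

Lemma a_vS i : a i \in star (v (ordS i)).
Proof. by rewrite a_star eqxx orbT. Qed.

(** Edges of [I] off the cycle are isolated, so they cannot meet a vertex of the cycle. *)
Lemma star_v i b : b \in I -> b \in star (v i) -> exists2 j, b = a j & i = j \/ i = ordS j.
Proof.
move=> bI bi.
have [/existsP[j /eqP bj]|nb] := boolP [exists j, b == a j].
  exists j => //; move: bi; rewrite bj a_star => /orP[] /eqP /v_inj; by [left|right].
have bn j : b != a j by apply: contra nb => bj; apply/existsP; exists j.
case/eqP: (bn i); apply/esym; apply: (isolated_end (a_rest bI bn) (aI i) bi).
exact: a_v.
Qed.

Lemma matching_evens : perfect_matching (I :\: evens)%SET.
Proof.
move=> w; suff [m [mP mw mu]] : exists m, [/\ m \in (I :\: evens)%SET, m \in star w &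
    forall b, b \in (I :\: evens)%SET -> b \in star w -> b = m].
  suff -> : (star w :&: (I :\: evens) = [set m])%SET by rewrite cards1.
  apply/setP => b; rewrite finset.in_setI finset.in_set1.
  by apply/andP/eqP => [[bw bP]|->]; [exact: mu|].
have [/existsP[i /eqP wi]|nw] := boolP [exists i, w == v i].
  have uniq (j : 'I_(k.*2)) : odd j -> i = j \/ i = ordS j ->
      forall b, b \in (I :\: evens)%SET -> b \in star w -> b = a j.
      move=> jo ij b; rewrite finset.in_setD wi => /andP[bE bI] bi.
    have [h e ih] := star_v bI bi; rewrite e mem_evens negbK in bE; rewrite e.
    congr a; case: ij => ij; case: ih => ih; move: jo bE.
    - by rewrite -ij -ih.
    - by rewrite -ij ih odd_ordS => /negbTE->.
    - by rewrite -ih ij odd_ordS => -> .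
    - by move=> _ _; apply: (can_inj (@ordSK _)); rewrite -ij -ih.
  have [io|ie] := boolP (odd i).
    exists (a i); split; [|by rewrite wi a_v|by apply: uniq; auto].
    by rewrite finset.in_setD mem_evens negbK io aI.
  have [j ij] := ordS_surj i; have jo : odd j by rewrite -[odd j]negbK -odd_ordS -ij.
  exists (a j); split; [|by rewrite wi ij a_vS|by apply: uniq; auto].
  by rewrite finset.in_setD mem_evens negbK jo aI.
have [c cI cw] := I_star w.
have cn i : c != a i.
  apply: contra nw => /eqP e; apply/existsP; move: cw; rewrite e a_star.
  by case/orP => wv; [exists i|exists (ordS i)].
have ciso := a_rest cI cn; exists c; split=> //.
  rewrite finset.in_setD cI andbT; apply/imsetP => -[i _ e].
  by have := cn i; rewrite e eqxx.
by move=> b; rewrite finset.in_setD => /andP[_ bI] bw; apply: (isolated_end ciso bI cw bw).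
Qed.

(** A property alternating along the cycle is a parity. It serves for membership in a matching and
    for colours. *)
Lemma cycle_ind (f : 'I_(k.*2) -> bool) : (forall i, f (ordS i) = ~~ f i) ->
  forall i j, f i (+) odd i = f j (+) odd j.
Proof.
move=> fS i j; have h m (mk : (m < k.*2)%N) (k0 : (0 < k.*2)%N) :
    f (Ordinal mk) (+) odd m = f (Ordinal k0).
  elim: m mk => [|m IHm] mk.
    by rewrite addbF; congr f; apply/val_inj.
  have mk' : (m < k.*2)%N by apply: ltnW.
  have -> : Ordinal mk = ordS (Ordinal mk') by apply/val_inj; rewrite /= modn_small.
  by rewrite fS -(IHm mk') /= addNb addbN negbK.
have k0 : (0 < k.*2)%N by apply: leq_ltn_trans (ltn_ord i).
case: i j => [m mk] [m' m'k].
by rewrite (h m mk k0) (h m' m'k k0).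
Qed.

Lemma a_ordS_neq i : a (ordS i) != a i.
Proof.
apply/eqP => /a_inj e; have := odd_ordS i; rewrite e; by case: (odd i).
Qed.

(** A perfect matching in [I] contains all isolated edges and exactly one of two consecutive edges
    of the cycle, so one bit determines it. *)
Lemma matching_evens_odds (P : {set edge T}) : (0 < k)%N ->
  perfect_matching P -> P \subset I ->
  P = (I :\: evens)%SET \/ P = (I :\: odds)%SET.
Proof.
move=> k_gt0 PM /fintype.subsetP PI.
have isoP c : c \in isolated I -> c \in P.
  move=> ciso; have [b [bP bw] _] := matching_star PM (white_end c).
  by rewrite -(isolated_end ciso (PI b bP) (white_end_in c) bw).
have PS i : (a (ordS i) \in P) = (a i \notin P).
  have [m [mP mw] mu] := matching_star PM (v (ordS i)).
  apply/idP/idP => [aSP|aP].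
    apply/negP => aP; case/eqP: (a_ordS_neq i).
    by rewrite (mu _ aP (a_vS i)); apply: mu => //; apply: a_v.
  have [j e] := star_v (PI m mP) mw; rewrite e in mP.
  case=> [->//|/ordS_inj ij]; by rewrite ij mP in aP.
have k0 : (0 < k.*2)%N by rewrite double_gt0.
pose i0 := Ordinal k0.
have ai i : (a i \in P) = (a i0 \in P) (+) odd i.
  have := cycle_ind PS i i0; rewrite /= addbF => <-.
  by rewrite -addbA addbb addbF.
have eqP_of (E : {set edge T}) :
    (forall i, (a i \in E) = ~~ (a i \in P)) -> (forall b, b \in E -> exists i, b = a i) ->
    P = (I :\: E)%SET.
  move=> aE Ea; apply/setP => b; rewrite finset.in_setD.
  have [/existsP[i /eqP ->]|nb] := boolP [exists i, b == a i].
    by rewrite aE negbK aI andbT.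
  have bn i : b != a i by apply: contra nb => bi; apply/existsP; exists i.
  have -> /= : b \notin E by apply/negP => /Ea[i e]; have := bn i; rewrite e eqxx.
  by apply/idP/idP => [/PI//|bI]; apply/isoP/a_rest.
have [a0P|a0P] := boolP (a i0 \in P); [right|left]; apply: eqP_of => [i|b].
- by rewrite mem_odds ai a0P addTb negbK.
- by case/imsetP => i _ ->; exists i.
- by rewrite mem_evens ai (negbTE a0P).
- by case/imsetP => i _ ->; exists i.
Qed.

Section Fill.
Variables (R : realType) (x : rep R T).
Local Notation C := R[i].
Hypotheses (xr : satisfies_relations x) (xI : cosupport x = I).

Let x0 b : (x b == 0) = (b \in I).
Proof. by rewrite -xI inE. Qed.

Definition rest w : C := \prod_(b in star w | b \notin I) x b.

Lemma rest_neq0 w : rest w != 0.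
Proof. by apply/prodf_neq0 => b /andP[_]; rewrite x0. Qed.

Lemma rest_isolated b : b \in isolated I -> rest (white_end b) = rest (black_end b).
Proof.
move=> biso; have /relationsP/(_ b) := xr.
have E w : b \in star w -> \prod_(c in star w | c != b) x c = rest w.
  move=> bw; apply: eq_bigl => c; have [cw|//] := boolP (c \in star w).
  rewrite /=; congr (~~ _); apply/eqP/idP => [->|cI].
    by have /isolatedP[] := biso.
  exact: (isolated_end biso cI bw cw).
by rewrite !E ?white_end_in ?black_end_in.
Qed.

Definition is_white w := if w is inl _ then true else false.
Definition signed w (u : C) := if is_white w then u else u^-1.

Lemma prod_signed_star (P : pred (edge T)) (f : vertex T -> edge T -> C) :
  (forall b, P b -> f (white_end b) b = f (black_end b) b) ->
  (forall w b, P b -> f w b != 0) ->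
  \prod_w \prod_(b in star w | P b) signed w (f w b) = 1.
Proof.
move=> fwb f0; under eq_bigr do rewrite big_mkcondr.
rewrite (prod_star (fun w b => if P b then signed w (f w b) else 1)).
apply: big1 => b _; case: ifP => Pb; last by rewrite mulr1.
by rewrite /signed /= fwb // mulfV // f0.
Qed.

Lemma signed_prod w (P : pred (edge T)) (f : edge T -> C) :
  signed w (\prod_(b | P b) f b) = \prod_(b | P b) signed w (f b).
Proof. by rewrite /signed; case: (is_white w) => //; rewrite prodfV. Qed.

(* Multiplying all relations of the form w_F = w_F', the edges outside [I]
   cancel, and the relations at the isolated edges eliminate the vertices outside
   the cycle. *)
Lemma prod_rest_cycle : \prod_i signed (v i) (rest (v i)) = 1.
Proof.
have all1 : \prod_w signed w (rest w) = 1.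
  rewrite -[RHS](@prod_signed_star (fun b => b \notin I) (fun _ b => x b)) //.
    by apply: eq_bigr => w _; rewrite /rest signed_prod.
  by move=> _ b; rewrite x0.
have iso1 : \prod_w \prod_(b in star w | b \in isolated I) signed w (rest w) = 1.
  apply: (@prod_signed_star (mem (isolated I)) (fun w _ => rest w)).
    exact: rest_isolated.
  by move=> w b _; apply: rest_neq0.
rewrite (bigID (mem [set v i | i : 'I_(k.*2)]%SET)) /= in all1.
rewrite (big_imset _ (in2W v_inj)) /= in all1.
rewrite -[RHS]all1 -[LHS]mulr1; congr (_ * _).
rewrite -[LHS]iso1 (bigID (mem [set v i | i : 'I_(k.*2)]%SET)) /=.
rewrite [X in X * _]big1 ?mul1r => [|w /imsetP[i _ ->]]; last first.
  apply: big_pred0 => b; apply/negP => /andP[bv biso].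
  have /isolatedP[bI _] := biso; have [j e _] := star_v bI bv.
  have h := isolated_end biso (aI _) _ _.
  have e1 : a (ordS j) = b by apply: (h _ (v (ordS j))); rewrite ?e ?a_vS ?a_v.
  by have := a_ordS_neq j; rewrite e1 e eqxx.
apply: eq_bigr => w wv; have [c cI cw] := I_star w.
have cn i : c != a i.
  apply: contra wv => /eqP e; apply/imsetP; move: cw; rewrite e a_star.
  by case/orP => /eqP ->; [exists i|exists (ordS i)].
have ciso := a_rest cI cn.
rewrite (big_pred1 c) // => b /=; apply/andP/eqP => [[bw biso]|->//].
have /isolatedP[bI _] := biso; exact: (isolated_end ciso bI cw bw).
Qed.

Lemma is_white_ordS i : is_white (v (ordS i)) = ~~ is_white (v i).
Proof.
have := white_end_in (a i); have := black_end_in (a i); rewrite !a_star.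
by case/orP => /eqP <-; [case/orP => [//|/eqP <-]|case/orP => [/eqP <-|//]].
Qed.

(* The alternating partial products below solve, along the cycle, the relations
   at the odd edges for the coordinates at the even edges; they close up by
   [prod_rest_cycle]. *)
Definition factor (i : 'I_(k.*2)) : C := if odd i then rest (v i) else (rest (v i))^-1.

Lemma factor_neq0 i : factor i != 0.
Proof. by rewrite /factor; case: ifP; rewrite ?invr_eq0 rest_neq0. Qed.

Lemma prod_factor : \prod_i factor i = 1.
Proof.
have [/eqP k0|k_gt0] := posnP k.*2.
  by rewrite big1 // => -[m mk]; exfalso; move: mk; rewrite (eqP k0).
pose i0 := Ordinal k_gt0.
have W i : is_white (v i) = is_white (v i0) (+) odd i.
  have := cycle_ind (f := fun i => is_white (v i)) is_white_ordS i i0.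
  by rewrite /= addbF => <-; rewrite -addbA addbb addbF.
have [w0|w0] := boolP (is_white (v i0)).
  apply: invr_inj; rewrite invr1 -prodfV -[RHS]prod_rest_cycle.
  apply: eq_bigr => i _; rewrite /factor /signed W w0 addTb.
  by case: (odd i); rewrite ?invrK.
rewrite -[RHS]prod_rest_cycle.
by apply: eq_bigr => i _; rewrite /factor /signed W (negbTE w0) addFb.
Qed.

Definition partial m : C := \prod_(j : 'I_(k.*2) | (j < m)%N) factor j.

Lemma partialS (i : 'I_(k.*2)) : partial i.+1 = partial i * factor i.
Proof.
rewrite /partial (bigD1 i) //= mulrC; congr (_ * _); apply: eq_bigl => j.
by rewrite ltnS ltn_neqAle andbC.
Qed.

Lemma partial_neq0 m : partial m != 0.
Proof. by apply/prodf_neq0 => i _; apply: factor_neq0. Qed.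

Definition fill : rep R T := [ffun b =>
  if b \in I then
    if [pick i : 'I_(k.*2) | (a i == b) && ~~ odd i] is Some i then partial i.+1 else 0
  else x b].

Lemma fill_outside b : b \notin I -> fill b = x b.
Proof. by move=> bI; rewrite ffunE (negbTE bI). Qed.

Lemma fill_even (i : 'I_(k.*2)) : ~~ odd i -> fill (a i) = partial i.+1.
Proof.
move=> io; rewrite ffunE aI; case: pickP => [j /andP[/eqP/a_inj -> //]|/(_ i)].
by rewrite eqxx io.
Qed.

Lemma cosupport_fill : cosupport fill = (I :\: evens)%SET.
Proof.
apply/setP => b; rewrite inE finset.in_setD ffunE; case: ifP => bI; last first.
  by rewrite x0 bI andbF.
rewrite andbT; case: pickP => [i /andP[/eqP <- io]|no].
  by rewrite mem_evens io (negbTE (partial_neq0 _)).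
rewrite eqxx; apply/esym/negP => /imsetP[i io e].
by have := no i; rewrite e eqxx; move: io; rewrite inE => ->.
Qed.

Lemma fill_star b c w : b \in I -> c \in I -> c \in star w -> c != b ->
    (forall d, d \in I -> d \in star w -> d = b \/ d = c) ->
  \prod_(d in star w | d != b) fill d = fill c * rest w.
Proof.
move=> bI cI cw cb Iw; rewrite (bigD1 c) /= ?cw //; congr (_ * _).
apply: eq_big => d; last first.
  move=> /andP[/andP[dw db] dc]; apply: fill_outside; apply/negP => dI.
  by have [e|e] := Iw d dI dw; [case/eqP: db|case/eqP: dc].
have [dw|//] := boolP (d \in star w); rewrite /=.
have [dI|dI] := boolP (d \in I); last first.
  by apply/andP; split; apply: contra dI => /eqP ->.
by have [->|->] := Iw d dI dw; rewrite eqxx ?andbF.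
Qed.

(** For the last index the successor is 0 and both sides are 1 by [prod_factor]: here the solution
    closes up. *)
Lemma partial_wrap (i : 'I_(k.*2)) : odd i ->
  partial i.+1 = partial (ordS i).+1 * rest (v (ordS i)).
Proof.
move=> io; have ie : ~~ odd (ordS i) by rewrite odd_ordS io.
have fE : factor (ordS i) = (rest (v (ordS i)))^-1 by rewrite /factor (negbTE ie).
rewrite (partialS (ordS i)) fE divfK ?rest_neq0 //.
have [lt|ge] := ltnP i.+1 k.*2; first by rewrite /= modn_small.
have e : i.+1 = k.*2 by apply/eqP; rewrite eqn_leq ge ltn_ord.
rewrite /= e modnn /partial [RHS]big_pred0 // -[RHS]prod_factor.
by apply: eq_bigl => j; rewrite ltn_ord.
Qed.

Lemma fill_relations : satisfies_relations fill.
Proof.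
apply/relationsP => b.
(* For an edge outside the matching, both products contain the zero coordinate of a matching
   edge. *)
have zero : b \notin (I :\: evens)%SET -> forall w,
    \prod_(c in star w | c != b) fill c = 0.
  move=> bP w; have [m [mP mw] _] := matching_star matching_evens w.
  apply/eqP/prodf_eq0; exists m.
    by rewrite mw; apply: contraNneq bP => <-.
  by move: mP; rewrite -cosupport_fill inE.
have [bP|bP] := boolP (b \in (I :\: evens)%SET); last by rewrite !zero.
move: bP; rewrite finset.in_setD => /andP[bE bI].
have [/existsP[i /eqP bi]|nb] := boolP [exists i, b == a i]; last first.
  have bn i : b != a i by apply: contra nb => bi; apply/existsP; exists i.
  have biso := a_rest bI bn.
  have E w : b \in star w -> \prod_(c in star w | c != b) fill c = rest w.
    move=> bw; apply: eq_big => c; last first.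
      move=> /andP[cw cb]; apply: fill_outside; apply: contra cb => cI; apply/eqP.
      exact: (isolated_end biso cI bw cw).
    have [cw|//] := boolP (c \in star w); rewrite /=; congr (~~ _).
    by apply/eqP/idP => [->//|cI]; apply: (isolated_end biso cI bw cw).
  by rewrite !E ?white_end_in ?black_end_in // rest_isolated.
have io : odd i by move: bE; rewrite bi mem_evens negbK.
have [j ij] := ordS_surj i.
have je : ~~ odd j by rewrite -odd_ordS -ij.
(* An odd index is not 0, so its predecessor does not wrap around. *)
have jS : i = j.+1 :> nat.
  have [lt|ge] := ltnP j.+1 k.*2; first by rewrite ij /= modn_small.
  have e : j.+1 = k.*2 by apply/eqP; rewrite eqn_leq ge ltn_ord.
  by move: io; rewrite ij /= e modnn.
(* The relation at [a i] balances its two even neighbours: [fill (a j) * rest (v i)] against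
   [fill (a (ordS i)) * rest (v (ordS i))]. *)
have at_i : \prod_(c in star (v i) | c != b) fill c = partial i.+1.
  rewrite (@fill_star b (a j)) ?aI //; last first.
  - move=> d dI dw; have [h e ih] := star_v dI dw; rewrite e bi.
    case: ih => ih; [by left; rewrite -ih|right].
    by congr a; apply: ordS_inj; rewrite -ih -ij.
  - by rewrite bi ij eq_sym a_ordS_neq.
  - by rewrite ij a_vS.
  by rewrite fill_even // -jS partialS /factor io.
have at_Si : \prod_(c in star (v (ordS i)) | c != b) fill c = partial i.+1.
  rewrite (@fill_star b (a (ordS i))) ?aI //; last first.
  - move=> d dI dw; have [h e ih] := star_v dI dw; rewrite e bi.
    by case: ih => ih; [right; rewrite ih|left; congr a; apply: ordS_inj].
  - by rewrite bi a_ordS_neq.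
  - exact: a_v.
  by rewrite (partial_wrap io) fill_even // odd_ordS io.
have ends w : b \in star w -> \prod_(c in star w | c != b) fill c = partial i.+1.
  by rewrite {1}bi a_star => /orP[] /eqP ->.
by rewrite !ends ?white_end_in ?black_end_in.
Qed.

End Fill.

End Alternating.

Section Component.
Variables (T : brane_tiling) (I S : {set edge T}).
Implicit Types (b c : edge T) (w : vertex T).
Hypothesis S_component : component I S.

Lemma component_sub : S \subset I.
Proof.
have [b bI ->] := S_component; apply/fintype.subsetP => c; rewrite inE => bc.
have cl : closed (adjacent_in I) (mem I) by move=> d e /and3P[dI eI _]; rewrite dI eI.
by have := closed_connect cl bc; rewrite bI.
Qed.

Lemma component_closed b c w :
  b \in S -> c \in I -> b \in star w -> c \in star w -> c \in S.
Proof.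
move=> bS; have /fintype.subsetP/(_ b bS) bI := component_sub.
have [d dI e] := S_component; move: bS; rewrite e !inE => db cI bw cw.
apply: connect_trans db (connect1 _).
apply/and3P; split=> //.
by apply/existsP; exists w; rewrite bw.
Qed.

End Component.

Lemma eq_opp_rat (u : rat) : u = - u -> u = 0.
Proof.
move=> e; have /eqP : u *+ 2 = 0 by rewrite mulr2n {1}e addNr.
by rewrite mulrn_eq0 => /eqP.
Qed.

Section GraphCycle.
Variables (T : brane_tiling) (k : nat).
Variables (a : 'I_(k.*2) -> edge T) (v : 'I_(k.*2) -> vertex T).
Hypotheses (v_inj : injective v)
  (av : forall i, (a i \in star (v i)) && (a i \in star (v (ordS i)))).

Lemma cycle_ends i w : (a i \in star w) = (w == v i) || (w == v (ordS i)).
Proof.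
have vS : v i != v (ordS i).
  apply/eqP => /v_inj e; have := odd_ordS i; rewrite -e; by case: (odd i).
have /andP[] := av i; rewrite !in_star => /orP[] /eqP e1 /orP[] /eqP e2.
- by case/eqP: vS; rewrite e1 -e2.
- by rewrite -e1 -e2.
- by rewrite -e1 -e2 orbC.
- by case/eqP: vS; rewrite e1 -e2.
Qed.

Lemma sign_ordS i : sign (v (ordS i)) = - sign (v i).
Proof.
have := white_end_in (a i); have := black_end_in (a i); rewrite !cycle_ends.
by case/orP => /eqP <-; [case/orP => [//|/eqP <-]|case/orP => [/eqP <-|//]]; rewrite /= ?opprK.
Qed.

(** Rotating the cycle by one step changes every sign, so the sum is its own negative. *)
Lemma sum_sign_cycle : \sum_(w in [set v i | i : 'I_(k.*2)]%SET) sign w = 0.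
Proof.
rewrite (big_imset _ (in2W v_inj)) /=; apply: eq_opp_rat.
rewrite {1}(reindex_inj (@ordS_inj _)) -sumrN /=.
by apply: eq_bigr => i _; rewrite sign_ordS.
Qed.

End GraphCycle.

(** Results about the even edges thus apply to the odd ones, by rotating the cycle. *)
Lemma evens_rotate (T : brane_tiling) k (a : 'I_(k.*2) -> edge T) :
  evens (fun i => a (ordS i)) = odds a.
Proof.
apply/setP => b; apply/imsetP/imsetP => -[i io ->].
  by exists (ordS i) => //; move: io; rewrite !inE odd_ordS.
have [j ij] := ordS_surj i; exists j; last by rewrite -ij.
by move: io; rewrite !inE ij odd_ordS.
Qed.

(** * Degenerations of orbits *)

Section Closure.
Variables (R : realType) (T : brane_tiling) (theta : face T -> int).
Local Notation C := R[i].
Implicit Types (b : edge T) (x y z l : rep R T).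
Hypotheses (theta_B : in_B theta) (theta_generic : generic theta).
Local Notation SS := (semistable_locus (R := R) theta).
Local Notation orbit y := (orbit_M (moduli_point theta y)).


(* The one-parameter subgroup given by the difference of two perfect matchings
   degenerates [y] to [x]. *)
Lemma matching_closure x y (P : {set edge T}) : SS x -> SS y ->
    perfect_matching (cosupport y) -> perfect_matching P ->
    cosupport x = (cosupport y :|: P)%SET ->
    (forall b, b \notin cosupport x -> x b = y b) ->
  orbit x `<=` moduli_closure theta (orbit y).
Proof.
move=> xss yss yM PM xI xy m; rewrite orbit_M_moduli_point // => -[l lT ->{m}].
move=> Z /moduli_closedP[J JP] Zy.
have lxss := semistable_locus_act lT xss; apply/(JP _ lxss) => f Jf.
pose lam (s : 'I_1) : {ffun edge T -> int} :=
  [ffun b => (b \in P)%:Z - (b \in cosupport y)%:Z].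
have sumM (M : {set edge T}) w : perfect_matching M -> \sum_(b in star w) (b \in M)%:Z = 1.
  move=> MM; have [c [cM cw] cu] := matching_star MM w.
  rewrite (bigD1 c) //= cM big1 ?addr0 // => b /andP[bw bc].
  by case: (boolP (b \in M)) => // bM; case/eqP: bc; apply: cu.
have lam_star s v w : \sum_(b in star v) lam s b = \sum_(b in star w) lam s b.
  suff E u : \sum_(b in star u) lam s b = 0 by rewrite !E.
  under eq_bigr do rewrite ffunE.
  by rewrite sumrB !sumM // subrr.
(* [lam] is negative only on edges where [y] vanishes, so the curve [z] in the orbit of [y] has
   polynomial coordinates and extends to t = 0 with value [act l x]. *)
pose zc (b : edge T) : {poly C} :=
  if b \in P then (l b * y b)%:P * 'X else (l b * x b)%:P.
pose z (t : C) : rep R T := [ffun b => (zc b).[t]].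
have zE (t : C) : t != 0 -> z t = act (act l (one_param lam (fun=> t))) y.
  move=> t0; apply/ffunP => b; rewrite !ffunE big_ord1 ffunE /zc.
  have [/eqP yb|yb] := boolP (y b == 0).
    rewrite yb !mulr0; case: ifP => bP; first by rewrite hornerM hornerC mul0r.
    have /eqP -> : x b == 0.
      suff : b \in cosupport x by rewrite inE.
      by rewrite xI !inE yb eqxx.
    by rewrite mulr0 hornerC.
  have bn : b \notin cosupport y by rewrite inE.
  rewrite (negbTE bn) subr0; case: (boolP (b \in P)) => bP.
    by rewrite !hornerE expr1z mulrAC.
  by rewrite hornerC expr0z mulr1 xy // xI !inE negb_or yb.
have z0 : z 0 = act l x.
  apply/ffunP => b; rewrite !ffunE /zc; case: ifP => bP; last by rewrite hornerC.
  have /eqP -> : x b == 0.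
    suff : b \in cosupport x by rewrite inE.
    by rewrite xI !inE bP orbT.
  by rewrite mulr0 hornerM hornerX mulr0.
pose ev (t : C) (p : {poly C}) := p.[t].
have evD t p q : ev t (p + q) = ev t p + ev t q by rewrite /ev hornerD.
have evM t p q : ev t (p * q) = ev t p * ev t q by rewrite /ev hornerM.
have evC t (c : C) : ev t c%:P = c by rewrite /ev hornerC.
have [|g [d gd]] := @regular_meval _ _ _ setT ev _ evD evM evC _
    (fun t h => z t (enum_val h)) f.
  move=> h; apply: (eq_regular (regular_ev setT evC (zc (enum_val h)))) => t _.
  by rewrite ffunE.
(* The factor ['X] takes care of t = 0, where the equations of [Z] are not yet known to hold. *)
have /eqP : g * 'X = 0.
  apply: poly_vanishing => t; rewrite hornerM hornerX.
  have [->|t0] := eqVneq t 0; first by rewrite mulr0.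
  have [_ e] := gd t I; rewrite -[g.[t]]/(ev t g) -e; suff -> : f.@[fun h => z t (enum_val h)] = 0 by rewrite !mul0r.
  have tT : torus_Lambda (one_param lam (fun=> t)) by apply: one_param_Lambda.
  have ltT := torus_LambdaM lT tT; have lyss := semistable_locus_act ltT yss.
  rewrite zE //; apply: (JP _ lyss).1 Jf; apply: Zy.
  by rewrite orbit_M_moduli_point //; exists (act l (one_param lam (fun=> t))).
rewrite mulf_eq0 polyX_eq0 orbF => /eqP g0.
have [d0] := gd 0 I; rewrite g0 /ev horner0 -[X in X * _]/(peval (z 0) f) z0 => /eqP.
by rewrite mulf_eq0 (negbTE d0) orbF => /eqP.
Qed.

(** The vanishing of one coordinate is a closed condition on M_theta, invariant under the torus. *)
Lemma closure_cosupport x y : SS x -> SS y ->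
  orbit x `<=` moduli_closure theta (orbit y) -> cosupport y \subset cosupport x.
Proof.
move=> xss yss xy; apply/fintype.subsetP => b; rewrite !inE => yb.
have xX : orbit x (moduli_point theta x).
  rewrite orbit_M_moduli_point //; exists [ffun=> 1]; first exact: torus_Lambda1.
  by rewrite act1.
have := xy _ xX (vanishing theta [set coord b]).
case; [exact: moduli_closed_vanishing| |].
  move=> m; rewrite orbit_M_moduli_point // => -[l lT ->].
  have lyss := semistable_locus_act lT yss; split; first exact: moduli_moduli_point.
  move=> z p; rewrite moduli_pointE // => -[h hB <-] ->.
  rewrite peval_coord; apply/eqP; rewrite act_eq0 ?act_eq0 //.
  exact: torus_B_Lambda.
move=> _ /(_ x (coord b)); rewrite moduli_pointE // peval_coord => xb.
by apply/eqP/xb => //; apply: orbit_B_refl.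
Qed.

Lemma orbit_cosupport y : SS y -> orbit_has_cosupport theta (orbit y) (cosupport y).
Proof.
move=> yss z zss; rewrite orbit_M_moduli_point // => -[l lT e].
have lyss := semistable_locus_act lT yss.
have : moduli_point theta z z by rewrite moduli_pointE //; apply: orbit_B_refl.
rewrite e moduli_pointE // => -[h hB <-].
by rewrite !cosupport_act //; apply: torus_B_Lambda.
Qed.

Lemma orbit_act y l : SS y -> torus_Lambda l -> orbit (act l y) = orbit y.
Proof.
move=> yss lT; have lyss := semistable_locus_act lT yss.
rewrite !orbit_M_moduli_point //; apply/seteqP; split=> _ [h hT ->].
  by exists (act h l); [exact: torus_LambdaM|rewrite actA].
exists (act h (torus_inv l)); first exact/torus_LambdaM/torus_LambdaV.
by rewrite -actA act_invK.
Qed.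

End Closure.

Section Evens.
Variables (R : realType) (T : brane_tiling) (theta : face T -> int).
Hypotheses (theta_B : in_B theta) (theta_generic : generic theta).
Hypothesis balanced : nwhite T = nblack T.
Local Notation SS := (semistable_locus (R := R) theta).
Local Notation orbit y := (orbit_M (moduli_point theta y)).

Variables (x : rep R T) (k : nat).
Variables (a : 'I_(k.*2) -> edge T) (v : 'I_(k.*2) -> vertex T).
Hypotheses (xss : SS x) (a_inj : injective a) (v_inj : injective v)
  (av : forall i, (a i \in star (v i)) && (a i \in star (v (ordS i))))
  (aI : forall i, a i \in cosupport x)
  (I_star : forall w, exists2 b, b \in cosupport x & b \in star w)
  (a_rest : forall b, b \in cosupport x -> (forall i, b != a i) ->
    b \in isolated (cosupport x)).

Let a_star := cycle_ends v_inj av.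

Lemma odds_matching : perfect_matching (cosupport x :\: odds a)%SET.
Proof.
rewrite -evens_rotate; apply: (@matching_evens _ _ _ _ (fun i => v (ordS i))) => //.
- by move=> i j /v_inj /ordS_inj.
- by move=> b bI bn; apply: a_rest => // i; have [j ->] := ordS_surj i.
- by move=> i j /a_inj /ordS_inj.
Qed.

Lemma evens_odds : cosupport x = ((cosupport x :\: evens a) :|: (cosupport x :\: odds a))%SET.
Proof.
rewrite -finset.setDIr; suff -> : (evens a :&: odds a = finset.set0)%SET by rewrite finset.setD0.
apply/setP => b; rewrite finset.in_setI finset.in_set0; apply/negP.
by case/andP => /imsetP[i io ->]; rewrite mem_odds // => ie; move: io; rewrite inE ie.
Qed.

Lemma fill_ss : SS (fill (cosupport x) a v x).
Proof.
split; first exact: fill_relations xss.1 erefl.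
apply: semistable_cosupport xss.2; rewrite cosupport_fill //.
exact: finset.subsetDl.
Qed.

Lemma evens_orbit : exists2 y, SS y &
  [/\ cosupport y = (cosupport x :\: evens a)%SET,
      has_dimension theta (orbit y) 2
    & orbit x `<=` moduli_closure theta (orbit y)].
Proof.
have yI := cosupport_fill v a_inj (erefl (cosupport x)).
exists (fill (cosupport x) a v x); first exact: fill_ss.
have yM : perfect_matching (cosupport (fill (cosupport x) a v x)).
  rewrite yI; exact: (matching_evens v_inj a_star aI I_star a_rest a_inj).
split=> //; first exact: (matching_dimension theta_B theta_generic balanced fill_ss).
apply: (matching_closure theta_B theta_generic xss fill_ss yM odds_matching).
  by rewrite yI -evens_odds.
by move=> b bI; rewrite fill_outside.
Qed.

End Evens.

(* The edges a_1, ..., a_{2k} are a 0, ..., a (2k - 1). *)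
Theorem corollary4p19 (R : realType) (T : brane_tiling)
    (consistent : geometrically_consistent R T)
    (theta : face T -> int) (theta_B : in_B theta)
    (theta_generic : generic theta)
    (x : rep R T) (x_semistable : semistable_locus theta x)
    (x_dim1 : has_dimension theta (orbit_M (moduli_point theta x)) 1)
    (k : nat) (a : 'I_(k.*2) -> edge T)
    (a_cycle : graph_cycle a)
    (a_big : big_component (cosupport x) [set a i | i : 'I_(k.*2)]%SET) :
  let I1 := cosupport x :\: [set a i | i : 'I_(k.*2) & ~~ odd i]%SET in
  let I2 := cosupport x :\: [set a i | i : 'I_(k.*2) & odd i]%SET in
  [/\ exists O1 O2 : set (set (rep R T)),
        [/\ O1 <> O2,
            forall O : set (set (rep R T)),
              [/\ is_orbit_M theta O, has_dimension theta O 2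
                & orbit_M (moduli_point theta x) `<=` moduli_closure theta O]
              <-> O = O1 \/ O = O2,
            orbit_has_cosupport theta O1 I1
          & orbit_has_cosupport theta O2 I2],
      forall P : {set edge T},
        perfect_matching P /\ P \subset cosupport x <-> P = I1 \/ P = I2
    & cosupport x = I1 :|: I2].
Proof.
have balanced := consistent_balanced consistent.
have [a_inj [v v_inj av]] := a_cycle.
have [a_comp a_card] := a_big.
have k_gt0 : (0 < k)%N.
  move: a_card; rewrite card_imset // cardT size_enum_ord => h.
  by rewrite -double_gt0 (ltn_trans _ h).
have k2_gt0 : (0 < k.*2)%N by rewrite double_gt0.
pose i0 := Ordinal k2_gt0.
have a_star := cycle_ends v_inj av.
have memC i : a i \in [set a i | i : 'I_(k.*2)]%SET by apply/imsetP; exists i.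
have aI i : a i \in cosupport x.
  by have /fintype.subsetP := component_sub a_comp; apply.
have I_star w := cosupport_star w x_semistable.1 (aI i0).
have in_cycle b i : b \in cosupport x -> b \in star (v i) -> exists j, b = a j.
  move=> bI bv; have /imsetP[j _ ->] := component_closed a_comp (memC i) bI
    (a_v (fun i w => a_star i w) i) bv.
  by exists j.
have not_iso i : a i \notin isolated (cosupport x).
  apply/negP => /isolatedP[_ /(_ (a (ordS i)) (v (ordS i)) (aI _))] h.
  have := a_ordS_neq a_inj i; rewrite h ?eqxx //; [exact: a_vS|exact: a_v].
have a_rest b : b \in cosupport x -> (forall i, b != a i) ->
    b \in isolated (cosupport x).
  (* The vertices of the cycle are balanced and carry a whole component of the cosupport, so in
     dimension 1 all other edges of the cosupport are isolated. *)
  move=> bI bn; pose V := [set v i | i : 'I_(k.*2)]%SET.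
  have VP c w : c \in cosupport x -> c \in star w -> w \in V -> exists i, c = a i.
    by move=> cI cw /imsetP[i _ wi]; apply: (in_cycle _ i) => //; rewrite -wi.
  have VaV i w : a i \in star w -> w \in V.
    by rewrite a_star => /orP[] /eqP ->; apply/imsetP; eexists.
  apply: (unique_big_part theta_B theta_generic balanced x_semistable x_dim1
    (V := V) (b := a i0)) => //.
  - move=> c cI; apply/idP/idP => /VP h.
      by have [i e] := h _ cI (white_end_in c); apply: (VaV i); rewrite -e black_end_in.
    by have [i e] := h _ cI (black_end_in c); apply: (VaV i); rewrite -e white_end_in.
  - exact: sum_sign_cycle v_inj av.
  - move=> c ciso; apply/negP => /VP h; have /isolatedP[cI _] := ciso.
    have [i e] := h _ cI (white_end_in c); have := not_iso i; by rewrite -e ciso.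
  - by apply: (VaV i0); rewrite white_end_in.
  apply/negP => /VP h; have [i e] := h _ bI (white_end_in b).
  by have := bn i; rewrite e eqxx.
pose a' i := a (ordS i); pose v' i := v (ordS i).
have a'_inj : injective a' by move=> i j /a_inj /ordS_inj.
have v'_inj : injective v' by move=> i j /v_inj /ordS_inj.
have a'_rest b : b \in cosupport x -> (forall i, b != a' i) -> b \in isolated (cosupport x).
  by move=> bI bn; apply: a_rest => // i; have [j ->] := ordS_surj i; apply: bn.
have [y1 y1ss [y1I y1d y1c]] := evens_orbit theta_B theta_generic balanced
  x_semistable a_inj v_inj av aI I_star a_rest.
have [y2 y2ss [y2I y2d y2c]] := evens_orbit theta_B theta_generic balanced
  x_semistable a'_inj v'_inj (fun i => av (ordS i)) (fun i => aI (ordS i)) I_star a'_rest.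
rewrite /a' evens_rotate in y2I.
have y1M := dimension_matching theta_B theta_generic balanced y1ss y1d.
have y2M := dimension_matching theta_B theta_generic balanced y2ss y2d.
move=> I1 I2; rewrite -[I1]y1I -[I2]y2I.
have matchings (P : {set edge T}) : perfect_matching P /\ P \subset cosupport x <->
    P = cosupport y1 \/ P = cosupport y2.
  rewrite y1I y2I; split=> [[PM PI]|].
    exact: (matching_evens_odds v_inj a_star aI a_rest a_inj k_gt0 PM PI).
  by rewrite -y1I -y2I => -[->|->]; split=> //; rewrite ?y1I ?y2I finset.subsetDl.
split=> //; last by rewrite y1I y2I; exact: evens_odds.
exists (orbit_M (moduli_point theta y1)), (orbit_M (moduli_point theta y2)).
have y12 : cosupport y1 <> cosupport y2.
  move=> e; have : a i0 \in cosupport y2 by rewrite y2I finset.in_setD mem_odds ?aI.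
  by rewrite -e y1I finset.in_setD mem_evens.
have self (y : rep R T) : semistable_locus theta y ->
    orbit_M (moduli_point theta y) (moduli_point theta y).
  move=> yss; rewrite (orbit_M_moduli_point theta_B theta_generic) //.
  by exists [ffun=> 1]; [exact: torus_Lambda1|rewrite act1].
have cosP (y : rep R T) (yss : semistable_locus theta y) := orbit_cosupport theta_B theta_generic yss.
split; [|move=> O; split| exact: cosP| exact: cosP].
- move=> e; apply: y12; apply: esym; apply: (cosP y1 y1ss y2 y2ss).
  by rewrite e; apply: self.
- case=> [[m [y yss <-] ->] yd yc].
  have yM := dimension_matching theta_B theta_generic balanced yss yd.
  have yI := closure_cosupport theta_B theta_generic x_semistable yss yc.
  have [|e|e] := (matchings (cosupport y)).1; first by [].
  + left; have [l lT ->] := matching_orbit y1ss yss (esym e) y1M.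
    exact: orbit_act.
  + right; have [l lT ->] := matching_orbit y2ss yss (esym e) y2M.
    exact: orbit_act.
- have is_orbit (y : rep R T) : semistable_locus theta y -> is_orbit_M theta (orbit_M (moduli_point theta y)).
    by move=> yss; exists (moduli_point theta y) => //; exists y.
  by case=> ->; split=> //; apply: is_orbit.
Qed.
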